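(* Let $\mathscr T=(V,\mathcal E)$ be the directed Cartesian product of rooted directed trees $\mathscr T_1,\dots,\mathscr T_d$ and let $S_{\boldsymbol\lambda}$ be a commuting toral contractive multishift on $\mathscr T$. Let $W=\bigcup_{\alpha\in\mathbb N^d,\ \alpha\le k_{\mathscr T}}\mathsf{Chi}^{\langle\alpha\rangle}(\mathsf{root})$ and $\tilde W=W_1\times\dots\times W_d$, where $W_j=\mathsf{Chi}(V^{(j)}_\prec)\cup\{\mathsf{root}_j\}$. Then the following are equivalent: (i) $S_{\boldsymbol\lambda}$ is joint subnormal; (ii) for every $v\in W$ the multisequence $\{\|S^\alpha_{\boldsymbol\lambda}e_v\|^2\}_{\alpha\in\mathbb N^d}$ is completely monotone; (iii) for every $v\in\tilde W$ the multisequence $\{\|S^\alpha_{\boldsymbol\lambda}e_v\|^2\}_{\alpha\in\mathbb N^d}$ is completely monotone.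
   Context: Directed trees: no loops or circuits, connected ignoring orientation, unique parent for each vertex with an incoming edge; rooted: unique parentless vertex $\mathsf{root}$; $\mathsf{Chi}(u)=\{v:(u,v)\in\mathcal E\}$, $\mathsf{Chi}(W)=\bigcup_{u\in W}\mathsf{Chi}(u)$; all trees leafless. Depth of $u$: $n$ with $u\in\mathsf{Chi}^n(\mathsf{root})$. $V^{(j)}_\prec=\{u\in V_j:\mathrm{card}\,\mathsf{Chi}(u)\ge2\}$; branching index $k_{\mathscr T_j}=1+\sup\{\text{depth}(w):w\in V^{(j)}_\prec\}$ if $V^{(j)}_\prec\ne\emptyset$, else $0$ (possibly $\infty$); $k_{\mathscr T}=(k_{\mathscr T_1},\dots,k_{\mathscr T_d})$, and $\alpha\le\beta$ is componentwise. Directed Cartesian product: $V=V_1\times\dots\times V_d$ (countably infinite), $(v,w)\in\mathcal E$ iff for some $k$, $(v_k,w_k)\in\mathcal E_k$ and $w_j=v_j$ ($j\ne k$); $\mathsf{root}=(\mathsf{root}_j)$. $\mathsf{Chi}_j(v)=\{w:w_j\in\mathsf{Chi}(v_j),w_k=v_k\ (k\neq j)\}$, $\mathsf{Chi}_j$ of a set is the union, and $\mathsf{Chi}^{\langle\alpha\rangle}(v)=\mathsf{Chi}_1^{\alpha_1}\cdots\mathsf{Chi}_d^{\alpha_d}(v)$ (iterates). Multishift: positive weights, $S_je_v=\sum_{w\in\mathsf{Chi}_j(v)}\lambda^{(j)}_we_w$, bounded on $l^2(V)$, $S^\alpha=S_1^{\alpha_1}\cdots S_d^{\alpha_d}$.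 Toral contraction: $S_j^*S_j\le I$ for each $j$. Joint subnormal: restriction of a commuting normal tuple on a larger space. A function $\phi$ on $\mathbb N^d$ is completely monotone if $(\nabla^\beta\phi)(\alpha)\ge0$ for all $\alpha,\beta$, where $(\nabla_j\phi)(\alpha)=\phi(\alpha)-\phi(\alpha+\epsilon_j)$ and $\nabla^\beta=\nabla_1^{\beta_1}\cdots\nabla_d^{\beta_d}$. *)

(* Defs.v *)
From HB Require Import structures.
From mathcomp Require Import all_boot all_order all_algebra.
From mathcomp Require Import all_classical all_reals.
From mathcomp Require Import ereal esum.
From mathcomp Require Import complex.

Set Implicit Arguments.
Unset Strict Implicit.
Unset Printing Implicit Defensive.

Import Order.TTheory GRing.Theory Num.Theory.
Local Open Scope classical_set_scope.
Local Open Scope ring_scope.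

Definition directed_tree (U : Type) (E : U -> U -> Prop) : Prop :=
  [/\ (forall u, ~ E u u),
      (forall (n : nat) (p : nat -> U), (0 < n)%N ->
          (forall i, (i < n)%N -> E (p i) (p i.+1)) -> p n <> p 0%N),
      (forall u v, exists (n : nat) (p : nat -> U),
          [/\ p 0%N = u, p n = v &
              forall i, (i < n)%N -> E (p i) (p i.+1) \/ E (p i.+1) (p i)])
    & (forall u v w, E v u -> E w u -> v = w)].

Definition rooted_directed_tree (U : Type) (E : U -> U -> Prop) (root : U) :=
  [/\ directed_tree E,
      (forall u, ~ E u root)
    & (forall u, u <> root -> exists p, E p u)].

Definition leafless (U : Type) (E : U -> U -> Prop) : Prop :=
  forall u, exists v, E u v.

Fixpoint ChiN (U : Type) (E : U -> U -> Prop) (root : U) (n : nat) : set U :=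
  match n with
  | 0%N => [set root]
  | n'.+1 => [set v | exists u, ChiN E root n' u /\ E u v]
  end.

Definition Vprec (U : Type) (E : U -> U -> Prop) : set U :=
  [set u | exists x y, [/\ x <> y, E u x & E u y]].

Definition branching_index (R : realType) (U : Type) (E : U -> U -> Prop)
    (root : U) : \bar R :=
  if `[< exists u, Vprec E u >] then
    (1 + ereal_sup [set (n%:R)%:E | n in
                    [set n : nat | exists w, Vprec E w /\ ChiN E root n w]])%E
  else 0%E.

Definition prodV (d : nat) (U : 'I_d -> countType) := forall j : 'I_d, U j.

Definition ChiV (d : nat) (U : 'I_d -> countType)
    (E : forall j, U j -> U j -> Prop) (j : 'I_d) (A : set (prodV U))
    : set (prodV U) :=
  [set w | exists v, [/\ A v, E j (v j) (w j) &
                         forall k, k != j -> w k = v k]].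

Definition ChiAlpha (d : nat) (U : 'I_d -> countType)
    (E : forall j, U j -> U j -> Prop) (alpha : 'I_d -> nat)
    (A : set (prodV U)) : set (prodV U) :=
  foldr (fun j B => iter (alpha j) (ChiV E j) B) A (enum 'I_d).

Definition sqmod (R : realType) (z : R[i]) : R :=
  match z with Complex a b => a ^+ 2 + b ^+ 2 end.

Definition l2 (R : realType) (I : choiceType) (f : I -> R[i]) : Prop :=
  (\esum_(i in [set: I]) (sqmod (f i))%:E < +oo)%E.

Definition nrm2 (R : realType) (I : choiceType) (f : I -> R[i]) : R :=
  fine (\esum_(i in [set: I]) (sqmod (f i))%:E).

(* inner product (linear in the first variable), by polarization *)
Definition inner (R : realType) (I : choiceType) (f g : I -> R[i]) : R[i] :=
  4%:R^-1 * \sum_(k < 4) ('i ^+ k * (nrm2 (fun x => f x + 'i ^+ k * g x))%:C)%C.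

Definition op (R : realType) (I : choiceType) := (I -> R[i]) -> (I -> R[i]).

Definition bounded_op (R : realType) (I : choiceType) (T : op R I) : Prop :=
  [/\ (forall f, l2 f -> l2 (T f)),
      (forall (a : R[i]) f g, l2 f -> l2 g ->
          T (fun x => a * f x + g x) = (fun x => a * T f x + T g x))
    & exists c : R, forall f, l2 f -> nrm2 (T f) <= c * nrm2 f].

Definition is_adjoint (R : realType) (I : choiceType) (T T' : op R I) : Prop :=
  bounded_op T' /\
  forall f g, l2 f -> l2 g -> inner (T f) g = inner f (T' g).

Definition normal_op (R : realType) (I : choiceType) (T : op R I) : Prop :=
  bounded_op T /\
  exists T', is_adjoint T T' /\ forall f, l2 f -> T' (T f) = T (T' f).

Definition commute_op (R : realType) (I : choiceType) (A B : op R I) : Prop :=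
  forall f, l2 f -> A (B f) = B (A f).

(* Joint subnormality of a d-tuple S of operators on l^2(V):
   there are a Hilbert space K (realized, via an orthonormal basis, as
   l^2(I) for some index type I), an isometric linear embedding
   J : l^2(V) -> K and a commuting d-tuple N of normal operators on K
   with N_j J = J S_j for every j. *)
Definition joint_subnormal (R : realType) (d : nat) (V : choiceType)
    (S : 'I_d -> op R V) : Prop :=
  exists (I : choiceType) (J : (V -> R[i]) -> (I -> R[i])) (N : 'I_d -> op R I),
    [/\ [/\ (forall f, l2 f -> l2 (J f)),
           (forall (a : R[i]) f g, l2 f -> l2 g ->
               J (fun x => a * f x + g x) = (fun x => a * J f x + J g x))
         & (forall f, l2 f -> nrm2 (J f) = nrm2 f)],
        (forall j, normal_op (N j)),
        (forall j k, commute_op (N j) (N k))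
      & (forall j f, l2 f -> N j (J f) = J (S j f))].

Definition parent (U : choiceType) (E : U -> U -> Prop) (x : U) : U :=
  xget x [set p | E p x].

(* S_j e_v = sum_{w in Chi_j(v)} lambda^(j)_w e_w, i.e.
   (S_j f)(w) = lambda^(j)_w f(par_j w) if w_j is not the root, else 0. *)
Definition multishift (R : realType) (d : nat) (U : 'I_d -> countType)
    (E : forall j, U j -> U j -> Prop) (root : forall j, U j)
    (lam : 'I_d -> prodV U -> R) (j : 'I_d) : op R (prodV U) :=
  fun f w => if w j == root j then 0
             else ((lam j w)%:C * f (@dfwith _ (fun k => U k) w j (parent (E j) (w j))))%C.

Definition opPow (R : realType) (d : nat) (I : choiceType)
    (S : 'I_d -> op R I) (alpha : 'I_d -> nat) : op R I :=
  foldr (fun j T => fun f => iter (alpha j) (S j) (T f)) id (enum 'I_d).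

Definition basis_vec (R : realType) (I : choiceType) (v : I) : I -> R[i] :=
  fun w => if w == v then 1 else 0.

Definition shift_e (d : nat) (alpha : 'I_d -> nat) (j : 'I_d) : 'I_d -> nat :=
  fun i => (alpha i + (i == j))%N.

Definition nabla (R : realType) (d : nat) (j : 'I_d)
    (phi : ('I_d -> nat) -> R) : ('I_d -> nat) -> R :=
  fun alpha => phi alpha - phi (shift_e alpha j).

Definition nablaPow (R : realType) (d : nat) (beta : 'I_d -> nat)
    (phi : ('I_d -> nat) -> R) : ('I_d -> nat) -> R :=
  foldr (fun j psi => iter (beta j) (nabla j) psi) phi (enum 'I_d).

Definition completely_monotone (R : realType) (d : nat)
    (phi : ('I_d -> nat) -> R) : Prop :=
  forall alpha beta : 'I_d -> nat, 0 <= nablaPow beta phi alpha.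

(* Main.v *)
Require Import Defs.
From HB Require Import structures.
From mathcomp Require Import all_boot all_order all_algebra.
From mathcomp Require Import all_classical all_reals.
From mathcomp Require Import ereal esum.
From mathcomp Require Import complex.
From mathcomp Require Import sequences exp.
From mathcomp Require Import ring lra zify.
Import Order.TTheory GRing.Theory Num.Theory.
Import Normc.
Local Open Scope classical_set_scope.
Local Open Scope ring_scope.

Set Implicit Arguments.
Unset Strict Implicit.
Unset Printing Implicit Defensive.

(** Necessity.  If N is a commuting normal extension of S, Fuglede's theorem
    makes all N_j and N_k^* commute.  On the vectors with bounded N-orbit,
    which contain l2(V) because S is contractive, subtracting from a positive
    N-compatible form B the form B(N_j x, N_j y) leaves a positive form; after
    |beta| subtractions the value on N^alpha x is (nabla^beta phi)(alpha).

    Sufficiency.  Commutativity of S gives a potential L on the vertices with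
    S^m e_v = sum of (L(y) / L(v)) e_y over the m-th descendants y of v, so that
    psi_v(m) := L(v)^2 ||S^m e_v||^2 satisfies
    psi_v(k + m) = sum of psi_x(m) over the k-th descendants x of v.
    If psi_v is the moment sequence of nu_v, then t^(-depth v) nu_v is additive
    under passing to children, and S becomes multiplication by sqrt(t) exp(i theta)
    on a space of functions of an end of the tree, of t and of theta.  The inner
    products of the functions N^*a N^r e_v in that model only involve psi; they
    form the kernel [kernel] below.  Its positivity is proved without measures, by
    Bernstein approximation, and a Gram-Schmidt (GNS) construction then turns it into
    commuting normal operators on l2(nat).

    Finally, a vertex whose parent (in one coordinate) has no other child has
    the shifted sequence psi of that parent, so complete monotonicity propagates
    from the vertices of W-tilde to all vertices. *)

(** * Absolutely summable real families *)

(** The normal extension in the definition may have norm larger than 1, and in the sufficiency part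
    no bound on the operators of the kernel space is known beforehand. One positivity lemma settles
    both: a commuting tuple that commutes with its adjoints is contractive on every vector whose
    orbit is bounded. It gives the monotonicity for a given extension, and the continuity of the
    operators for the constructed one.

    The kernel is indexed by the symbols N^*a N^r e_v because this set is stable under N and under
    its adjoint. Both act on symbols by raising an exponent, so commutation is immediate and
    adjointness is one identity between kernel values; all the analysis lies in the positivity.

    Fuglede's theorem and Gram-Schmidt are carried out on bare modules with a positive form, without
    completeness. Hence (1 + zN'/n)^n replaces the exponential of zN', N' being the adjoint, and
    bounded maps are built coordinatewise on l2 from their values on a basis. *)

Lemma max0B (R : realDomainType) (u : R) : Num.max u 0 - Num.max (- u) 0 = u.
Proof. by case: (leP u 0) => ?; case: (leP (- u) 0) => ?; lra. Qed.

Section RealSums.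
Variables (R : realType) (I : choiceType).
Implicit Types (f g : I -> R) (s : seq I).

Definition rsummable f := (\esum_(x in [set: I]) (`|f x|)%:E < +oo)%E.

(** [esum] is additive only on non-negative families, hence the two parts. [fine] turns an infinite
    sum into 0, so the value is meaningful only under [rsummable]. *)
Definition rsum f : R :=
  fine (\esum_(x in [set: I]) (Num.max (f x) 0)%:E) -
  fine (\esum_(x in [set: I]) (Num.max (- f x) 0)%:E).

Lemma esum_seq_le (f : I -> \bar R) s : uniq s ->
  (\sum_(x <- s) f x <= \esum_(x in [set: I]) f x)%E.
Proof.
move=> us; apply: esum_ge; exists [set` s].
  by split=> //; exact: finite_seq.
by rewrite (fsbig_seq _ f us) lexx.
Qed.

Lemma esum_le_seq (f : I -> \bar R) (c : \bar R) :
  (forall s, uniq s -> (\sum_(x <- s) f x <= c)%E) ->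
  (\esum_(x in [set: I]) f x <= c)%E.
Proof.
move=> H; apply: ge_ereal_sup => _ [A [fA _] <-].
by rewrite fsbig_finite //=; apply: H; exact: finmap.fset_uniq.
Qed.

Lemma esum_fin_num (f : I -> R) : (forall x, 0 <= f x) -> rsummable f ->
  (\esum_(x in [set: I]) (f x)%:E)%E \is a fin_num.
Proof.
move=> f0; rewrite /rsummable; under eq_esum do rewrite ger0_norm //.
move=> fi; rewrite ge0_fin_numE //; apply: esum_ge0 => x _; by rewrite lee_fin.
Qed.

Lemma rsummable_le f g : (forall x, `|f x| <= g x) -> rsummable g -> rsummable f.
Proof.
move=> fg; apply: le_lt_trans; apply: le_esum => x _; rewrite lee_fin.
by apply: le_trans (fg x) (ler_norm _).
Qed.

Lemma rsummableD f g : rsummable f -> rsummable g -> rsummable (fun x => f x + g x).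
Proof.
move=> sf sg; apply: (@le_lt_trans _ _
  (\esum_(x in [set: I]) ((`|f x|)%:E + (`|g x|)%:E))%E).
  by apply: le_esum => x _; rewrite -EFinD lee_fin ler_normD.
by rewrite esumD ?lte_add_pinfty // => x _; rewrite lee_fin.
Qed.

Lemma rsummableN f : rsummable f -> rsummable (fun x => - f x).
Proof. by rewrite /rsummable; under [in X in _ -> X]eq_esum do rewrite normrN. Qed.

Lemma rsummableB f g : rsummable f -> rsummable g -> rsummable (fun x => f x - g x).
Proof. by move=> sf sg; apply: rsummableD => //; exact: rsummableN. Qed.

Lemma rsummable_bounded f (c : R) : (forall x, 0 <= f x) ->
  (forall s, uniq s -> \sum_(x <- s) f x <= c) -> rsummable f.
Proof.
move=> f0 fc; apply: (@le_lt_trans _ _ c%:E); last by rewrite ltry.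
apply: esum_le_seq => s us; rewrite sumEFin lee_fin; apply: le_trans (fc s us).
by apply: ler_sum => x _; rewrite ger0_norm.
Qed.

(** With p, n the positive and negative parts of [f], one has p + h = g + n pointwise, and all four
    sums are finite. This reduces additivity of [rsum] to that of non-negative sums. *)
Lemma rsumE f g h : (forall x, 0 <= g x) -> (forall x, 0 <= h x) ->
  rsummable g -> rsummable h -> (forall x, f x = g x - h x) ->
  rsum f = fine (\esum_(x in [set: I]) (g x)%:E) - fine (\esum_(x in [set: I]) (h x)%:E).
Proof.
move=> g0 h0 sg sh fgh.
have sf : rsummable f.
  by rewrite (_ : f = fun x => g x - h x); [exact: rsummableB | apply/funext].
pose p x := Num.max (f x) 0; pose n x := Num.max (- f x) 0.
have p0 x : 0 <= p x by rewrite le_max lexx orbT.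
have n0 x : 0 <= n x by rewrite le_max lexx orbT.
have sp : rsummable p.
  apply: (rsummable_le (g := fun x => `|f x|)).
    by move=> x; rewrite ger0_norm // ge_max ler_norm normr_ge0.
  by move: sf; rewrite /rsummable; under [in X in _ -> X]eq_esum do rewrite normr_id.
have sn : rsummable n.
  apply: (rsummable_le (g := fun x => `|f x|)).
    by move=> x; rewrite ger0_norm // ge_max -normrN ler_norm normr_ge0.
  by move: sf; rewrite /rsummable; under [in X in _ -> X]eq_esum do rewrite normr_id.
have E : (\esum_(x in [set: I]) (p x)%:E + \esum_(x in [set: I]) (h x)%:E =
          \esum_(x in [set: I]) (g x)%:E + \esum_(x in [set: I]) (n x)%:E)%E.
  rewrite -!esumD; try by move=> x _; rewrite lee_fin.
  apply: eq_esum => x _; rewrite -!EFinD; congr EFin.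
  by have := max0B (f x); rewrite /p /n fgh; lra.
have [Fp Fn] := (esum_fin_num p0 sp, esum_fin_num n0 sn).
have [Fg Fh] := (esum_fin_num g0 sg, esum_fin_num h0 sh).
move/(congr1 fine): E; rewrite !fineD // /rsum -/p -/n => E.
by lra.
Qed.

Lemma rsum_nneg f : (forall x, 0 <= f x) ->
  rsum f = fine (\esum_(x in [set: I]) (f x)%:E).
Proof.
move=> f0; rewrite /rsum [X in _ - fine X]esum1; last first.
  by move=> x _; congr EFin; apply/max_idPr; rewrite oppr_le0.
rewrite /= subr0; congr fine; apply: eq_esum => x _; congr EFin.
by apply/max_idPl.
Qed.

Let pos_part_summable f : rsummable f -> rsummable (fun x => Num.max (f x) 0).
Proof.
move=> sf; apply: (rsummable_le (g := fun x => `|f x|)).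
  by move=> x; rewrite ger0_norm ?ge_max ?ler_norm ?normr_ge0 // le_max lexx orbT.
by move: sf; rewrite /rsummable; under [in X in _ -> X]eq_esum do rewrite normr_id.
Qed.

Lemma rsumD f g : rsummable f -> rsummable g ->
  rsum (fun x => f x + g x) = rsum f + rsum g.
Proof.
move=> sf sg.
have m0 (u : R) : 0 <= Num.max u 0 by rewrite le_max lexx orbT.
have [a b] := (pos_part_summable sf, pos_part_summable (rsummableN sf)).
have [c d] := (pos_part_summable sg, pos_part_summable (rsummableN sg)).
rewrite (@rsumE _ (fun x => Num.max (f x) 0 + Num.max (g x) 0)
  (fun x => Num.max (- f x) 0 + Num.max (- g x) 0)).
- under eq_esum do rewrite EFinD; under [X in _ - fine X]eq_esum do rewrite EFinD.
  rewrite !esumD; try by move=> x _; rewrite lee_fin.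
  rewrite !fineD; try exact: esum_fin_num.
  by rewrite /rsum opprD addrACA.
- by move=> x; rewrite addr_ge0.
- by move=> x; rewrite addr_ge0.
- exact: rsummableD.
- exact: rsummableD.
- by move=> x; have := max0B (f x); have := max0B (g x); lra.
Qed.

Lemma rsumN f : rsum (fun x => - f x) = - rsum f.
Proof. by rewrite /rsum opprB; congr (_ - fine _); apply: eq_esum => x _; rewrite opprK. Qed.

Lemma rsumB f g : rsummable f -> rsummable g ->
  rsum (fun x => f x - g x) = rsum f - rsum g.
Proof. by move=> sf sg; rewrite rsumD ?rsumN //; exact: rsummableN. Qed.

Lemma rsum_ge0 f : (forall x, 0 <= f x) -> 0 <= rsum f.
Proof.
by move=> f0; rewrite rsum_nneg // fine_ge0 // esum_ge0 // => x _; rewrite lee_fin.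
Qed.


Lemma rsum_nneg_EFin f : (forall x, 0 <= f x) -> rsummable f ->
  (rsum f)%:E = (\esum_(x in [set: I]) (f x)%:E)%E.
Proof. by move=> f0 sf; rewrite rsum_nneg // fineK //; exact: esum_fin_num. Qed.

Lemma sum_le_rsum f s : (forall x, 0 <= f x) -> rsummable f -> uniq s ->
  \sum_(x <- s) f x <= rsum f.
Proof.
move=> f0 sf us; rewrite -lee_fin rsum_nneg_EFin // -sumEFin.
exact: esum_seq_le.
Qed.

Lemma rsum_le_bound f (c : R) : (forall x, 0 <= f x) ->
  (forall s, uniq s -> \sum_(x <- s) f x <= c) -> rsum f <= c.
Proof.
move=> f0 fc; rewrite -lee_fin rsum_nneg_EFin //; last exact: rsummable_bounded fc.
by apply: esum_le_seq => s us; rewrite sumEFin lee_fin fc.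
Qed.

Lemma rsum_approx f (e : R) : (forall x, 0 <= f x) -> rsummable f -> 0 < e ->
  exists2 s, uniq s & rsum f - e < \sum_(x <- s) f x.
Proof.
move=> f0 sf e0; apply: contrapT => H.
suff : rsum f <= rsum f - e by lra.
apply: rsum_le_bound => // s us; rewrite leNgt; apply/negP => Hs.
by apply: H; exists s.
Qed.

Lemma sum_subset_uniq (f : I -> R) s t : (forall x, 0 <= f x) -> uniq s -> uniq t ->
  {subset s <= t} -> \sum_(x <- s) f x <= \sum_(x <- t) f x.
Proof.
move=> f0 us ut st; rewrite [leRHS](bigID (mem s)) /= -[leLHS]addr0.
rewrite -[X in _ <= X + _]big_filter [X in _ <= X + _](perm_big s).
  by rewrite lerD2l sumr_ge0.
apply: uniq_perm; rewrite ?filter_uniq // => x; rewrite mem_filter.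
by case xs: (x \in s); rewrite //= ?st.
Qed.

Lemma sum_supp_uniq (f : I -> R) s t : (forall x, x \notin s -> f x = 0) -> uniq s -> uniq t ->
  \sum_(x <- t) f x = \sum_(x <- [seq x <- s | x \in t]) f x.
Proof.
move=> f0 us ut; rewrite (bigID (mem s)) /= [X in _ + X]big1 ?addr0; last first.
  by move=> x /f0.
rewrite -[in LHS]big_filter; apply: perm_big; apply: uniq_perm; rewrite ?filter_uniq //.
by move=> x; rewrite !mem_filter /= andbC.
Qed.

Lemma rsummable_supp f s : uniq s -> (forall x, x \notin s -> f x = 0) -> rsummable f.
Proof.
move=> us f0; suff : rsummable (fun x => `|f x|).
  by apply: rsummable_le => x.
apply: (@rsummable_bounded _ (\sum_(x <- s) `|f x|)) => // t ut.
rewrite (sum_supp_uniq (s := s)) //; last by move=> x /f0 ->; rewrite normr0.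
apply: sum_subset_uniq; rewrite ?filter_uniq // => x.
by rewrite mem_filter => /andP[].
Qed.

Lemma rsum_supp f s : uniq s -> (forall x, x \notin s -> f x = 0) ->
  rsum f = \sum_(x <- s) f x.
Proof.
suff H g : (forall x, 0 <= g x) -> uniq s -> (forall x, x \notin s -> g x = 0) ->
    fine (\esum_(x in [set: I]) (g x)%:E) = \sum_(x <- s) g x.
  move=> us f0; rewrite /rsum !H //; try by move=> x; rewrite le_max lexx orbT.
  - by rewrite -sumrB; apply: eq_bigr => x _; exact: max0B.
  - by move=> x /f0 ->; rewrite oppr0 maxxx.
  - by move=> x /f0 ->; rewrite maxxx.
move=> g0 us gs; rewrite -rsum_nneg //; apply/eqP; rewrite eq_le; apply/andP; split.
  apply: rsum_le_bound => // t ut; rewrite (sum_supp_uniq gs) //.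
  by apply: sum_subset_uniq; rewrite ?filter_uniq // => x; rewrite mem_filter => /andP[].
by apply: sum_le_rsum => //; exact: rsummable_supp gs.
Qed.

Lemma rsummableZ (c : R) f : rsummable f -> rsummable (fun x => c * f x).
Proof.
move=> sf; suff : rsummable (fun x => `|c| * `|f x|).
  by apply: rsummable_le => x; rewrite normrM.
apply: (@rsummable_bounded _ (`|c| * rsum (fun x => `|f x|))) => [x|s us].
  by rewrite mulr_ge0.
rewrite -mulr_sumr ler_wpM2l //; apply: sum_le_rsum => //.
by move: sf; rewrite /rsummable; under [in X in _ -> X]eq_esum do rewrite normr_id.
Qed.

Lemma rsumZ (c : R) f : rsummable f -> rsum (fun x => c * f x) = c * rsum f.
Proof.
(* Two reductions: first to a non-negative scalar, then to a non-negative family. *)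
suff H (a : R) g : 0 <= a -> (forall x, 0 <= g x) -> rsummable g ->
    rsum (fun x => a * g x) = a * rsum g.
  suff H' a g : 0 <= a -> rsummable g -> rsum (fun x => a * g x) = a * rsum g.
    move=> sf; have [c0|c0] := leP 0 c; first exact: H'.
    rewrite -[c]opprK [RHS]mulNr -H' //; last by rewrite oppr_ge0 ltW.
    by rewrite -rsumN; congr rsum; apply/funext => x; rewrite mulNr.
  move=> a0 sg; pose p x := Num.max (g x) 0; pose n x := Num.max (- g x) 0.
  have m0 (u : R) : 0 <= Num.max u 0 by rewrite le_max lexx orbT.
  have [sp sn] := (pos_part_summable sg, pos_part_summable (rsummableN sg)).
  have gpn : g = fun x => p x - n x.
    by apply/funext => x; rewrite /p /n max0B.
  rewrite {2}gpn rsumB // mulrBr -!H; try by move=> x; exact: m0.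
  - rewrite -rsumB; try exact: rsummableZ.
    by congr rsum; apply/funext => x; rewrite -mulrBr {1}gpn.
  - done.
  - done.
  - done.
  - done.
move=> a0 g0 sg; apply/eqP; rewrite eq_le; apply/andP; split.
  apply: rsum_le_bound => [x|s us]; first by rewrite mulr_ge0.
  by rewrite -mulr_sumr ler_wpM2l //; apply: sum_le_rsum.
have [->|an0] := eqVneq a 0.
  by rewrite mul0r; apply: rsum_ge0 => x; rewrite mul0r.
rewrite mulrC -ler_pdivlMr ?lt_def ?an0 //; apply: rsum_le_bound => // s us.
rewrite ler_pdivlMr ?lt_def ?an0 // mulrC mulr_sumr.
by apply: sum_le_rsum => //; [move=> x; rewrite mulr_ge0 | exact: rsummableZ].
Qed.

Lemma rsummable_sum (J : Type) (r : seq J) (F : J -> I -> R) :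
  (forall j, rsummable (F j)) -> rsummable (fun x => \sum_(j <- r) F j x).
Proof.
move=> sF; elim: r => [|j r IH].
  by apply: (rsummable_supp (s := [::])) => // x _; rewrite big_nil.
suff -> : (fun x => \sum_(j0 <- j :: r) F j0 x) =
  (fun x => F j x + \sum_(j <- r) F j x) by exact: rsummableD.
by apply/funext => x; rewrite big_cons.
Qed.

Lemma rsum_sum (J : Type) (r : seq J) (F : J -> I -> R) :
  (forall j, rsummable (F j)) ->
  rsum (fun x => \sum_(j <- r) F j x) = \sum_(j <- r) rsum (F j).
Proof.
move=> sF; elim: r => [|j r IH].
  by rewrite big_nil (rsum_supp (s := [::])) ?big_nil // => x _; rewrite big_nil.
rewrite big_cons -IH -rsumD //; last exact: rsummable_sum.
by congr rsum; apply/funext => x; rewrite big_cons.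
Qed.

Lemma rsum_eq0 f : (forall x, 0 <= f x) -> rsummable f -> rsum f = 0 -> forall x, f x = 0.
Proof.
move=> f0 sf S0 x; apply/eqP; rewrite eq_le f0 andbT -S0.
by have := @sum_le_rsum f [:: x] f0 sf isT; rewrite big_seq1.
Qed.

End RealSums.

(** * Positive semidefinite sesquilinear forms *)

Section ComplexFacts.
Variable R : realType.
Implicit Types z w : R[i].

Lemma sqmodE z : sqmod z = complex.Re z ^+ 2 + complex.Im z ^+ 2.
Proof. by case: z. Qed.

Lemma sqmod_ge0 z : 0 <= sqmod z.
Proof. by rewrite sqmodE addr_ge0 ?sqr_ge0. Qed.

Lemma normc_sqrt z : normc z = Num.sqrt (sqmod z).
Proof. by case: z. Qed.

Lemma normc_ge0 z : 0 <= normc z.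
Proof. by rewrite normc_sqrt sqrtr_ge0. Qed.

Lemma normc_sqr z : normc z ^+ 2 = sqmod z.
Proof. by rewrite normc_sqrt sqr_sqrtr ?sqmod_ge0. Qed.

Lemma sqmodM z w : sqmod (z * w) = sqmod z * sqmod w.
Proof. by rewrite -!normc_sqr normcM exprMn. Qed.

Lemma sqmod_conj z : sqmod (z^*)%C = sqmod z.
Proof. by case: z => a b /=; rewrite sqrrN. Qed.

Lemma mulc_conj z : z * (z^*)%C = (sqmod z)%:C%C.
Proof.
by case: z => a b /=; apply/eqP; rewrite eq_complex /=; apply/andP; split; apply/eqP; ring.
Qed.

Lemma conjcM z w : ((z * w)^*)%C = (z^*)%C * (w^*)%C.
Proof. exact: rmorphM. Qed.

Lemma conjcD z w : ((z + w)^*)%C = (z^*)%C + (w^*)%C.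
Proof. exact: rmorphD. Qed.

Lemma sqmod_real (a : R) : sqmod (a%:C%C) = a ^+ 2.
Proof. by rewrite /= expr0n addr0. Qed.

Lemma sqmod0 : sqmod (0 : R[i]) = 0.
Proof. by rewrite /= expr0n addr0. Qed.

Lemma sqmod1 : sqmod (1 : R[i]) = 1.
Proof. by rewrite /= expr0n expr1n addr0. Qed.

Lemma sqmod_eq0 z : sqmod z = 0 -> z = 0.
Proof. by move=> E; apply: eq0_normc; rewrite normc_sqrt E sqrtr0. Qed.

Lemma normc_real (a : R) : normc (a%:C%C) = `|a|.
Proof. by rewrite normc_sqrt sqmod_real sqrtr_sqr. Qed.

Lemma normc_conj z : normc (z^*)%C = normc z.
Proof. by rewrite !normc_sqrt sqmod_conj. Qed.

Lemma Re_le_normc z : `|complex.Re z| <= normc z.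
Proof.
by rewrite normc_sqrt -sqrtr_sqr; apply: ler_wsqrtr; rewrite sqmodE lerDl sqr_ge0.
Qed.

Lemma normcX z n : normc (z ^+ n) = normc z ^+ n.
Proof. by elim: n => [|n IH]; rewrite ?expr0 ?normc1 // !exprS normcM IH. Qed.

Lemma normc_sum (J : Type) (r : seq J) (F : J -> R[i]) :
  normc (\sum_(j <- r) F j) <= \sum_(j <- r) normc (F j).
Proof.
elim: r => [|j r IH]; first by rewrite !big_nil normc0.
by rewrite !big_cons (le_trans (le_normcD _ _)) // lerD2l.
Qed.

(** Iterated square roots of -1 satisfy w^(2^k) = -1, so the order divides 2^(k+1) but not 2^k.
    Powers of two suffice because only roots of arbitrarily large order are needed. *)
Lemma prim_root_pow2 k : exists w : R[i], (2 ^ k.+1).-primitive_root w.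
Proof.
have : exists w : R[i], w ^+ (2 ^ k) = -1.
  exists (iter k (@sqrtc R) (-1)); elim: k => // k IH.
  by rewrite iterS expnS exprM sqr_sqrtc.
case=> w wk; exists w.
have w1 : w ^+ (2 ^ k.+1) = 1 by rewrite expnS mulnC exprM wk sqrrN expr1n.
have [m pm] := prim_order_exists (expn_gt0 2 k.+1 : (0 < 2 ^ k.+1)%N) w1.
move/dvdn_pfactor => /(_ isT) [j jk jm]; move: pm; rewrite jm.
move: jk; rewrite leq_eqVlt => /orP[/eqP -> //|jk] pm.
have : w ^+ (2 ^ k) = 1.
  by apply/eqP; rewrite -(prim_order_dvd pm) dvdn_exp2l.
by rewrite wk => /eqP; rewrite eq_sym -addr_eq0 -(natrD _ 1 1) pnatr_eq0.
Qed.

Lemma sum_prim_root n (w : R[i]) j : n.-primitive_root w ->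
  \sum_(t < n) w ^+ (t * j) = if (n %| j)%N then n%:R else 0.
Proof.
move=> pw; rewrite (prim_order_dvd pw); case: eqP => [wj|/eqP wj].
  rewrite (eq_bigr (fun=> 1)); first by rewrite sumr_const card_ord.
  by move=> t _; rewrite mulnC exprM wj expr1n.
apply: (mulfI (x := w ^+ j - 1)); first by rewrite subr_eq0.
rewrite mulr0 (eq_bigr (fun t : 'I_n => (w ^+ j) ^+ t)).
  by rewrite -subrX1 -exprM mulnC exprM (prim_expr_order pw) expr1n subrr.
by move=> t _; rewrite mulnC exprM.
Qed.

(* Average [z^-1 p(z)] over the points [r w^t], where [w] is a primitive root of
   unity of order larger than [m]. *)
Lemma cauchy_coef1 (p : nat -> R[i]) m (r M : R) : (1 < m)%N -> 0 <= r ->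
  (forall z, normc z = r -> normc (\sum_(k < m) z ^+ k * p k) <= M) ->
  r * normc (p 1%N) <= M.
Proof.
move=> m1 r0 H; have [w pw] := prim_root_pow2 m.
set n := (2 ^ m.+1)%N in pw; have n0 : (0 < n)%N by rewrite expn_gt0.
have mn : (m.+1 < n)%N by apply: ltn_expl.
clearbody n.
have w1 : normc w = 1.
  apply/eqP; rewrite -(pexpr_eq1 n0 (normc_ge0 w)) -normcX (prim_expr_order pw) normc1.
  by [].
(* [w ^+ (t * n.-1)] stands for w^(-t). Since n > m + 1, degree 1 is the only degree below m that is
   congruent to 1 modulo n. *)
have E : \sum_(t < n) w ^+ (t * n.-1) * (\sum_(k < m) (r%:C%C * w ^+ t) ^+ k * p k)
    = n%:R * r%:C%C * p 1%N.
  transitivity (\sum_(k < m) (r%:C%C ^+ k * p k) * \sum_(t < n) w ^+ (t * (n.-1 + k))).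
    under eq_bigr do rewrite mulr_sumr.
    rewrite exchange_big /=; apply: eq_bigr => k _; rewrite mulr_sumr.
    apply: eq_bigr => t _; rewrite mulnDr exprD exprMn -exprM; ring.
  rewrite (bigD1 (Ordinal m1)) //= [X in _ + X]big1 ?addr0 => [|k kn1].
    rewrite (sum_prim_root _ pw) expr1 addn1 prednK // dvdnn; ring.
  rewrite (sum_prim_root _ pw); case: ifP; last by rewrite mulr0.
  case/dvdnP => q Hq; have := ltn_ord k; move: kn1; rewrite -val_eqE /= => k1 km.
  suff : q = 1%N by move=> q1; move: Hq; rewrite q1; lia.
  by have : (q < 2)%N by [nia]; have : (0 < q)%N by [nia]; lia.
have : normc (n%:R * r%:C%C * p 1%N) <= n%:R * M.
  rewrite -E (le_trans (normc_sum _ _)) //.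
  rewrite (_ : n%:R * M = \sum_(t < n) M); last first.
    by rewrite sumr_const card_ord mulr_natl.
  apply: ler_sum => t _; rewrite normcM normcX w1 expr1n mul1r; apply: H.
  by rewrite normcM normcX w1 expr1n mulr1 normc_real ger0_norm.
rewrite !normcM normc_real (ger0_norm r0) -mulrA.
have -> : normc (n%:R : R[i]) = n%:R.
  by rewrite -(rmorph_nat (real_complex R)) normc_real ger0_norm.
by rewrite ler_pM2l // ltr0n.
Qed.

End ComplexFacts.

(** A positive form that may be degenerate: it serves for l2 and for the polynomial module of the
    GNS construction. Positivity concerns the real part; symmetry makes [hf x x] real. *)
Record hform (R : realType) (H : lmodType R[i]) := HForm {
  hf :> H -> H -> R[i];
  hf_lin : forall a x y z, hf (a *: x + y) z = a * hf x z + hf y z;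
  hf_sym : forall x y, hf y x = (hf x y)^*%C;
  hf_pos : forall x, 0 <= complex.Re (hf x x) }.

Definition islin (K : pzRingType) (H H' : lmodType K) (A : H -> H') :=
  forall a x y, A (a *: x + y) = a *: A x + A y.

Section Lin.
Variables (K : pzRingType) (H H' : lmodType K) (A : H -> H').
Hypothesis linA : islin A.

Lemma islinD x y : A (x + y) = A x + A y.
Proof. by rewrite -{1}[x]scale1r linA scale1r. Qed.
Lemma islin0 : A 0 = 0.
Proof. by apply: (addrI (A 0)); rewrite -islinD !addr0. Qed.
Lemma islinZ a x : A (a *: x) = a *: A x.
Proof. by rewrite -[a *: x]addr0 linA islin0 addr0. Qed.
Lemma islinN x : A (- x) = - A x.
Proof. by rewrite -scaleN1r islinZ scaleN1r. Qed.
Lemma islinB x y : A (x - y) = A x - A y.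
Proof. by rewrite islinD islinN. Qed.
Lemma islin_sum (J : Type) (r : seq J) (F : J -> H) :
  A (\sum_(j <- r) F j) = \sum_(j <- r) A (F j).
Proof.
by elim: r => [|j r IH]; rewrite ?big_nil ?islin0 // !big_cons islinD IH.
Qed.
End Lin.

(** * Cauchy-Schwarz and the seminorm of a positive form *)

Section HForm.
Variables (R : realType) (H : lmodType R[i]) (B : hform H).
Implicit Types x y z : H.

Definition hq x := complex.Re (B x x).
Definition hn x := Num.sqrt (hq x).

Lemma hfDl x y z : B (x + y) z = B x z + B y z.
Proof. by rewrite -{1}[x]scale1r hf_lin mul1r. Qed.
Lemma hf0l z : B 0 z = 0.
Proof. by apply: (addrI (B 0 z)); rewrite -hfDl !addr0. Qed.
Lemma hfZl a x z : B (a *: x) z = a * B x z.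
Proof. by rewrite -[a *: x]addr0 hf_lin hf0l addr0. Qed.
Lemma hfNl x z : B (- x) z = - B x z.
Proof. by rewrite -scaleN1r hfZl mulN1r. Qed.
Lemma hfBl x y z : B (x - y) z = B x z - B y z.
Proof. by rewrite hfDl hfNl. Qed.
Lemma hfDr x y z : B x (y + z) = B x y + B x z.
Proof. by rewrite hf_sym hfDl conjcD -!hf_sym. Qed.
Lemma hf0r x : B x 0 = 0.
Proof. by rewrite hf_sym hf0l conjc0. Qed.
Lemma hfZr a x y : B x (a *: y) = (a^*)%C * B x y.
Proof. by rewrite hf_sym hfZl conjcM -hf_sym. Qed.
Lemma hfNr x y : B x (- y) = - B x y.
Proof. by rewrite hf_sym hfNl rmorphN /= -hf_sym. Qed.
Lemma hf_suml (J : Type) (r : seq J) (F : J -> H) z :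
  B (\sum_(j <- r) F j) z = \sum_(j <- r) B (F j) z.
Proof. by elim: r => [|j r IH]; rewrite ?big_nil ?hf0l // !big_cons hfDl IH. Qed.
Lemma hf_sumr (J : Type) (r : seq J) (F : J -> H) z :
  B z (\sum_(j <- r) F j) = \sum_(j <- r) B z (F j).
Proof. by elim: r => [|j r IH]; rewrite ?big_nil ?hf0r // !big_cons hfDr IH. Qed.

Lemma hqE x : B x x = (hq x)%:C%C.
Proof.
have := hf_sym B x x; rewrite /hq; case: (B x x) => a b /= [] bb.
by congr Complex; lra.
Qed.

Lemma hq_ge0 x : 0 <= hq x. Proof. exact: hf_pos. Qed.
Lemma hn_ge0 x : 0 <= hn x. Proof. exact: sqrtr_ge0. Qed.
Lemma hn_sqr x : hn x ^+ 2 = hq x. Proof. by rewrite sqr_sqrtr ?hq_ge0. Qed.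

Lemma hqZ a x : hq (a *: x) = sqmod a * hq x.
Proof.
rewrite /hq hfZl hfZr mulrA mulc_conj hqE -rmorphM /=.
by rewrite /hq.
Qed.

Lemma hqD x y : hq (x + y) = hq x + hq y + 2 * complex.Re (B x y).
Proof.
rewrite /hq hfDl !hfDr (hf_sym B x y).
by case: (B x x) (B x y) (B y y) => [a b] [c d] [e f] /=; ring.
Qed.

Lemma hqN x : hq (- x) = hq x.
Proof. by rewrite -scaleN1r hqZ sqmodE /= oppr0 expr0n addr0 sqrrN expr1n mul1r. Qed.

Lemma hqB x y : hq (x - y) = hq x + hq y - 2 * complex.Re (B x y).
Proof. by rewrite hqD hqN hfNr; case: (B x y) => a b /=; ring. Qed.

Lemma hq0 : hq 0 = 0. Proof. by rewrite /hq hf0l. Qed.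

Lemma cauchy_schwarz x y : sqmod (B x y) <= hq x * hq y.
Proof.
(* The form at x - t B(x,y) y for real t; the best choice is t = 1 / hq y. *)
have K (t : R) : 0 <= hq x - 2 * t * sqmod (B x y) + t ^+ 2 * sqmod (B x y) * hq y.
  have := hq_ge0 (x - (t%:C%C * B x y) *: y).
  rewrite hqB hqZ hfZr conjcM conjc_real sqmodM sqmod_real.
  rewrite -[_ * B x y]mulrA [(B x y)^*%C * _]mulrC mulc_conj -rmorphM /=; lra.
have s0 := sqmod_ge0 (B x y).
have [y0|] := eqVneq (hq y) 0.
  rewrite y0 mulr0; move: K; rewrite y0 => K.
  rewrite leNgt; apply/negP => sp.
  (* When [hq y = 0], this t makes the expression equal to -1. *)
  have := K ((hq x + 1) / (2 * sqmod (B x y))).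
  rewrite mulr0 addr0 (_ : 2 * ((hq x + 1) / (2 * sqmod (B x y))) * sqmod (B x y) = hq x + 1).
    by lra.
  by field; rewrite gt_eqF.
move=> yn0; have yp : 0 < hq y by rewrite lt_def yn0 hq_ge0.
have := K (hq y)^-1.
rewrite (_ : _ - _ + _ = hq x - sqmod (B x y) / hq y); last by field.
by rewrite subr_ge0 ler_pdivrMr.
Qed.

Lemma normc_hf_le x y : normc (B x y) <= hn x * hn y.
Proof.
rewrite normc_sqrt /hn -sqrtrM ?hq_ge0 //; apply: ler_wsqrtr.
exact: cauchy_schwarz.
Qed.

Lemma hnD x y : hn (x + y) <= hn x + hn y.
Proof.
rewrite -(@ler_pXn2r _ 2) ?nnegrE ?addr_ge0 ?hn_ge0 // hn_sqr hqD sqrrD !hn_sqr.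
have := le_trans (le_trans (ler_norm _) (Re_le_normc _)) (normc_hf_le x y).
by rewrite mulr2n; lra.
Qed.

Lemma hnZ a x : hn (a *: x) = normc a * hn x.
Proof. by rewrite /hn hqZ sqrtrM ?sqmod_ge0 // normc_sqrt. Qed.

Lemma hnN x : hn (- x) = hn x. Proof. by rewrite /hn hqN. Qed.

Lemma hf_null x y : hq x = 0 -> B x y = 0.
Proof.
move=> x0; apply: sqmod_eq0; apply/eqP; rewrite eq_le sqmod_ge0 andbT.
by have := cauchy_schwarz x y; rewrite x0 mul0r.
Qed.

End HForm.

(** * Fuglede's theorem *)

Section Steps.
Variables (R : realType) (H : lmodType R[i]).
Implicit Types (A D T : H -> H) (w z : R[i]) (x y : H).

(** The n-th iterate at w = z/n plays the part of the exponential of zA in the Fuglede argument;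
    being a polynomial in z, it requires no limit in [H]. *)
Definition step w A x := x + w *: A x.

Lemma step_lin w A : islin A -> islin (step w A).
Proof.
move=> lA a x y; rewrite /step lA scalerDr scalerDr !scalerA addrACA.
by rewrite [w * a]mulrC.
Qed.

Lemma iter_lin n A : islin A -> islin (iter n A).
Proof. by move=> lA a x y; elim: n => //= n ->; rewrite lA. Qed.

Lemma step_comm w z A D x : islin A -> islin D -> (forall y, A (D y) = D (A y)) ->
  step w A (step z D x) = step z D (step w A x).
Proof.
move=> lA lD AD; rewrite /step (islinD lA) (islinD lD) (islinZ lA) (islinZ lD) !scalerDr !scalerA AD.
by rewrite [w * z]mulrC -!addrA; congr (_ + _); rewrite addrCA.
Qed.

Lemma step_comm_id w A D x : islin D -> (forall y, A (D y) = D (A y)) ->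
  step w A (D x) = D (step w A x).
Proof. by move=> lD AD; rewrite /step (islinD lD) (islinZ lD) AD. Qed.

Lemma iter_comm n A D x : (forall y, A (D y) = D (A y)) -> iter n A (D x) = D (iter n A x).
Proof. by move=> AD; elim: n => //= n ->. Qed.

Lemma iter_comm2 n m A D x : (forall y, A (D y) = D (A y)) ->
  iter n A (iter m D x) = iter m D (iter n A x).
Proof.
move=> AD; apply: iter_comm => y; symmetry; apply: iter_comm => u.
by rewrite AD.
Qed.

Lemma iter_comp n A D x : (forall y, A (D y) = D (A y)) ->
  iter n A (iter n D x) = iter n (fun y => A (D y)) x.
Proof.
move=> AD; elim: n => //= n <-; congr A.
by rewrite [LHS](@iter_comm n A D) // => y.
Qed.

Lemma stepM w A x : islin A ->
  step w A (step (- w) A x) = step (- w ^+ 2) (fun y => A (A y)) x.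
Proof.
move=> lA; rewrite /step (islinD lA) (islinZ lA) scalerDr scalerA mulrN -expr2.
by rewrite -addrA; congr (_ + _); rewrite addrA -scalerDl addNr scale0r add0r.
Qed.

(** A polynomial in z with coefficients in [H]. Only degrees 0 and 1 are recorded, because the
    Cauchy estimate is applied to the linear coefficient. *)
Definition vpoly (F : R[i] -> H) m (a b : H) :=
  exists v : nat -> H, [/\ forall z, F z = \sum_(k < m) z ^+ k *: v k,
    (forall k, (m <= k)%N -> v k = 0), v 0%N = a & v 1%N = b].

Lemma vpoly_const x : vpoly (fun=> x) 1 x 0.
Proof.
exists (fun k => if k == 0%N then x else 0); split=> // [z|[|k]//].
by rewrite big_ord1 expr0 scale1r.
Qed.

Lemma vpoly_map F m a b T : islin T -> vpoly F m a b -> vpoly (fun z => T (F z)) m (T a) (T b).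
Proof.
move=> lT [v [Fv v0 va vb]]; exists (fun k => T (v k)); split; rewrite ?va ?vb //.
  by move=> z; rewrite Fv (islin_sum lT); apply: eq_bigr => k _; rewrite (islinZ lT).
by move=> k /v0 ->; rewrite (islin0 lT).
Qed.

Lemma vpoly_step F m a b A (c : R[i]) : islin A -> (0 < m)%N -> vpoly F m a b ->
  vpoly (fun z => step (c * z) A (F z)) m.+1 a (b + c *: A a).
Proof.
move=> lA m0 [v [Fv v0 va vb]].
exists (fun k => v k + if k is k'.+1 then c *: A (v k') else 0); split.
- move=> z; under eq_bigr do rewrite scalerDr.
  rewrite big_split /= big_ord_recr /= v0 // scaler0 addr0 -Fv /step; congr (_ + _).
  rewrite big_ord_recl /= scaler0 add0r Fv (islin_sum lA) scaler_sumr.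
  apply: eq_bigr => k _; rewrite (islinZ lA) !scalerA exprS; congr (_ *: _); ring.
- case=> // k km; rewrite v0 ?add0r; last exact: ltnW.
  by rewrite v0 // (islin0 lA) scaler0.
- by rewrite va addr0.
- by rewrite vb va.
Qed.

Lemma vpoly_iter n F m a b A (c : R[i]) : islin A -> (0 < m)%N -> vpoly F m a b ->
  vpoly (fun z => iter n (step (c * z) A) (F z)) (n + m) a (b + (n%:R * c) *: A a).
Proof.
move=> lA m0 Fab; elim: n => [|n IH].
  by rewrite mul0r scale0r addr0.
have /= := vpoly_step c lA _ IH; rewrite addSn addn_gt0 m0 orbT => /(_ isT).
by rewrite -addrA -scalerDl -[n.+1]addn1 natrD mulrDl mul1r.
Qed.

Variable B : hform H.

Lemma hn_step w A (c : R) x : (forall x, hn B (A x) <= c * hn B x) ->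
  hn B (step w A x) <= (1 + normc w * c) * hn B x.
Proof.
move=> Ac; rewrite (le_trans (hnD _ _ _)) // hnZ mulrDl mul1r lerD2l -mulrA.
by rewrite ler_wpM2l ?normc_ge0.
Qed.

Lemma hn_iter n A (c : R) x : 0 <= c -> (forall x, hn B (A x) <= c * hn B x) ->
  hn B (iter n A x) <= c ^+ n * hn B x.
Proof.
move=> c0 Ac; elim: n => [|n IH]; first by rewrite expr0 mul1r.
by rewrite /= (le_trans (Ac _)) // exprS -mulrA ler_wpM2l.
Qed.

Lemma hn_iter_step_sub n w A (c : R) x : islin A -> 0 <= c ->
  (forall x, hn B (A x) <= c * hn B x) ->
  hn B (iter n (step w A) x - x) <= ((1 + normc w * c) ^+ n - 1) * hn B x.
Proof.
move=> lA c0 Ac; elim: n => [|n IH].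
  by rewrite /= subrr expr0 subrr mul0r /hn hq0 sqrtr0.
have b0 : 0 <= 1 + normc w * c by rewrite addr_ge0 ?mulr_ge0 ?normc_ge0.
rewrite iterS {1}/step addrAC (le_trans (hnD _ _ _)) //.
have H1 := hn_iter n x b0 (fun x => hn_step w x Ac).
have H2 : hn B (w *: A (iter n (step w A) x)) <=
    normc w * c * ((1 + normc w * c) ^+ n * hn B x).
  rewrite hnZ -mulrA ler_wpM2l ?normc_ge0 // (le_trans (Ac _)) //.
  by rewrite ler_wpM2l.
by apply: (le_trans (lerD IH H2)); rewrite exprS le_eqVlt; apply/orP; left; apply/eqP; ring.
Qed.

Lemma hf_step_adj w A D x y : (forall x y, B (A x) y = B x (D y)) ->
  B (step w A x) y = B x (step (w^*)%C D y).
Proof. by move=> AD; rewrite /step hfDl hfDr hfZl hfZr conjcK AD. Qed.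

Lemma hf_iter_adj n A D x y : (forall x y, B (A x) y = B x (D y)) ->
  B (iter n A x) y = B x (iter n D y).
Proof.
move=> AD; elim: n x y => //= n IH x y.
by rewrite AD IH -iterSr.
Qed.

End Steps.

(** * Rosenblum's argument with finite products *)

Section Fuglede.
Variables (R : realType) (H : lmodType R[i]) (B : hform H).
Variables (N N' T : H -> H) (c cT : R).
Hypotheses (lN : islin N) (lN' : islin N') (lT : islin T).
Hypothesis adjN : forall x y, B (N x) y = B x (N' y).
Hypothesis NN' : forall x, N (N' x) = N' (N x).
Hypotheses (c0 : 0 <= c) (cT0 : 0 <= cT).
Hypothesis bN : forall x, hn B (N x) <= c * hn B x.
Hypothesis bT : forall x, hn B (T x) <= cT * hn B x.
Hypothesis TN : forall x, T (N x) = N (T x).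

Lemma adj_sym x y : B (N' x) y = B x (N y).
Proof. by rewrite hf_sym -adjN -hf_sym. Qed.

Lemma hn_normal x : hn B (N' x) = hn B (N x).
Proof. by rewrite /hn /hq adj_sym adjN NN'. Qed.

Let bN' x : hn B (N' x) <= c * hn B x.
Proof. by rewrite hn_normal. Qed.

Let bNN x : hn B (N (N x)) <= c ^+ 2 * hn B x.
Proof. by rewrite (le_trans (bN _)) // expr2 -mulrA ler_wpM2l. Qed.

Let bNN' x : hn B (N' (N' x)) <= c ^+ 2 * hn B x.
Proof. by rewrite (le_trans (bN' _)) // expr2 -mulrA ler_wpM2l. Qed.

Let lNN : islin (fun x => N (N x)). Proof. by move=> a x y; rewrite !lN. Qed.

Section Unitary.
Variables (n : nat) (w : R[i]).
Let b := (1 + normc w ^+ 2 * c ^+ 2) ^+ n.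

Let it u A := iter n (@step R H u A).

(** For w of size r/n, [X] approximates the exponential of n(wN' - conj(w)N), which is unitary since
    the exponent is skew-adjoint. [Y] is the adjoint of [X]. *)
Let X x := it w N' (it (- (w^*)%C) N x).
Let Y x := it (w^*)%C N (it (- w) N' x).

Lemma adjYX x y : B (Y x) y = B x (X y).
Proof.
rewrite /X /Y /it (@hf_iter_adj _ _ _ _ _ (step w N')); last first.
  by move=> u v; rewrite (hf_step_adj _ _ _ adjN) conjcK.
rewrite (@hf_iter_adj _ _ _ _ _ (step (- (w^*)%C) N)).
  rewrite iter_comm2 // => u; apply: step_comm => // v.
by move=> u v; rewrite (hf_step_adj _ _ _ adj_sym) rmorphN.
Qed.

Let itmul u A x : islin A -> it u A (it (- u) A x) = it (- u ^+ 2) (fun y => A (A y)) x.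
Proof.
move=> lA; rewrite /it iter_comp; last by move=> y; exact: step_comm.
by apply: eq_iter => y; exact: stepM.
Qed.

Let itC u v A D x : islin A -> islin D -> (forall y, A (D y) = D (A y)) ->
  it u A (it v D x) = it v D (it u A x).
Proof. by move=> lA lD AD; apply: iter_comm2 => y; exact: step_comm. Qed.

(** Opposite steps pair off as (1 + uA)(1 - uA) = 1 - u^2 A^2, so the product differs from the
    identity by terms of order 1/n only. *)
Let XYE x : X (Y x) =
  it (- w ^+ 2) (fun y => N' (N' y)) (it (- (w^*)%C ^+ 2) (fun y => N (N y)) x).
Proof.
rewrite /X /Y -!itmul //; congr (it w N' _).
rewrite (itC (- (w^*)%C) (w^*)%C _ lN lN) //.
by rewrite (itC _ _ x lN lN' NN') (itC _ _ _ lN lN' NN').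
Qed.

Let YXE x : Y (X x) =
  it (- w ^+ 2) (fun y => N' (N' y)) (it (- (w^*)%C ^+ 2) (fun y => N (N y)) x).
Proof.
rewrite /X /Y -!itmul // (itC (- w) w _ lN' lN') //.
by rewrite (itC _ _ _ lN lN' NN'); congr (it w N' _); rewrite (itC _ _ _ lN lN' NN').
Qed.

Let b0 : 0 <= 1 + normc w ^+ 2 * c ^+ 2.
Proof. by rewrite addr_ge0 // mulr_ge0 // sqr_ge0. Qed.

Let normcX2 (u : R[i]) : normc u = normc w -> normc (- u ^+ 2) = normc w ^+ 2.
Proof.
move=> E; rewrite -mulN1r normcM normcX E.
by rewrite (_ : normc (-1) = 1) ?mul1r // normc_sqrt sqmodE /= oppr0 expr0n addr0 sqrrN expr1n sqrtr1.
Qed.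

Let bound_it u A x : (forall x, hn B (A x) <= c ^+ 2 * hn B x) -> normc u = normc w ^+ 2 ->
  hn B (it u A x) <= b * hn B x.
Proof.
move=> bA E; apply: hn_iter => // y; have := hn_step u y bA.
by rewrite E.
Qed.

Let bb x : hn B (it (- w ^+ 2) (fun y => N' (N' y)) (it (- (w^*)%C ^+ 2) (fun y => N (N y)) x))
  <= b ^+ 2 * hn B x.
Proof.
have bp : 0 <= b by rewrite exprn_ge0.
rewrite (le_trans (bound_it _ bNN' _)) ?normcX2 // expr2 -mulrA ler_wpM2l //.
by apply: bound_it => //; rewrite normcX2 ?normc_conj.
Qed.

(** The square of the norm of Xx is B(YXx, x), and YX has norm at most b^2 by [YXE]. *)
Lemma bound_X x : hn B (X x) <= b * hn B x.
Proof.
have bp : 0 <= b by rewrite exprn_ge0.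
rewrite -(@ler_pXn2r _ 2) ?nnegrE ?mulr_ge0 ?hn_ge0 // exprMn hn_sqr /hq.
have -> : B (X x) (X x) = B (Y (X x)) x by rewrite adjYX.
rewrite YXE.
apply: (le_trans (le_trans (ler_norm _) (Re_le_normc _))).
apply: (le_trans (normc_hf_le _ _ _)).
by rewrite [hn B x ^+ 2]expr2 mulrA ler_wpM2r ?hn_ge0 // bb.
Qed.

Lemma bound_Y x : hn B (Y x) <= b * hn B x.
Proof.
have bp : 0 <= b by rewrite exprn_ge0.
rewrite -(@ler_pXn2r _ 2) ?nnegrE ?mulr_ge0 ?hn_ge0 // exprMn hn_sqr /hq.
have -> : B (Y x) (Y x) = B x (X (Y x)) by rewrite adjYX.
rewrite XYE.
apply: (le_trans (le_trans (ler_norm _) (Re_le_normc _))).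
apply: (le_trans (normc_hf_le _ _ _)).
by rewrite mulrC [hn B x ^+ 2]expr2 mulrA ler_wpM2r ?hn_ge0 // bb.
Qed.

(* As [T] commutes with [N], [X T Y] equals [P T P'] up to the defect of
   (1 - u N)^n (1 + u N)^n from the identity, where [P], [P'] are the powers of the
   [N']-steps, and [X], [Y] are almost unitary. *)
Lemma bound_conj x : hn B (it w N' (T (it (- w) N' x))) <=
  (b ^+ 2 + ((1 + normc w * c) ^+ n) ^+ 2 * (b - 1)) * cT * hn B x.
Proof.
have bp : 0 <= b by rewrite exprn_ge0.
have e0 : 0 <= 1 + normc w * c by rewrite addr_ge0 ?mulr_ge0 ?normc_ge0.
have lit u A : islin A -> islin (it u A) by move=> lA; exact/iter_lin/step_lin.
pose z := it (- w) N' x.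
have TQ u y : T (it u N y) = it u N (T y).
  by symmetry; apply: iter_comm => v; apply: step_comm_id => // s; rewrite TN.
have XTY : X (T (Y x)) = it w N' (T z) +
    it w N' (T (it (- (w^*)%C ^+ 2) (fun y => N (N y)) z - z)).
  rewrite /X -TQ /Y (itC _ _ _ lN lN) // itmul //.
  rewrite -(islinD (lit _ _ lN')) -(islinD lT); congr (it w N' (T _)).
  by rewrite addrC subrK.
have -> : it w N' (T z) = X (T (Y x)) -
    it w N' (T (it (- (w^*)%C ^+ 2) (fun y => N (N y)) z - z)).
  by rewrite XTY addrK.
rewrite (le_trans (hnD _ _ _)) // hnN mulrDl [leRHS]mulrDl; apply: lerD.
  rewrite (le_trans (bound_X _)) // expr2 -!mulrA ler_wpM2l //.
  by rewrite (le_trans (bT _)) // mulrCA ler_wpM2l // bound_Y.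
have H1 u v : normc u = normc w -> hn B (it u N' v) <= (1 + normc w * c) ^+ n * hn B v.
  by move=> E; apply: hn_iter => // y; rewrite -E; exact: hn_step.
have nN : normc (- w) = normc w by rewrite !normc_sqrt; case: (w) => p q /=; rewrite !sqrrN.
rewrite (le_trans (H1 _ _ _)) // expr2 -!mulrA ler_wpM2l ?exprn_ge0 //.
rewrite (le_trans (bT _)) //.
have := @hn_iter_step_sub _ _ B n (- (w^*)%C ^+ 2) _ _ z lNN (sqr_ge0 c) bNN.
rewrite normcX2 ?normc_conj // -/b => H2.
have b1 : 0 <= b - 1.
  by rewrite subr_ge0 /b exprn_ege1 // lerDl mulr_ge0 ?sqr_ge0.
apply: (@le_trans _ _ (cT * ((b - 1) * ((1 + normc w * c) ^+ n * hn B x)))).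
  apply: ler_wpM2l => //; apply: (le_trans H2); apply: ler_wpM2l => //.
  exact: H1.
by rewrite le_eqVlt; apply/orP; left; apply/eqP; ring.
Qed.

End Unitary.

Let expn_le (t : R) n : 0 <= t -> (1 + t) ^+ n <= expR (n%:R * t).
Proof.
move=> t0; rewrite expRM_natl lerXn2r ?nnegrE ?addr_ge0 ?expR_ge0 //.
exact: expR_ge1Dx.
Qed.

(** The bound must be uniform in r. With E = exp(rc) and e = 1/(2E^2), a large n gives b <= 1 + 2e
    <= 2, so b^2 <= 4, and the second term is at most 2eE^2 = 1; hence 5. *)
Let large_step (r : R) : 0 <= r -> exists n : nat, (0 < n)%N /\
  let b := (1 + (r / n%:R) ^+ 2 * c ^+ 2) ^+ n in
  b ^+ 2 + ((1 + r / n%:R * c) ^+ n) ^+ 2 * (b - 1) <= 5.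
Proof.
move=> r0; pose E := expR (r * c); have E1 : 1 <= E.
  by apply: le_trans (expR_ge1Dx _); rewrite lerDl mulr_ge0.
pose e : R := (2 * E ^+ 2)^-1.
have e0 : 0 < e by rewrite invr_gt0 mulr_gt0 ?exprn_gt0 ?expR_gt0.
have eE : e * E ^+ 2 = 2^-1 by rewrite /e; field; rewrite gt_eqF ?expR_gt0.
have e12 : e <= 2^-1 by have := ler_wpM2l (ltW e0) (exprn_ege1 2 E1); lra.
have K0 : 0 <= r ^+ 2 * c ^+ 2 / e by rewrite divr_ge0 ?mulr_ge0 ?sqr_ge0 // ltW.
pose n := (Num.truncn (r ^+ 2 * c ^+ 2 / e)).+1.
have nb : r ^+ 2 * c ^+ 2 / e < n%:R by exact: truncnS_gt.
exists n; split=> //=.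
have n0 : 0 < n%:R :> R by rewrite ltr0n.
clearbody n.
set b := (_ ^+ n) => /=.
have b1 : 1 <= b by rewrite exprn_ege1 // lerDl mulr_ge0 ?sqr_ge0.
have be : b <= 1 + 2 * e.
  have : b <= expR e.
    rewrite (le_trans (expn_le _ _)) ?mulr_ge0 ?sqr_ge0 // ler_expR.
    rewrite (_ : n%:R * _ = r ^+ 2 * c ^+ 2 / n%:R); last by field; rewrite gt_eqF.
    by rewrite ler_pdivrMr // [e * _]mulrC -ler_pdivrMr // ltW.
  move=> /le_trans; apply.
  (* exp(e) <= 1/(1 - e) <= 1 + 2e, because e <= 1/2. *)
  have : 1 - e <= expR (- e) by exact: expR_ge1Dx.
  rewrite expRN => H1; have := expR_gt0 e; set X := expR e in H1 * => X0.
  have : (1 - e) * X <= 1 by rewrite -ler_pdivlMr // div1r.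
  by nra.
set P := (_ ^+ n).
have P0 : 0 <= P by rewrite exprn_ge0 // addr_ge0 ?mulr_ge0 ?divr_ge0 // ltW.
have PE : P <= E.
  have q0 : 0 <= r / n%:R * c by rewrite mulr_ge0 // divr_ge0 // ltW.
  apply: (le_trans (expn_le n q0)).
  by rewrite /E (_ : n%:R * _ = r * c) //; field; rewrite gt_eqF.
have P2 : P ^+ 2 <= E ^+ 2 by rewrite lerXn2r ?nnegrE // (le_trans P0).
by nra.
Qed.

(** The polynomial (1 + zN'/n)^n T (1 - zN'/n)^n x has linear coefficient N'Tx - TN'x, which does
    not depend on n, so n may be chosen after r = |z|. [bound_conj] bounds the polynomial on that
    circle uniformly in r, and the Cauchy estimate for arbitrarily large r kills the coefficient. *)
Theorem fuglede : (forall x, hq B x = 0 -> x = 0) -> forall x, T (N' x) = N' (T x).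
Proof.
move=> pd x; apply/esym/eqP; rewrite -subr_eq0; apply/eqP; apply: pd.
set dx := N' (T x) - T (N' x); pose y := dx.
suff : normc (B dx y) = 0 by move/eq0_normc; rewrite /hq => ->.
apply/eqP; rewrite eq_le normc_ge0 andbT leNgt; apply/negP => dp.
pose M := 5 * cT * hn B x * hn B y.
have M0 : 0 <= M by rewrite !mulr_ge0 ?hn_ge0.
suff H1 (r : R) : 0 <= r -> r * normc (B dx y) <= M.
  have r0 : 0 <= (M + 1) / normc (B dx y) by rewrite divr_ge0 ?addr_ge0 ?normc_ge0.
  by have := H1 _ r0; rewrite divfK ?gt_eqF //; lra.
move=> r0; have [n [n0 nM]] := large_step r0.
have nz : n%:R != 0 :> R[i] by rewrite pnatr_eq0 -lt0n.
have V1 := vpoly_iter n (- n%:R^-1) lN' (isT : (0 < 1)%N) (vpoly_const x).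
have V2 := vpoly_map lT V1.
have n1 : (0 < n + 1)%N by rewrite addn1.
have [v [Fv _ _ v1]] := vpoly_iter n n%:R^-1 lN' n1 V2.
have dxE : v 1%N = dx.
  rewrite v1 /dx add0r mulrN divff // scaleN1r scale1r (islinN lT).
  by rewrite addrC.
rewrite -dxE; apply: (cauchy_coef1 (p := fun k => B (v k) y) (m := n + (n + 1))) => //.
  by lia.
move=> z zr.
rewrite (_ : \sum_(k < _) _ = B (iter n (step (n%:R^-1 * z) N') (T (iter n (step (- n%:R^-1 * z) N') x))) y).
  rewrite (le_trans (normc_hf_le _ _ _)) // /M ler_wpM2r ?hn_ge0 // mulNr.
  rewrite (le_trans (bound_conj _ _ _)) // ler_wpM2r ?hn_ge0 // ler_wpM2r //.
  have -> : normc (n%:R^-1 * z) = r / n%:R.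
    rewrite normcM zr normcV mulrC; congr (_ / _).
    by rewrite -(rmorph_nat (real_complex R)) normc_real ger0_norm.
  exact: nM.
by rewrite Fv hf_suml; apply: eq_bigr => k _; rewrite hfZl.
Qed.

End Fuglede.

(** * Commuting normal tuples with bounded orbits *)

Section MultiIndex.
Variable d : nat.
Implicit Types (al be : 'I_d -> nat) (j k : 'I_d).

Lemma mindex_ind (P : ('I_d -> nat) -> Prop) :
  P (fun=> 0%N) -> (forall al j, P al -> P (shift_e al j)) -> forall al, P al.
Proof.
move=> P0 PS al; have [n] := ubnP (\sum_j al j)%N; elim: n al => // n IH al aln.
have [[j aj]|H] := pselect (exists j, (0 < al j)%N); last first.
  rewrite (_ : al = fun=> 0%N) //; apply/funext => j; apply/eqP.
  by rewrite -leqn0 leqNgt; apply/negP => aj; apply: H; exists j.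
pose al' i := (al i - (i == j))%N.
have E : al = shift_e al' j.
  by apply/funext => i; rewrite /shift_e /al' subnK //; case: eqP => [->|].
rewrite E; apply: PS; apply: IH.
rewrite E /shift_e big_split /= in aln.
have s1 : (\sum_(i < d) (i == j) = 1)%N.
  by rewrite (bigD1 j) //= eqxx big1 ?addn0 // => i /negbTE ->.
by rewrite s1 addn1 ltnS in aln.
Qed.

Definition mpow (T : Type) (A : 'I_d -> T -> T) al x :=
  foldr (fun j y => iter (al j) (A j) y) x (enum 'I_d).

Lemma opPowE (R : realType) (I : choiceType) (S : 'I_d -> op R I) al f :
  opPow S al f = mpow S al f.
Proof. by rewrite /opPow /mpow; elim: (enum 'I_d) f => //= j l IH f; rewrite IH. Qed.

Lemma mpow0 (T : Type) (A : 'I_d -> T -> T) x : mpow A (fun=> 0%N) x = x.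
Proof. by rewrite /mpow; elim: (enum 'I_d). Qed.

Lemma mpow_inv (T : Type) (P : T -> Prop) (A : 'I_d -> T -> T) al x :
  (forall j y, P y -> P (A j y)) -> P x -> P (mpow A al x).
Proof.
move=> PA Px; rewrite /mpow; elim: (enum 'I_d) => //= j l IH.
by elim: (al j) => //= n IHn; exact: PA.
Qed.

(** [mpow] applies its factors in a fixed order; commutation on the invariant domain [P] carries the
    extra [A j] to the front. *)
Lemma mpowS (T : Type) (P : T -> Prop) (A : 'I_d -> T -> T) al j x :
  (forall k y, P y -> P (A k y)) -> (forall k l y, P y -> A k (A l y) = A l (A k y)) ->
  P x -> mpow A (shift_e al j) x = A j (mpow A al x).
Proof.
move=> PA AC Px; rewrite /mpow.
have H (l : seq 'I_d) : uniq l ->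
    foldr (fun j0 y => iter (shift_e al j j0) (A j0) y) x l =
    (if j \in l then A j else id) (foldr (fun j y => iter (al j) (A j) y) x l)
    /\ P (foldr (fun j y => iter (al j) (A j) y) x l).
  elim: l => //= k l IH /andP[kl ul]; have [-> Pl] := IH ul.
  have Pi n : P (iter n (A k) (foldr (fun j y => iter (al j) (A j) y) x l)).
    by elim: n => //= n Pn; exact: PA.
  split; last exact: Pi.
  rewrite inE /shift_e [j == k]eq_sym; have [kj|kj] := eqVneq k j.
    by rewrite -kj (negbTE kl) addn1.
  rewrite addn0 /=; case: (j \in l) => //.
  by elim: (al k) => //= n IHn; rewrite IHn AC.
have [-> _] := H _ (enum_uniq 'I_d).
by rewrite mem_enum.
Qed.

End MultiIndex.

(** By convexity a positive first increment persists and forces linear growth beyond [C]. *)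
Lemma convex_bounded_noninc (R : realType) (a : nat -> R) (C : R) :
  (forall n, a n <= C) -> (forall n, 2 * a n.+1 <= a n + a n.+2) -> a 1%N <= a 0%N.
Proof.
move=> aC acv; rewrite leNgt; apply/negP => a01.
pose e := a 1%N - a 0%N; have e0 : 0 < e by rewrite subr_gt0.
have inc n : e <= a n.+1 - a n.
  by elim: n => // n IH; have := acv n; lra.
have lin n : a 0%N + n%:R * e <= a n.
  by elim: n => [|n IH]; [lra | have := inc n; rewrite -natr1; lra].
pose n := (Num.truncn ((C - a 0%N) / e)).+1.
have : (C - a 0%N) / e < n%:R by exact: truncnS_gt.
by rewrite ltr_pdivrMr // => ?; have := lin n; have := aC n; lra.
Qed.

Definition word (T : Type) (d : nat) (A : 'I_d -> T -> T) (w : seq 'I_d) x :=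
  foldr (fun j y => A j y) x w.

Lemma word_cons (T : Type) (d : nat) (A : 'I_d -> T -> T) j w x :
  word A (j :: w) x = A j (word A w x).
Proof. by []. Qed.

Section ContractiveNormalTuple.
Variables (R : realType) (H : lmodType R[i]) (B : hform H) (d : nat).
Variables (A A' : 'I_d -> H -> H).
Hypothesis lA : forall j, islin (A j).
Hypothesis adjA : forall j x y, B (A j x) y = B x (A' j y).
Hypothesis AA : forall j k x, A j (A k x) = A k (A j x).
Hypothesis AA' : forall j k x, A j (A' k x) = A' k (A j x).

Local Notation word := (word A).

(** [A j] may have norm larger than 1 on the whole space. The vectors singled out here are stable
    under each [A j], under its adjoint and under differences, which is what the positivity argument
    uses. *)
Definition bounded_orbit x := exists C : R, forall w, hq B (word w x) <= C.

Lemma word_lin w : islin (word w).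
Proof. by elim: w => // j w IH a x y; rewrite !word_cons IH lA. Qed.

Lemma hq_adj j x : hq B (A' j x) = hq B (A j x).
Proof.
by rewrite /hq (adj_sym (adjA j)) AA' -adjA.
Qed.

Lemma bounded_orbitB x y : bounded_orbit x -> bounded_orbit y -> bounded_orbit (x - y).
Proof.
move=> [C HC] [D HD]; exists (2 * C + 2 * D) => w.
rewrite (islinB (word_lin w)).
have := hq_ge0 B (word w x + word w y); have := HC w; have := HD w.
by rewrite hqB hqD; lra.
Qed.

Lemma bounded_orbitA j x : bounded_orbit x -> bounded_orbit (A j x).
Proof.
move=> [C HC]; exists C => w; rewrite (_ : word w _ = word (rcons w j) x) //.
by rewrite /word -cats1 foldr_cat.
Qed.

Lemma bounded_orbitA' j x : bounded_orbit x -> bounded_orbit (A' j x).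
Proof.
move=> [C HC]; exists C => w.
rewrite (_ : word w (A' j x) = A' j (word w x)); first by rewrite hq_adj (HC (j :: w)).
by elim: w => // k w IH; rewrite !word_cons IH AA'.
Qed.

(** The sesquilinear form of an iterated difference: an alternating sum of B(A_I x, A_I y) over the
    subwords I of [l]. Off-diagonal values are needed to move adjoints across it. *)
Fixpoint defect (l : seq 'I_d) x y : R[i] :=
  if l is j :: l' then defect l' x y - defect l' (A j x) (A j y) else B x y.

Lemma defectBl l x y z : defect l (x - y) z = defect l x z - defect l y z.
Proof.
elim: l x y z => [|j l IH] x y z /=; first by rewrite hfBl.
by rewrite IH !(islinB (lA j)) IH !opprB addrACA [in RHS]addrCA !addrA -addrA addrC !addrA; ring.
Qed.

Lemma defect_sym l x y : defect l y x = ((defect l x y)^*)%C.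
Proof.
elim: l x y => [|j l IH] x y /=; first by rewrite hf_sym.
by rewrite IH [defect l (A j y) _]IH -rmorphB.
Qed.

Lemma defectBr l x y z : defect l z (x - y) = defect l z x - defect l z y.
Proof. by rewrite defect_sym defectBl rmorphB /= -!defect_sym. Qed.

Lemma defect_adj l j x y : defect l (A j x) y = defect l x (A' j y).
Proof.
elim: l x y => [|k l IH] x y /=; first exact: adjA.
by rewrite AA' (AA k j) !IH.
Qed.

Lemma defect_adj' l j x y : defect l (A' j x) y = defect l x (A j y).
Proof. by rewrite defect_sym -defect_adj -defect_sym. Qed.

Let Q l x := complex.Re (defect l x x).

(* Positivity of the form at [g - A'Ag] makes [n |-> Q (A^n g)] convex; being
   bounded, it is nonincreasing, which is positivity of the next defect. *)
Lemma defect_pos l x : bounded_orbit x -> 0 <= Q l x <= hq B x.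
Proof.
elim: l x => [|j l IH] x Gx; first by rewrite hf_pos lexx.
suff : Q l (A j x) <= Q l x.
  have /andP[a b] := IH _ Gx; have /andP[c _] := IH _ (bounded_orbitA j Gx).
  rewrite /Q /= in a b c *; case: (defect l x x) (defect l (A j x) (A j x)) a b c.
  by move=> ? ? [] ? ? /=; lra.
have Gi n : bounded_orbit (iter n (A j) x) by elim: n => //= n; exact: bounded_orbitA.
have [C HC] := Gx.
(* The upper bound [hq B x] is part of the induction because it bounds this sequence. *)
apply: (@convex_bounded_noninc _ (fun n => Q l (iter n (A j) x)) C) => n.
  have /andP[_ /le_trans] := IH _ (Gi n); apply.
  by have := HC (nseq n j); rewrite /word; congr (hq B _ <= C); elim: n => //= n ->.
set g := iter n (A j) x.
have Gg : bounded_orbit (g - A' j (A j g)).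
  by apply: bounded_orbitB (Gi _) _; apply: bounded_orbitA'; exact: (Gi n.+1).
have /andP[+ _] := IH _ Gg; rewrite /Q /= -/g.
(* Both cross terms equal Q(Ag), and normality turns the last term into Q(A^2 g): the total is Q(g)
   - 2 Q(Ag) + Q(A^2 g). *)
rewrite defectBl !defectBr -!defect_adj defect_adj' AA' defect_adj'.
by case: (defect l (A j g) (A j g)) (defect l g g) (defect l (A j (A j g)) _) => [? ?] [? ?] [? ?] /=; lra.
Qed.

Lemma hq_contractive j x : bounded_orbit x -> hq B (A j x) <= hq B x.
Proof.
move=> Gx; have /andP[+ _] := defect_pos [:: j] Gx.
by rewrite /Q /= /hq; case: (B x x) (B (A j x) _) => [? ?] [? ?] /=; lra.
Qed.

Lemma bounded_orbit_cm x : bounded_orbit x ->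
  completely_monotone (fun al => hq B (mpow A al x)).
Proof.
move=> Gx.
have Gm al : bounded_orbit (mpow A al x) by apply: mpow_inv => // *; exact: bounded_orbitA.
pose D phi := exists l, phi = fun al => Q l (mpow A al x).
have D0 phi : D phi -> forall al, 0 <= phi al.
  by move=> [l ->] al; have /andP[] := defect_pos l (Gm al).
have DN phi j : D phi -> D (nabla j phi).
  move=> [l ->]; exists (j :: l); apply/funext => al; rewrite /nabla.
  rewrite (mpowS (P := fun=> True)) // /Q /=.
  by case: (defect _ _ _) (defect _ _ _) => [? ?] [? ?].
move=> al be; apply: D0; rewrite /nablaPow.
elim: (enum 'I_d) => [|j l IH] /=; first by exists [::].
by elim: (be j) => //= n; exact: DN.
Qed.

End ContractiveNormalTuple.

(** * The Hilbert space l2(I) *)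

Section L2Functions.
Variables (R : realType) (I : choiceType).
Implicit Types (f g : I -> R[i]).

Lemma l2E f : l2 f <-> rsummable (fun x => sqmod (f x)).
Proof.
by rewrite /l2 /rsummable; under [in X in _ <-> X]eq_esum do rewrite ger0_norm ?sqmod_ge0 //.
Qed.

Lemma nrm2E f : nrm2 f = rsum (fun x => sqmod (f x)).
Proof. by rewrite rsum_nneg // => x; exact: sqmod_ge0. Qed.

Lemma sqmodD (z w : R[i]) :
  sqmod (z + w) = sqmod z + sqmod w + 2 * complex.Re (z * (w^*)%C).
Proof. by case: z w => a b [c d] /=; ring. Qed.

Lemma normc_mul_conj_le (z w : R[i]) : normc (z * (w^*)%C) <= sqmod z + sqmod w.
Proof.
rewrite normcM normc_conj -!normc_sqr.
have := sqr_ge0 (normc z - normc w); rewrite sqrrB.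
have := sqr_ge0 (normc z); have := sqr_ge0 (normc w).
by have := mulr_ge0 (normc_ge0 z) (normc_ge0 w); rewrite mulr2n; lra.
Qed.

Lemma Im_le_normc (z : R[i]) : `|complex.Im z| <= normc z.
Proof.
by rewrite normc_sqrt -sqrtr_sqr; apply: ler_wsqrtr; rewrite sqmodE lerDr sqr_ge0.
Qed.

Lemma rsummable_Re f g : l2 f -> l2 g -> rsummable (fun x => complex.Re (f x * (g x)^*%C)).
Proof.
move=> /l2E sf /l2E sg; apply: rsummable_le (rsummableD sf sg) => x.
exact: le_trans (Re_le_normc _) (normc_mul_conj_le _ _).
Qed.

Lemma rsummable_Im f g : l2 f -> l2 g -> rsummable (fun x => complex.Im (f x * (g x)^*%C)).
Proof.
move=> /l2E sf /l2E sg; apply: rsummable_le (rsummableD sf sg) => x.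
exact: le_trans (Im_le_normc _) (normc_mul_conj_le _ _).
Qed.

Lemma l2D f g : l2 f -> l2 g -> l2 (fun x => f x + g x).
Proof.
move=> lf lg; apply/l2E.
under [X in rsummable X]eq_fun do rewrite sqmodD.
apply: rsummableD; first by apply: rsummableD; exact/l2E.
exact: rsummableZ (rsummable_Re lf lg).
Qed.

Lemma l2Z (a : R[i]) f : l2 f -> l2 (fun x => a * f x).
Proof.
move=> lf; apply/l2E; under [X in rsummable X]eq_fun do rewrite sqmodM.
by apply: rsummableZ; exact/l2E.
Qed.

Lemma nrm2D f g : l2 f -> l2 g -> nrm2 (fun x => f x + g x) =
  nrm2 f + nrm2 g + 2 * rsum (fun x => complex.Re (f x * (g x)^*%C)).
Proof.
move=> lf lg; rewrite !nrm2E; under eq_fun do rewrite sqmodD.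
have [sf sg] := (iffLR (l2E f) lf, iffLR (l2E g) lg).
have sr := rsummable_Re lf lg.
by rewrite !rsumD ?rsumZ //; [exact: rsummableD | exact: rsummableZ].
Qed.

(** In the polarization formula the factors 1, i, -1, -i contribute Re, Im, -Re and -Im of the sum
    of f conj(g). *)
Lemma innerE f g : l2 f -> l2 g -> inner f g =
  Complex (rsum (fun x => complex.Re (f x * (g x)^*%C)))
          (rsum (fun x => complex.Im (f x * (g x)^*%C))).
Proof.
move=> lf lg; rewrite /inner !big_ord_recl big_ord0 /= /bump /= !add1n.
set a := rsum _; set b := rsum _.
have K (w : R[i]) (h : I -> R) : sqmod w = 1 ->
    (forall x, complex.Re (f x * ((w * g x)^*)%C) = h x) ->
    nrm2 (fun x => f x + w * g x) = nrm2 f + nrm2 g + 2 * rsum h.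
  move=> w1 hE; rewrite nrm2D //; last exact: l2Z.
  congr (_ + _ + 2 * _); last by congr rsum; apply/funext.
  by rewrite !nrm2E; congr rsum; apply/funext => x; rewrite sqmodM w1 mul1r.
rewrite (K _ (fun x => complex.Re (f x * (g x)^*%C))); first last.
- by move=> x; rewrite expr0 mul1r.
- by rewrite expr0 sqmod1.
rewrite (K _ (fun x => complex.Im (f x * (g x)^*%C))); first last.
- by move=> x; rewrite expr1; case: (f x) (g x) => [? ?] [? ?] /=; ring.
- by rewrite expr1 /= expr0n expr1n add0r.
rewrite (K _ (fun x => - complex.Re (f x * (g x)^*%C))); first last.
- by move=> x; rewrite sqr_i; case: (f x) (g x) => [? ?] [? ?] /=; ring.
- by rewrite sqr_i sqmodE /= oppr0 expr0n sqrrN expr1n addr0.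
rewrite (K _ (fun x => - complex.Im (f x * (g x)^*%C))); first last.
- by move=> x; rewrite exprS sqr_i; case: (f x) (g x) => [? ?] [? ?] /=; ring.
- rewrite exprS sqr_i sqmodM [sqmod (-1)]sqmodE /= oppr0 !expr0n sqrrN !expr1n.
  by rewrite add0r addr0 mulr1.
rewrite !rsumN -/a -/b expr0 expr1 sqr_i [_ ^+ 3]exprS sqr_i.
have -> : (4%:R : R[i])^-1 = ((4^-1 : R)%:C)%C.
  by rewrite (fmorphV (real_complex R)) (rmorph_nat (real_complex R)).
by apply/eqP; rewrite eq_complex /=; apply/andP; split; apply/eqP; field.
Qed.

End L2Functions.

Definition l2_pred (R : realType) (I : choiceType) : {pred (I -> R[i]^o)} :=
  fun f => `[< l2 f >].

Section L2Type.
Variables (R : realType) (I : choiceType).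

Lemma l2_predP (f : I -> R[i]^o) : reflect (l2 f) (f \in @l2_pred R I).
Proof. by apply: (iffP idP) => /asboolP. Qed.

Fact l2_submod_closed : submod_closed (@l2_pred R I).
Proof.
split=> [|a f g /l2_predP lf /l2_predP lg]; apply/l2_predP.
  by apply/l2E/(rsummable_supp (s := [::])) => // x _ /=; rewrite expr0n addr0.
exact: l2D (l2Z a lf) lg.
Qed.

HB.instance Definition _ := GRing.isSubmodClosed.Build R[i] (I -> R[i]^o)
  (@l2_pred R I) l2_submod_closed.

(** Operators in the statement are constrained on square-summable functions only. Bundling these
    into a module removes the side conditions and makes the theory of [hform] available. *)
Record L2 := MkL2 { l2val : I -> R[i]^o; l2valP : l2val \in @l2_pred R I }.

HB.instance Definition _ := [isSub for l2val].
HB.instance Definition _ := [Choice of L2 by <:].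
HB.instance Definition _ := [SubChoice_isSubLmodule of L2 by <:].

Implicit Types f g : L2.

Lemma L2P f : l2 (l2val f). Proof. exact/l2_predP/l2valP. Qed.

Definition toL2 (f : I -> R[i]) (lf : l2 f) : L2 := MkL2 (introT (l2_predP f) lf).

Lemma L2_inj f g : (forall x, l2val f x = l2val g x) -> f = g.
Proof. by move=> E; apply/val_inj/funext. Qed.

Lemma l2val_lin a f g x : l2val (a *: f + g) x = a * l2val f x + l2val g x.
Proof. by []. Qed.
Lemma l2valD f g x : l2val (f + g) x = l2val f x + l2val g x.
Proof. by []. Qed.
Lemma l2valZ a f x : l2val (a *: f) x = a * l2val f x.
Proof. by []. Qed.
Lemma l2val_sum (J : Type) (r : seq J) (F : J -> L2) x :
  l2val (\sum_(j <- r) F j) x = \sum_(j <- r) l2val (F j) x.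
Proof. by elim: r => [|j r IH]; rewrite ?big_nil // !big_cons l2valD IH. Qed.

Definition L2ip f g : R[i] := inner (l2val f) (l2val g).

Fact L2ip_lin a f g h : L2ip (a *: f + g) h = a * L2ip f h + L2ip g h.
Proof.
rewrite /L2ip !innerE; try exact: L2P.
have [[fr fi] [gr gi]] := ((rsummable_Re (L2P f) (L2P h), rsummable_Im (L2P f) (L2P h)),
  (rsummable_Re (L2P g) (L2P h), rsummable_Im (L2P g) (L2P h))).
case: a => a b.
have KR (u v w : R[i]) : complex.Re ((Complex a b * u + v) * w) =
    a * complex.Re (u * w) - b * complex.Im (u * w) + complex.Re (v * w).
  by case: u v w => [? ?] [? ?] [? ?] /=; ring.
have KI (u v w : R[i]) : complex.Im ((Complex a b * u + v) * w) =
    a * complex.Im (u * w) + b * complex.Re (u * w) + complex.Im (v * w).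
  by case: u v w => [? ?] [? ?] [? ?] /=; ring.
apply/eqP; rewrite eq_complex; apply/andP; split; apply/eqP => /=.
  rewrite -(rsumZ a fr) -(rsumZ b fi) -rsumB; try exact: rsummableZ.
  rewrite -rsumD //; last by apply: rsummableB; exact: rsummableZ.
  by congr rsum; apply/funext => x; exact: KR.
rewrite -(rsumZ a fi) -(rsumZ b fr) -rsumD; try exact: rsummableZ.
rewrite -rsumD //; last by apply: rsummableD; exact: rsummableZ.
by congr rsum; apply/funext => x; exact: KI.
Qed.

Fact L2ip_sym f g : L2ip g f = ((L2ip f g)^*)%C.
Proof.
rewrite /L2ip !innerE; try exact: L2P.
congr Complex; rewrite -?rsumN; congr rsum; apply/funext => x.
  by case: (l2val f x) (l2val g x) => [? ?] [? ?] /=; ring.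
by case: (l2val f x) (l2val g x) => [? ?] [? ?] /=; ring.
Qed.

Lemma L2ip_nrm2 f : complex.Re (L2ip f f) = nrm2 (l2val f).
Proof.
rewrite /L2ip innerE ?nrm2E; try exact: L2P.
congr rsum; apply/funext => x.
by case: (l2val f x) => [? ?] /=; ring.
Qed.

Fact L2ip_pos f : 0 <= complex.Re (L2ip f f).
Proof. by rewrite L2ip_nrm2 nrm2E; apply: rsum_ge0 => x; exact: sqmod_ge0. Qed.

Definition L2form : hform L2 := HForm L2ip_lin L2ip_sym L2ip_pos.

Lemma L2_hq f : hq L2form f = nrm2 (l2val f). Proof. exact: L2ip_nrm2. Qed.

Lemma L2_hq_rsum f : hq L2form f = rsum (fun x => sqmod (l2val f x)).
Proof. by rewrite L2_hq nrm2E. Qed.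

Lemma L2_definite f : hq L2form f = 0 -> f = 0.
Proof.
rewrite L2_hq_rsum => f0; apply: L2_inj => x; apply: sqmod_eq0.
apply: (rsum_eq0 (f := fun x => sqmod (l2val f x))) => // [y|].
  exact: sqmod_ge0.
exact/l2E/L2P.
Qed.

Lemma l2_basis v : l2 (@basis_vec R I v).
Proof.
apply/l2E/(rsummable_supp (s := [:: v])) => // x.
by rewrite inE /basis_vec => /negbTE ->; exact: sqmod0.
Qed.

Definition delta v : L2 := toL2 (l2_basis v).

Lemma L2ip_delta f v : L2form f (delta v) = l2val f v.
Proof.
rewrite /= /L2ip innerE; try exact: L2P.
have E (h : R[i] -> R) : h 0 = 0 ->
    rsum (fun x => h (l2val f x * ((l2val (delta v) x)^*)%C)) = h (l2val f v).
  move=> h0; rewrite (rsum_supp (s := [:: v])) // ?big_seq1 /= /basis_vec ?eqxx.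
    by rewrite conjc1 mulr1.
  by move=> x; rewrite inE => /negbTE ->; rewrite conjc0 mulr0.
by rewrite !E //; case: (l2val f v).
Qed.

Lemma delta_ip v f : L2form (delta v) f = (l2val f v)^*%C.
Proof. by rewrite hf_sym L2ip_delta. Qed.

Lemma delta_orth v w : L2form (delta v) (delta w) = if v == w then 1 else 0.
Proof. by rewrite L2ip_delta /= /basis_vec eq_sym. Qed.

Lemma hq_delta v : hq L2form (delta v) = 1.
Proof. by rewrite /hq delta_orth eqxx. Qed.

Lemma l2val_sum_delta (s : seq I) (c : I -> R[i]) x : uniq s ->
  l2val (\sum_(v <- s) c v *: delta v) x = if x \in s then c x else 0.
Proof.
move=> us; rewrite l2val_sum.
under eq_bigr do rewrite l2valZ /= /basis_vec.
case: ifPn => xs.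
  rewrite (bigD1_seq x) //= eqxx mulr1 big1 ?addr0 // => v vx.
  by rewrite eq_sym (negbTE vx) mulr0.
rewrite big_seq big1 // => v vs; case: eqP => [xv|]; last by rewrite mulr0.
by rewrite xv vs in xs.
Qed.

Lemma hq_sum_delta (s : seq I) (c : I -> R[i]) : uniq s ->
  hq L2form (\sum_(v <- s) c v *: delta v) = \sum_(v <- s) sqmod (c v).
Proof.
move=> us; rewrite L2_hq_rsum (rsum_supp (s := s)) //.
  by rewrite big_seq [RHS]big_seq; apply: eq_bigr => v vs; rewrite l2val_sum_delta ?vs.
by move=> x xs; rewrite l2val_sum_delta // (negbTE xs) sqmod0.
Qed.

Lemma L2_approx f (e : R) : 0 < e -> exists2 s : seq I, uniq s &
  hq L2form (f - \sum_(v <- s) l2val f v *: delta v) < e.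
Proof.
move=> e0; have sf : rsummable (fun x => sqmod (l2val f x)) by exact/l2E/L2P.
have [s us Hs] := rsum_approx (fun x => sqmod_ge0 (l2val f x)) sf e0.
exists s => //; rewrite hqB hq_sum_delta // hf_sumr.
under [X in complex.Re X]eq_bigr do rewrite hfZr L2ip_delta mulrC mulc_conj.
rewrite -rmorph_sum /= L2_hq_rsum; lra.
Qed.

(** Finite combinations of the [delta v] are dense by [L2_approx], and the bound makes [phi]
    continuous. This is the device that carries identities from basis vectors to all of l2. *)
Lemma L2_functional0 (phi : L2 -> R[i]) (c : R) :
  (forall a f g, phi (a *: f + g) = a * phi f + phi g) ->
  (forall f, sqmod (phi f) <= c * hq L2form f) ->
  (forall v, phi (delta v) = 0) -> forall f, phi f = 0.
Proof.
move=> lphi bphi phi0 f; apply: sqmod_eq0; apply/eqP; rewrite eq_le sqmod_ge0 andbT.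
have lphi' : islin (phi : L2 -> R[i]^o) by [].
rewrite leNgt; apply/negP => fp.
have c0 : 0 < c.
  rewrite ltNge; apply/negP => cn.
  by have := le_trans (bphi f) (mulr_le0_ge0 cn (hq_ge0 _ f)); rewrite leNgt fp.
have [s us Hs] := L2_approx f (divr_gt0 fp c0).
have := bphi (f - \sum_(v <- s) l2val f v *: delta v).
rewrite (islinB lphi') (islin_sum lphi') big1 ?subr0; last first.
  by move=> v _; rewrite (islinZ lphi') phi0 scaler0.
rewrite leNgt => /negP; apply; rewrite mulrC -ltr_pdivlMr //.
Qed.

End L2Type.

Arguments L2form {R I}.
Arguments delta {R I}.

(** * Contractions of l2 spaces and necessity of complete monotonicity *)

Lemma sqmodB_le (R : realType) (z w : R[i]) : sqmod (z - w) <= 2 * (sqmod z + sqmod w).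
Proof.
case: z w => a b [c d] /=.
by have := sqr_ge0 (a + c); have := sqr_ge0 (b + d); nra.
Qed.

(** * Contractions determined by their values on a basis *)

Section Extension.
Variables (R : realType) (V I : choiceType).

(** The condition under which sending [delta v] to [G v] extends to a contraction. *)
Definition contractive_family (G : V -> L2 R I) := forall (s : seq V) (c : V -> R[i]),
  uniq s -> hq L2form (\sum_(v <- s) c v *: G v) <= \sum_(v <- s) sqmod (c v).

Definition contraction (T : L2 R V -> L2 R I) :=
  islin T /\ forall f, hq L2form (T f) <= hq L2form f.

Lemma L2_lin_eq (H : lmodType R[i]) (B : hform H) (c : R) (T1 T2 : L2 R V -> H) :
  (forall x, hq B x = 0 -> x = 0) -> islin T1 -> islin T2 -> 0 <= c ->
  (forall f, hq B (T1 f) <= c * hq L2form f) -> (forall f, hq B (T2 f) <= c * hq L2form f) ->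
  (forall v, T1 (delta v) = T2 (delta v)) -> forall f, T1 f = T2 f.
Proof.
move=> pd l1 l2 c0 b1 b2 E f; apply/eqP; rewrite -subr_eq0; apply/eqP/pd.
suff K y : B (T1 f - T2 f) y = 0 by rewrite /hq K.
apply: (L2_functional0 (phi := fun f => B (T1 f - T2 f) y) (c := 4 * c * hq B y)).
- by move=> a g h; rewrite l1 l2 opprD addrACA -scalerBr hf_lin.
- move=> g; apply: (le_trans (cauchy_schwarz _ _ _)).
  rewrite mulrAC ler_wpM2r ?hq_ge0 //.
  have := hq_ge0 B (T1 g + T2 g); have := b1 g; have := b2 g.
  by rewrite hqB hqD -!mulrA; lra.
- by move=> v; rewrite E subrr hf0l.
Qed.

Lemma form_adj (T : L2 R V -> L2 R I) (T' : L2 R I -> L2 R V) :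
  islin T -> islin T' ->
  (forall f, hq L2form (T f) <= hq L2form f) -> (forall g, hq L2form (T' g) <= hq L2form g) ->
  (forall v i, L2form (T (delta v)) (delta i) = L2form (delta v) (T' (delta i))) ->
  forall f g, L2form (T f) g = L2form f (T' g).
Proof.
move=> lT lT' bT bT' E f g; apply/eqP; rewrite -subr_eq0; apply/eqP.
apply: (L2_functional0 (phi := fun f => L2form (T f) g - L2form f (T' g))
  (c := 4 * hq L2form g)).
- by move=> a u w; rewrite lT !hf_lin; ring.
- move=> u; apply: (le_trans (sqmodB_le _ _)).
  have h1 := cauchy_schwarz L2form (T u) g; have h2 := cauchy_schwarz L2form u (T' g).
  have h3 := ler_wpM2r (hq_ge0 L2form g) (bT u).
  have h4 := ler_wpM2l (hq_ge0 L2form u) (bT' g).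
  by lra.
(* Conjugation makes the second argument the linear one, so the density argument applies to it as
   well. *)
move=> v; apply/eqP; rewrite -conjc_eq0; apply/eqP.
rewrite -[RHS]/(0 : R[i]).
have -> : forall z w : R[i], ((z - w)^*)%C = (z^*)%C - (w^*)%C by move=> z w; rewrite rmorphB.
rewrite -!hf_sym.
apply: (L2_functional0 (phi := fun g => L2form g (T (delta v)) - L2form (T' g) (delta v))
  (c := 4)).
- by move=> a u w; rewrite lT' !hf_lin; ring.
- move=> u; apply: (le_trans (sqmodB_le _ _)).
  have h1 := cauchy_schwarz L2form u (T (delta v)).
  have h2 := cauchy_schwarz L2form (T' u) (delta v).
  have h3 := bT (delta v); have := bT' u; rewrite !hq_delta in h1 h2 h3 *.
  have := ler_wpM2l (hq_ge0 L2form u) h3.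
  by lra.
- by move=> i; rewrite hf_sym E -hf_sym subrr.
Qed.

(** With t the sum and x the combination having these coefficients, B(g, x) = t and [hq x <= t];
    Cauchy-Schwarz then reads t^2 <= t hq(g). *)
Lemma bessel (G : V -> L2 R I) (g : L2 R I) (s : seq V) : contractive_family G -> uniq s ->
  \sum_(v <- s) sqmod (L2form g (G v)) <= hq L2form g.
Proof.
move=> cG us; set t := \sum_(v <- s) _.
have t0 : 0 <= t by apply: sumr_ge0 => v _; exact: sqmod_ge0.
pose x := \sum_(v <- s) L2form g (G v) *: G v.
have E : L2form g x = t%:C%C.
  rewrite hf_sumr rmorph_sum; apply: eq_bigr => v _.
  by rewrite hfZr mulrC mulc_conj.
have := cauchy_schwarz L2form g x; rewrite E sqmod_real expr2.
have := ler_wpM2l (hq_ge0 L2form g) (cG s (fun v => L2form g (G v)) us).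
rewrite -/x -/t => h1 h2; have h3 := le_trans h2 h1.
have [->|tn0] := eqVneq t 0; first exact: hq_ge0.
by move: h3; rewrite ler_pM2r // lt_def tn0.
Qed.

Lemma coadjoint_exists (G : V -> L2 R I) : contractive_family G ->
  exists K : L2 R I -> L2 R V, [/\ islin K, forall g, hq L2form (K g) <= hq L2form g
    & forall g v, l2val (K g) v = L2form g (G v)].
Proof.
move=> cG.
have lK g : l2 (fun v => L2form g (G v)).
  apply/l2E/(rsummable_bounded (c := hq L2form g)) => [v|s us].
    exact: sqmod_ge0.
  exact: bessel.
exists (fun g => toL2 (lK g)); split=> //.
- by move=> a f g; apply: L2_inj => v; rewrite l2val_lin /= -!/(L2form _ _) L2ip_lin.
- move=> g; rewrite L2_hq_rsum; apply: rsum_le_bound => [v|s us]; first exact: sqmod_ge0.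
  exact: bessel.
Qed.

End Extension.

(** The adjoint of the desired map has the explicit coordinates B(g, G v), so it is defined without
    any limit. Its values on the basis form a contractive family again, and the same construction
    applied to them returns the map itself. *)
Lemma extension_exists (R : realType) (V I : choiceType) (G : V -> L2 R I) :
  contractive_family G ->
  exists T : L2 R V -> L2 R I, contraction T /\ forall v, T (delta v) = G v.
Proof.
move=> cG; have [K [lK bK EK]] := coadjoint_exists cG.
have cG' : contractive_family (fun i => K (delta i)).
  move=> s c us; under eq_bigr do rewrite -(islinZ lK).
  by rewrite -(islin_sum lK) (le_trans (bK _)) // hq_sum_delta.
have [T [lT bT ET]] := coadjoint_exists cG'.
exists T; split=> // v; apply: L2_inj => i.
by rewrite ET delta_ip EK delta_ip conjcK.
Qed.

(** * Passing between operators on functions and operators on [L2] *)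

Section Lifting.
Variable R : realType.

Lemma toL2K (I : choiceType) (f : L2 R I) (lf : l2 (l2val f)) : toL2 lf = f.
Proof. exact: val_inj. Qed.

Lemma lift_exists (V I : choiceType) (T : (V -> R[i]) -> (I -> R[i])) (c : R) :
  (forall f, l2 f -> l2 (T f)) ->
  (forall (a : R[i]) f g, l2 f -> l2 g ->
     T (fun x => a * f x + g x) = (fun x => a * T f x + T g x)) ->
  (forall f, l2 f -> nrm2 (T f) <= c * nrm2 f) ->
  exists T' : L2 R V -> L2 R I, [/\ islin T', forall f, l2val (T' f) = T (l2val f)
    & forall f, hq L2form (T' f) <= c * hq L2form f].
Proof.
move=> T2 Tl Tc; exists (fun f => toL2 (T2 _ (L2P f))); split=> //.
  move=> a f g; apply: L2_inj => x; rewrite l2val_lin /=.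
  have := Tl a _ _ (L2P f) (L2P g).
  by move/(congr1 (fun h => h x)).
by move=> f; rewrite !L2_hq; apply/Tc/L2P.
Qed.

(** The default value 0 makes the result square-summable for every [f]. *)
Definition unlift (V I : choiceType) (T : L2 R V -> L2 R I) (f : V -> R[i]) : I -> R[i] :=
  if pselect (l2 f) is left lf then l2val (T (toL2 lf)) else fun=> 0.

Lemma unliftE (V I : choiceType) (T : L2 R V -> L2 R I) (f : L2 R V) :
  unlift T (l2val f) = l2val (T f).
Proof. by rewrite /unlift; case: pselect => [lf|/(_ (L2P f))//]; rewrite toL2K. Qed.

Lemma unlift_l2 (V I : choiceType) (T : L2 R V -> L2 R I) (f : V -> R[i]) :
  l2 (unlift T f).
Proof.
rewrite /unlift; case: pselect => [lf|_]; first exact: L2P.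
by apply/l2E/(rsummable_supp (s := [::])) => // x _; rewrite sqmod0.
Qed.

Lemma unlift_lin (V I : choiceType) (T : L2 R V -> L2 R I) (a : R[i]) f g :
  islin T -> l2 f -> l2 g ->
  unlift T (fun x => a * f x + g x) = (fun x => a * unlift T f x + unlift T g x).
Proof.
move=> lT lf lg; pose F := toL2 lf; pose G := toL2 lg.
rewrite -[f]/(l2val F) -[g]/(l2val G).
rewrite -[X in unlift T X]/(l2val (a *: F + G)) !unliftE lT.
by apply/funext.
Qed.

Lemma unlift_bounded (I : choiceType) (T : L2 R I -> L2 R I) (c : R) : islin T ->
  (forall f, hq L2form (T f) <= c * hq L2form f) -> bounded_op (unlift T).
Proof.
move=> lT bT; split.
- by move=> f _; exact: unlift_l2.
- by move=> a f g lf lg; exact: unlift_lin.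
- exists c => f lf; rewrite -[f]/(l2val (toL2 lf)) unliftE -!L2_hq.
  exact: bT.
Qed.

End Lifting.

(** * Joint subnormality implies complete monotonicity *)

Section SubnormalCM.
Variables (R : realType) (d : nat) (V : choiceType) (S : 'I_d -> op R V).
Hypothesis bS : forall j, bounded_op (S j).
Hypothesis SS : forall j k, commute_op (S j) (S k).
Hypothesis cS : forall j f, l2 f -> nrm2 (S j f) <= nrm2 f.

Lemma lift_tuple : exists T : 'I_d -> L2 R V -> L2 R V,
  [/\ forall j, islin (T j), forall j f, l2val (T j f) = S j (l2val f),
      forall j f, hq L2form (T j f) <= hq L2form f
    & forall j k f, T j (T k f) = T k (T j f)].
Proof.
have H j : exists T : L2 R V -> L2 R V, [/\ islin T, forall f, l2val (T f) = S j (l2val f)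
    & forall f, hq L2form (T f) <= 1 * hq L2form f].
  have [S1 S2 _] := bS j; apply: lift_exists => // f lf.
  by rewrite mul1r; exact: cS.
have [T HT] := choice H; exists T; split.
- by move=> j; have [] := HT j.
- by move=> j; have [] := HT j.
- by move=> j f; have [_ _ /(_ f)] := HT j; rewrite mul1r.
- move=> j k f; have [_ Ej _] := HT j; have [_ Ek _] := HT k.
  by apply: L2_inj => x; rewrite !(Ej, Ek) SS //; exact: L2P.
Qed.

Lemma mpow_lift (T : 'I_d -> L2 R V -> L2 R V) al (f : L2 R V) :
  (forall j f, l2val (T j f) = S j (l2val f)) ->
  l2val (mpow T al f) = mpow S al (l2val f).
Proof.
move=> ET; rewrite /mpow; elim: (enum 'I_d) => //= j l <-.
by elim: (al j) => //= n IH; rewrite ET IH.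
Qed.

Theorem subnormal_cm : joint_subnormal S -> forall f, l2 f ->
  completely_monotone (fun al => nrm2 (opPow S al f)).
Proof.
move=> [I [J [N [[J1 J2 J3] nN NN NJ]]]] f lf.
have [T [lT ET bT TT]] := lift_tuple.
have [J' [lJ EJ _]] : exists J' : L2 R V -> L2 R I, [/\ islin J',
    forall f, l2val (J' f) = J (l2val f) & forall f, hq L2form (J' f) <= 1 * hq L2form f].
  by apply: lift_exists => // g lg; rewrite mul1r J3.
have HN j : exists N' : L2 R I -> L2 R I, exists Ns : L2 R I -> L2 R I, exists c : R,
    [/\ islin N' /\ islin Ns, forall f, l2val (N' f) = N j (l2val f),
      forall f g, L2form (N' f) g = L2form f (Ns g), forall f, Ns (N' f) = N' (Ns f)
      & forall f, hq L2form (N' f) <= c * hq L2form f].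
  have [bN [N1 [[bN1 adj] comm]]] := nN j.
  have [n1 n2 [c Hc]] := bN; have [m1 m2 [c' Hc']] := bN1.
  have [N' [lN' EN' bN']] := lift_exists n1 n2 Hc.
  have [Ns [lNs ENs _]] := lift_exists m1 m2 Hc'.
  exists N', Ns, c; split=> //.
  - by move=> g h; rewrite /= /L2ip EN' ENs; apply: adj; exact: L2P.
  - by move=> g; apply: L2_inj => x; rewrite !(EN', ENs) comm //; exact: L2P.
have [A HA] := choice HN; have [As HAs] := choice HA; have [c Hc] := choice HAs.
have lA j : islin (A j) by have [[]] := Hc j.
have lAs j : islin (As j) by have [[]] := Hc j.
have EA j g : l2val (A j g) = N j (l2val g) by have [] := Hc j.
have adjA j g h : L2form (A j g) h = L2form g (As j h) by have [] := Hc j.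
have AN j g : As j (A j g) = A j (As j g) by have [] := Hc j.
(* [bounded_op] supplies [c j] without a sign, hence the absolute value. *)
have bA j g : hn L2form (A j g) <= Num.sqrt `|c j| * hn L2form g.
  rewrite /hn -sqrtrM //; apply: ler_wsqrtr.
  have [_ _ _ _ /(_ g) /le_trans] := Hc j; apply.
  by apply: ler_wpM2r; rewrite ?hq_ge0 // ler_norm.
have AA j k g : A j (A k g) = A k (A j g).
  by apply: L2_inj => x; rewrite !EA NN //; exact: L2P.
have AAs j k g : A j (As k g) = As k (A j g).
  exact: (fuglede (lA k) (lAs k) (lA j) (adjA k) (fun x => esym (AN k x))
    (sqrtr_ge0 _) (sqrtr_ge0 _) (bA k) (bA j) (AA j k) (@L2_definite _ _) g).
have AJ j g : A j (J' g) = J' (T j g).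
  by apply: L2_inj => x; rewrite EA !EJ ET NJ //; exact: L2P.
pose F := toL2 lf.
have hqJ g : hq L2form (J' g) = hq L2form g.
  by rewrite !L2_hq EJ J3 //; exact: L2P.
(* On the range of the isometry [J'] the extension acts as the contractive tuple [T]. *)
have Gx : bounded_orbit L2form A (J' F).
  exists (hq L2form F) => w; rewrite (_ : word A w (J' F) = J' (word T w F)).
    by rewrite hqJ; elim: w => [|j w IH]; rewrite ?lexx // word_cons (le_trans (bT _ _)).
  by elim: w => // j w IH; rewrite !word_cons IH AJ.
have := bounded_orbit_cm lA adjA AA AAs Gx.
rewrite (_ : (fun al => _) = (fun al => nrm2 (opPow S al f))) //.
apply/funext => al; rewrite opPowE -[f]/(l2val F) -(mpow_lift _ _ ET) -L2_hq -hqJ.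
congr (hq _ _); rewrite /mpow; elim: (enum 'I_d) => //= j l ->.
by elim: (al j) => //= n ->; rewrite AJ.
Qed.

End SubnormalCM.

(** * Rooted trees and their products *)

Section Tree.
Variables (U : countType) (E : U -> U -> Prop) (root : U).
Hypothesis tr : rooted_directed_tree E root.

Lemma parentP p u : E p u -> parent E u = p.
Proof.
move=> pu; have [[_ _ _ uniq_par] _ _] := tr.
by apply: (uniq_par u) => //; rewrite /parent; exact: (xgetPex u (ex_intro (fun p => E p u) p pu)).
Qed.

Lemma parent_edge u : u <> root -> E (parent E u) u.
Proof.
by move=> ur; have [_ _ /(_ u ur) [p pu]] := tr; rewrite (parentP pu).
Qed.

(** [parent] falls back to its argument, so iterated ancestors stay at the root once they reach
    it. *)
Lemma parent_root : parent E root = root.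
Proof.
have [_ noE _] := tr; rewrite /parent; case: xgetP => // p _ pr.
by case: (noE p).
Qed.

(** Follow an unoriented path from the root: a forward edge raises the depth by one, and a backward
    edge leads to the unique parent, which has already been reached. The root admits no backward
    edge. *)
Lemma ChiN_exists u : exists n, ChiN E root n u.
Proof.
have [[_ _ conn uniq_par] noE _] := tr.
have [n [p [p0 pn step]]] := conn root u.
rewrite -pn; elim: n p p0 {pn} step => [|n IH] p p0 step; first by exists 0%N; rewrite p0.
have [m Hm] : exists m, ChiN E root m (p n) by apply: IH => // i /ltnW; exact: step.
case: (step n (ltnSn n)) => [e|e]; first by exists m.+1; exists (p n).
case: m Hm => [|m] /=; first by move=> pr; rewrite pr in e; case: (noE _ e).
by move=> [q [Hq eq]]; exists m; rewrite (uniq_par _ _ _ e eq).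
Qed.

Lemma ChiN_unique n m u : ChiN E root n u -> ChiN E root m u -> n = m.
Proof.
have [[_ _ _ uniq_par] noE _] := tr.
elim: n m u => [|n IH] [|m] u //=.
- by move=> -> [q [_ e]]; case: (noE _ e).
- by move=> [q [_ e]] ur; rewrite ur in e; case: (noE _ e).
- move=> [p [Hp ep]] [q [Hq eq]]; congr S; apply: (IH _ p) => //.
  by rewrite (uniq_par _ _ _ ep eq).
Qed.

Definition tdepth u := xget 0%N [set n | ChiN E root n u].

Lemma tdepthP u : ChiN E root (tdepth u) u.
Proof. exact: (xgetPex _ (ChiN_exists u)). Qed.

Lemma tdepth_eq n u : ChiN E root n u -> tdepth u = n.
Proof. by move=> H; exact: ChiN_unique (tdepthP u) H. Qed.

Lemma tdepth_root : tdepth root = 0%N. Proof. exact: tdepth_eq. Qed.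

Lemma tdepth_child p u : E p u -> tdepth u = (tdepth p).+1.
Proof. by move=> e; apply: tdepth_eq; exists p; split=> //; exact: tdepthP. Qed.

Lemma tdepth0 u : tdepth u = 0%N -> u = root.
Proof. by move=> u0; have := tdepthP u; rewrite u0. Qed.

Lemma tdepth_parent u : tdepth (parent E u) = (tdepth u).-1.
Proof.
have [->|ur] := pselect (u = root); first by rewrite parent_root tdepth_root.
by rewrite (tdepth_child (parent_edge ur)).
Qed.

Definition anc k u := iter k (parent E) u.

Lemma tdepth_anc k u : tdepth (anc k u) = (tdepth u - k)%N.
Proof.
by elim: k => [|k IH]; rewrite ?subn0 // /anc iterS tdepth_parent IH subnS.
Qed.

(** The ancestor order, with the number of steps read off from the depths. *)
Definition tle u x := (tdepth u <= tdepth x)%N /\ anc (tdepth x - tdepth u) x = u.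

Lemma tle_refl u : tle u u. Proof. by rewrite /tle subnn. Qed.

Lemma tle_trans v u x : tle u v -> tle v x -> tle u x.
Proof.
move=> [duv av] [dvx ax]; split; first exact: leq_trans dvx.
rewrite (_ : tdepth x - tdepth u = (tdepth v - tdepth u) + (tdepth x - tdepth v))%N; last by lia.
by rewrite /anc iterD -/(anc _ x) ax.
Qed.

(** The ancestors of one vertex form a chain ordered by depth. *)
Lemma tle_below u v x : tle u x -> tle v x -> (tdepth u <= tdepth v)%N -> tle u v.
Proof.
move=> [dux au] [dvx av] duv; split=> //.
have -> : anc (tdepth v - tdepth u) v =
    anc ((tdepth v - tdepth u) + (tdepth x - tdepth v)) x by rewrite /anc iterD -/(anc _ x) av.
by rewrite (_ : _ + _ = tdepth x - tdepth u)%N //; lia.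
Qed.

Lemma tle_anc m u x : tdepth x = (tdepth u + m)%N -> anc m x = u -> tle u x.
Proof.
move=> dx ax; split; first by rewrite dx leq_addr.
by rewrite dx addKn.
Qed.

End Tree.

Arguments anc {U} E k u.

(** * Descendants and common descendants in a product of trees *)

Section Product.
Variables (R : realType) (d : nat) (U : 'I_d -> countType).
Variables (E : forall j, U j -> U j -> Prop) (root : forall j, U j).
Arguments E : clear implicits.
Hypothesis tr : forall j, rooted_directed_tree (E j) (root j).
Local Notation V := (prodV U).
Implicit Types (u v w x y : V) (m : 'I_d -> nat).

Definition depthV v j := tdepth (E j) (root j) (v j).

Definition pack j w : V := @dfwith _ (fun k => U k) w j (parent (E j) (w j)).

Definition le_V u x := forall j, tle (E j) (root j) (u j) (x j).

(** Membership of y in Chi^<m>(u), read upwards from y, where the path is unique. The depth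
    condition excludes ancestors that have stopped at a root. *)
Definition descV m u y :=
  forall j, depthV y j = (depthV u j + m j)%N /\ anc (E j) (m j) (y j) = u j.

Lemma pack_same j w : pack j w j = parent (E j) (w j).
Proof. by rewrite /pack dfwithin. Qed.

Lemma pack_other j k w : k != j -> pack j w k = w k.
Proof. by move=> kj; rewrite /pack dfwithout // eq_sym. Qed.

Lemma depth_pack j w : w j <> root j -> depthV w = shift_e (depthV (pack j w)) j.
Proof.
move=> wr; apply/funext => k; rewrite /shift_e /depthV; have [->|kj] := eqVneq k j.
  by rewrite pack_same addn1 (tdepth_child (tr j) (parent_edge (tr j) wr)).
by rewrite pack_other // addn0.
Qed.

Lemma depth_eq0 w : depthV w = (fun=> 0%N) -> w = root.
Proof.
move=> w0; apply: functional_extensionality_dep => j.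
by apply: (tdepth0 (tr j)); exact: (congr1 (fun f => f j) w0).
Qed.


Lemma desc0 u : descV (fun=> 0%N) u u.
Proof. by move=> j; rewrite addn0. Qed.

Lemma desc0_eq u y : descV (fun=> 0%N) u y -> y = u.
Proof. by move=> H; apply: functional_extensionality_dep => j; have [_] := H j. Qed.

Lemma desc_le m u y : descV m u y <-> le_V u y /\ forall j, depthV y j = (depthV u j + m j)%N.
Proof.
split=> [H|[H dy] j].
  by split=> j; have [dy ay] := H j; [exact: tle_anc ay | exact: dy].
split=> //; have [_] := H j.
by rewrite -!/(depthV _ j) dy addKn.
Qed.

Lemma desc_shift j m u w : w j <> root j -> descV (shift_e m j) u w <-> descV m u (pack j w).
Proof.
move=> wr.
have D k : depthV w k = (depthV (pack j w) k + (k == j))%N by rewrite (depth_pack wr).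
split=> H k; have [dk ak] := H k; move: (D k) dk ak; rewrite /shift_e.
  have [->|kj] := eqVneq k j; last by rewrite !addn0 pack_other // => -> -> ->.
  rewrite !addn1 pack_same /anc -iterSr => -> + ->; rewrite addnS => -[->] //.
have [->|kj] := eqVneq k j; last by rewrite !addn0 pack_other // => -> -> ->.
by rewrite !addn1 pack_same /anc -iterSr => -> -> ->; rewrite addnS.
Qed.

Lemma desc_shift_root j m u w : w j = root j -> ~ descV (shift_e m j) u w.
Proof.
move=> wr /(_ j) []; rewrite /depthV wr (tdepth_root (tr j)) /shift_e eqxx addn1 addnS.
by [].
Qed.

Definition ancV m y : V := fun j => anc (E j) (m j) (y j).

(** The intermediate vertex is forced: it is the m-th ancestor of y. *)
Lemma desc_add k m u y : descV (fun j => k j + m j)%N u y <->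
  descV k u (ancV m y) /\ descV m (ancV m y) y.
Proof.
split=> [H|[H1 H2] j].
  have D j : depthV (ancV m y) j = (depthV u j + k j)%N.
    have [dy _] := H j; rewrite [LHS]/depthV (tdepth_anc (tr j)) -/(depthV y j) dy; lia.
  split=> j; have [dy ay] := H j; split; rewrite ?D //; last by rewrite dy addnA.
  by rewrite /ancV /anc -iterD.
have [d1 a1] := H1 j; have [d2 a2] := H2 j; split.
  by rewrite d2 d1 addnA.
by rewrite /anc iterD.
Qed.

Lemma desc_anc m u y : descV m u y -> ancV m y = u.
Proof. by move=> H; apply: functional_extensionality_dep => j; have [_] := H j. Qed.

Lemma le_V_refl v : le_V v v. Proof. by move=> j; exact: tle_refl. Qed.

Lemma le_V_trans v u x : le_V u v -> le_V v x -> le_V u x.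
Proof. by move=> uv vx j; exact: tle_trans (uv j) (vx j). Qed.

(** The deeper vertex in each coordinate. It is a least upper bound exactly when [v] and [w] are
    compatible. *)
Definition joinV v w : V := fun j => if (depthV v j <= depthV w j)%N then w j else v j.

Lemma depth_join v w j : depthV (joinV v w) j = maxn (depthV v j) (depthV w j).
Proof.
by rewrite [LHS]/depthV /joinV; case: leqP.
Qed.

Definition compatibleV v w := le_V v (joinV v w) /\ le_V w (joinV v w).

(** In each tree two vertices have a common descendant only if they are comparable. Thus a product
    of two indicators of descendant sets is again such an indicator, or 0. *)
Lemma join_ub v w x : le_V v x /\ le_V w x <-> compatibleV v w /\ le_V (joinV v w) x.
Proof.
split=> [[vx wx]|[[vj wj] jx]]; last by split; [exact: le_V_trans jx|exact: le_V_trans jx].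
have jx : le_V (joinV v w) x by move=> j; rewrite /joinV; case: leqP.
split=> //; split=> j; rewrite /joinV; case: leqP => h; try exact: tle_refl.
  exact: tle_below (vx j) (wx j) h.
by apply: tle_below (wx j) (vx j) _; exact: ltnW.
Qed.


Lemma join_le v w : le_V v w -> joinV v w = w.
Proof.
by move=> vw; apply: functional_extensionality_dep => j; rewrite /joinV; have [-> _] := vw j.
Qed.

Lemma joinC v w : compatibleV v w -> joinV v w = joinV w v.
Proof.
move=> [vj wj]; apply: functional_extensionality_dep => j; move: (vj j) (wj j).
rewrite /joinV; case: (ltngtP (depthV v j) (depthV w j)) => // h.
by move=> [_ +] _; rewrite -!/(depthV _ _) /tle -/(depthV v j) -/(depthV w j) h subnn.
Qed.

Lemma compatibleC v w : compatibleV v w <-> compatibleV w v.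
Proof.
have H v' w' : compatibleV v' w' -> compatibleV w' v'.
  by move=> c; have := joinC c; case: c => vj wj e; split; rewrite -e.
by split; exact: H.
Qed.

End Product.

(** * Weights of a commuting multishift *)

Lemma mem_asbool (T : Type) (A : set T) x : (x \in A) = `[< A x >].
Proof. by apply/idP/idP => [/set_mem/asboolP|/asboolP/mem_set]. Qed.

Lemma rsum_fiber (R : realType) (I J : choiceType) (F : J -> R) (D : set J)
    (Q : set I) (an : J -> I) :
  (forall y, 0 <= F y) -> (forall y, D y -> Q (an y)) ->
  rsummable (fun y => if `[< D y >] then F y else 0) ->
  rsummable (fun x => if `[< Q x >] then
     rsum (fun y => if `[< D y /\ an y = x >] then F y else 0) else 0) /\
  rsum (fun y => if `[< D y >] then F y else 0) =
  rsum (fun x => if `[< Q x >] then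
     rsum (fun y => if `[< D y /\ an y = x >] then F y else 0) else 0).
Proof.
move=> F0 DQ sD; pose G x y := if `[< D y /\ an y = x >] then F y else 0.
have G0 x y : 0 <= G x y by rewrite /G; case: ifP.
have sG x : rsummable (G x).
  apply: rsummable_le sD => y; rewrite ger0_norm // /G.
  by case: asboolP => [[Dy _]|_]; case: asboolP.
have H0 x : 0 <= if `[< Q x >] then rsum (G x) else 0.
  by case: ifP => // _; exact: rsum_ge0.
have E : (\esum_(x in [set: I]) (if `[< Q x >] then rsum (G x) else 0)%:E =
    \esum_(y in [set: J]) (if `[< D y >] then F y else 0)%:E)%E.
  (* Non-negative double sums in the extended reals may be rearranged freely; summability of the
     outer family is read off afterwards. *)
  transitivity (\esum_(x in Q) (\esum_(y in D `&` (an @^-1` [set x])) (F y)%:E))%E.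
    rewrite [RHS]esum_mkcond; apply: eq_esum => x _; rewrite mem_asbool.
    case: ifP => // _; rewrite rsum_nneg_EFin // [in RHS]esum_mkcond; apply: eq_esum => y _.
    by rewrite /G mem_asbool; case: ifP.
  rewrite esum_esum; last by move=> x y _ _; rewrite lee_fin.
  rewrite [RHS](_ : _ = \esum_(y in D) (F y)%:E)%E; last first.
    by rewrite [RHS]esum_mkcond; apply: eq_esum => y _; rewrite mem_asbool; case: ifP.
  symmetry; apply: (reindex_esum _ D snd (fun y => (F y)%:E)).
  split.
  - by move=> [x y] /= [_ []].
  - move=> [x y] [x' y'] /[!inE] /= -[_ [_ e]] [_ [_ e']] yy'.
    by rewrite -e -e' yy'.
  - by move=> y Dy; exists (an y, y) => //=; split; [exact: DQ|split].
have sR : rsummable (fun x => if `[< Q x >] then rsum (G x) else 0).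
  rewrite /rsummable; under eq_esum do rewrite ger0_norm //.
  by rewrite E; apply: le_lt_trans sD; apply: le_esum => y _; rewrite lee_fin ler_norm.
split=> //; rewrite !rsum_nneg //; last by move=> y; case: ifP.
by rewrite E.
Qed.

Section Weights.
Variables (R : realType) (d : nat) (U : 'I_d -> countType).
Variables (E : forall j, U j -> U j -> Prop) (root : forall j, U j).
Variables (lam : 'I_d -> prodV U -> R).
Arguments E : clear implicits.
Hypothesis tr : forall j, rooted_directed_tree (E j) (root j).
Hypothesis lam_gt0 : forall j (w : prodV U), w j <> root j -> 0 < lam j w.
Local Notation V := (prodV U).
Local Notation S := (multishift E root lam).
Hypothesis bS : forall j, bounded_op (S j).
Hypothesis SS : forall j k, commute_op (S j) (S k).
Hypothesis cS : forall j f, l2 f -> nrm2 (S j f) <= nrm2 f.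
Implicit Types (u v w x y : V) (m : 'I_d -> nat).

Lemma multishiftE j f w :
  S j f w = if w j == root j then 0 else (lam j w)%:C%C * f (pack E j w).
Proof. by []. Qed.

Local Notation depth := (depthV E root).
Local Notation desc := (descV E root).

(* The entry at [w] of S^(depth w) e_root is the product of the weights along
   any path from the root to [w]. *)
Lemma weight_exists : exists L : V -> R, (forall w, 0 < L w) /\
  forall j w, w j <> root j -> L w = lam j w * L (pack E j w).
Proof.
have [T [lT ET bT TT]] := lift_tuple bS SS cS.
pose g m y := l2val (mpow T m (delta (root : V))) y.
have gS m j y : g (shift_e m j) y =
    if y j == root j then 0 else (lam j y)%:C%C * g m (pack E j y).
  by rewrite /g (mpowS (P := fun=> True)) // ET multishiftE.
pose Lc w := g (depth w) w.
have LcS j w : w j <> root j -> Lc w = (lam j w)%:C%C * Lc (pack E j w).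
  by move=> wr; rewrite /Lc (depth_pack tr wr) gS; case: eqP.
have Lpos w : exists2 r : R, 0 < r & Lc w = r%:C%C.
  move: {2}(depth w) (erefl (depth w)) => m; move: m w.
  apply: mindex_ind => [w w0|m j IH w wm].
    exists 1 => //; rewrite /Lc w0 (depth_eq0 tr w0) /g mpow0 /= /basis_vec eqxx.
    by [].
  have wr : w j <> root j.
    move=> wr; have := congr1 (fun f => f j) wm.
    by rewrite /depth wr (tdepth_root (tr j)) /shift_e eqxx addn1.
  have : depth (pack E j w) = m.
    apply/funext => k; have := congr1 (fun f => f k) wm.
    by rewrite (depth_pack tr wr) /shift_e => /addIn.
  move=> /IH [r r0 Er]; exists (lam j w * r); first by rewrite mulr_gt0 ?lam_gt0.
  by rewrite (LcS _ _ wr) Er rmorphM.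
exists (fun w => complex.Re (Lc w)); split=> [w|j w wr].
  by have [r r0 ->] := Lpos w.
rewrite (LcS _ _ wr); have [r r0 ->] := Lpos (pack E j w).
by rewrite -rmorphM.
Qed.

Variable L : V -> R.
Hypothesis L_gt0 : forall w, 0 < L w.
Hypothesis LS : forall j w, w j <> root j -> L w = lam j w * L (pack E j w).

Lemma pow_basis m v y : opPow S m (basis_vec R v) y =
  if `[< desc m v y >] then (L y / L v)%:C%C else 0.
Proof.
have [T [lT ET bT TT]] := lift_tuple bS SS cS.
rewrite opPowE -[basis_vec R v]/(l2val (delta v)) -(mpow_lift _ _ ET).
move: m y; apply: mindex_ind => [y|m j IH y].
  rewrite mpow0 /= /basis_vec; case: eqP => [->|yv]; case: asboolP => //.
  - by rewrite divff ?gt_eqF.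
  - by move=> /(_ (desc0 _ _ _)).
  - by move/(desc0_eq).
rewrite (mpowS (P := fun=> True)) // ET multishiftE.
case: eqP => [yr|yr]; first by case: asboolP => // /(desc_shift_root tr yr).
rewrite IH; case: asboolP => H; case: asboolP => H' //; last 2 first.
- by case: H; apply/(desc_shift tr _ _ yr).
- by rewrite mulr0.
- by rewrite (LS yr) -rmorphM mulrA.
- by case: H'; apply/(desc_shift tr _ _ yr).
Qed.

(** The psi_v(m) of the overview, by [nrm2_pow_basis]. The summand does not involve [v], which is
    what makes psi additive over generations. *)
Definition level_mass v m : R := rsum (fun y => if `[< desc m v y >] then L y ^+ 2 else 0).

Lemma psi_summable v m : rsummable (fun y => if `[< desc m v y >] then L y ^+ 2 else 0).
Proof.
have [T [lT ET bT TT]] := lift_tuple bS SS cS.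
have : l2 (opPow S m (basis_vec R v)).
  rewrite opPowE -[basis_vec R v]/(l2val (delta v)) -(mpow_lift _ _ ET).
  exact: L2P.
move/l2E/(rsummableZ (L v ^+ 2)); congr rsummable; apply/funext => y.
rewrite pow_basis; case: ifP => _; last by rewrite sqmod0 mulr0.
by rewrite sqmod_real; field; rewrite gt_eqF.
Qed.

Lemma nrm2_pow_basis v m : nrm2 (opPow S m (basis_vec R v)) = (L v ^+ 2)^-1 * level_mass v m.
Proof.
rewrite nrm2E /level_mass -rsumZ; last exact: psi_summable.
congr rsum; apply/funext => y; rewrite pow_basis; case: ifP => _; last first.
  by rewrite sqmod0 mulr0.
by rewrite sqmod_real; field; rewrite gt_eqF.
Qed.


Lemma psi_le v m : level_mass v m <= L v ^+ 2.
Proof.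
have [T [lT ET bT TT]] := lift_tuple bS SS cS.
have : nrm2 (opPow S m (basis_vec R v)) <= 1.
  rewrite opPowE -[basis_vec R v]/(l2val (delta v)) -(mpow_lift _ _ ET) -L2_hq.
  rewrite -(hq_delta R v) /mpow; elim: (enum 'I_d) => [|j l IH] //=.
  by elim: (m j) => //= n IHn; apply: le_trans (bT _ _) IHn.
by rewrite nrm2_pow_basis mulrC ler_pdivrMr ?mul1r // exprn_gt0.
Qed.

Lemma psi0 v : level_mass v (fun=> 0%N) = L v ^+ 2.
Proof.
rewrite /level_mass (rsum_supp (s := [:: v])) // ?big_seq1.
  by case: asboolP => // /(_ (desc0 _ _ _)).
by move=> y; rewrite inE => /eqP yv; case: asboolP => // /desc0_eq.
Qed.

Lemma psi_add_fiber u k m :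
  rsummable (fun x => if `[< desc k u x >] then level_mass x m else 0) /\
  level_mass u (fun j => k j + m j)%N = rsum (fun x => if `[< desc k u x >] then level_mass x m else 0).
Proof.
have := @rsum_fiber R V V (fun y => L y ^+ 2) [set y | desc (fun j => k j + m j)%N u y]
  [set x | desc k u x] (ancV E m) (fun y => sqr_ge0 _) _ (psi_summable _ _).
case=> [y /= /(desc_add tr)[]//|H1 H2].
have EE : (fun x => if `[< desc k u x >] then level_mass x m else 0) =
  (fun x => if `[< desc k u x >] then rsum (fun y =>
     if `[< desc (fun j => k j + m j)%N u y /\ ancV E m y = x >] then L y ^+ 2 else 0) else 0).
  apply/funext => x; case: asboolP => // ux; congr rsum; apply/funext => y.
  congr (if _ then _ else _); apply: asbool_equiv_eq; split=> [xy|[]].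
    have axy := desc_anc xy.
    by split=> //; apply/(desc_add tr); rewrite axy.
  by move=> /(desc_add tr)[_ +] axy; rewrite axy.
by rewrite EE.
Qed.

End Weights.

(** * Positive semidefinite kernels and Bernstein polynomials *)

Section PSD.
Variables (R : realType).

(** Real coefficients are enough: for a symmetric real kernel the complex form splits into its
    values at real and imaginary parts, as in [form_pos]. Points may repeat in [s], so composition
    with any map is harmless. *)
Definition psd (X : Type) (k : X -> X -> R) := forall s : seq (X * R),
  0 <= \sum_(p <- s) \sum_(q <- s) p.2 * q.2 * k p.1 q.1.

Lemma psd_comp (X Y : Type) (g : Y -> X) (k : X -> X -> R) :
  psd k -> psd (fun x y => k (g x) (g y)).
Proof.
move=> pk s; have := pk [seq (g p.1, p.2) | p <- s].
by rewrite big_map; under eq_bigr do rewrite big_map.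
Qed.

Lemma psd_scale (X : Type) (h : X -> R) (k : X -> X -> R) :
  psd k -> psd (fun x y => h x * h y * k x y).
Proof.
move=> pk s; have := pk [seq (p.1, p.2 * h p.1) | p <- s].
rewrite big_map; under eq_bigr do rewrite big_map.
congr (0 <= _); apply: eq_bigr => p _; apply: eq_bigr => q _ /=; ring.
Qed.

Lemma psd_sum (X J : Type) (r : seq J) (k : J -> X -> X -> R) :
  (forall j, psd (k j)) -> psd (fun x y => \sum_(j <- r) k j x y).
Proof.
move=> pk s.
rewrite (_ : \sum_(p <- s) _ =
  \sum_(j <- r) \sum_(p <- s) \sum_(q <- s) p.2 * q.2 * k j p.1 q.1).
  by apply: sumr_ge0 => j _; exact: pk.
rewrite [RHS]exchange_big /=; apply: eq_bigr => p _.
by rewrite [RHS]exchange_big /=; apply: eq_bigr => q _; rewrite mulr_sumr.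
Qed.

Lemma psd_nneg_scale (X : Type) (a : R) (k : X -> X -> R) :
  0 <= a -> psd k -> psd (fun x y => a * k x y).
Proof.
move=> a0 pk s.
rewrite (_ : \sum_(p <- s) _ = a * \sum_(p <- s) \sum_(q <- s) p.2 * q.2 * k p.1 q.1).
  by rewrite mulr_ge0.
rewrite mulr_sumr; apply: eq_bigr => p _; rewrite mulr_sumr; apply: eq_bigr => q _; ring.
Qed.

Lemma sum_indicators (T : eqType) (r : seq T) (a b : T) : uniq r -> a \in r ->
  \sum_(t <- r) ((a == t)%:R * (b == t)%:R : R) = (a == b)%:R.
Proof.
move=> ur ar; rewrite (bigD1_seq a) //= eqxx mul1r big1 ?addr0 => [|t ta].
  by rewrite eq_sym.
by rewrite eq_sym (negbTE ta) mul0r.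
Qed.

(** The kernel is block diagonal: it is the sum over values t of [k] scaled by the indicator of f =
    t in both variables. *)
Lemma psd_class (X T : eqType) (f : X -> T) (k : X -> X -> R) :
  psd k -> psd (fun x y => if f x == f y then k x y else 0).
Proof.
move=> pk s; pose ind t x : R := (f x == t)%:R.
have pt t : psd (fun x y => ind t x * ind t y * k x y) by exact: psd_scale.
set r := undup [seq f p.1 | p <- s].
rewrite (_ : \sum_(p <- s) _ =
  \sum_(t <- r) \sum_(p <- s) \sum_(q <- s) p.2 * q.2 * (ind t p.1 * ind t q.1 * k p.1 q.1)).
  by apply: sumr_ge0 => t _; exact: pt.
rewrite [RHS]exchange_big /= big_seq [RHS]big_seq; apply: eq_bigr => p ps.
rewrite [RHS]exchange_big /=; apply: eq_bigr => q _.
rewrite -mulr_sumr -mulr_suml sum_indicators ?undup_uniq //.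
  by case: eqP => _; rewrite ?mul1r ?mul0r.
by rewrite mem_undup; apply/mapP; exists p.
Qed.

Lemma psd_rsum (X : Type) (Z : choiceType) (w : Z -> R) (h : Z -> X -> R) :
  (forall z, 0 <= w z) -> (forall x y, rsummable (fun z => w z * (h z x * h z y))) ->
  psd (fun x y => rsum (fun z => w z * (h z x * h z y))).
Proof.
move=> w0 sw s.
rewrite (_ : \sum_(p <- s) _ = rsum (fun z => \sum_(p <- s) \sum_(q <- s)
    p.2 * q.2 * (w z * (h z p.1 * h z q.1)))); last first.
  rewrite rsum_sum => [|p]; last by apply: rsummable_sum => q; exact: rsummableZ.
  apply: eq_bigr => p _; rewrite rsum_sum => [|q]; last exact: rsummableZ.
  by apply: eq_bigr => q _; rewrite rsumZ.
apply: rsum_ge0 => z.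
rewrite (_ : \sum_(p <- s) _ = w z * (\sum_(p <- s) p.2 * h z p.1) ^+ 2).
  by rewrite mulr_ge0 ?sqr_ge0.
rewrite expr2 mulr_suml mulr_sumr; apply: eq_bigr => p _.
rewrite mulr_sumr mulr_sumr; apply: eq_bigr => q _; ring.
Qed.

Lemma telescope_above (f : nat -> R) c M : (c <= M)%N ->
  f c = f M + \sum_(i < M) (if (c <= i)%N then f i - f i.+1 else 0).
Proof.
elim: M => [|m IH]; first by rewrite leqn0 => /eqP ->; rewrite big_ord0 addr0.
rewrite leq_eqVlt => /orP[/eqP ->|].
  by rewrite big1 ?addr0 // => i _; rewrite leqNgt ltn_ord.
by rewrite ltnS => cm; rewrite big_ord_recr /= cm (IH cm); lra.
Qed.

(* [f (max p p')] is a sum of the rank one kernels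
   [(f i - f (i+1)) [p <= i] [p' <= i]]. *)
Lemma psd_max (X : eqType) (f : nat -> R) (p : X -> nat) (k : X -> X -> R) :
  (forall i, 0 <= f i) -> (forall i, f i.+1 <= f i) -> psd k ->
  psd (fun x y => f (maxn (p x) (p y)) * k x y).
Proof.
move=> f0 fd pk s; pose M := (\max_(q <- s) p q.1)%N.
have pM q : q \in s -> (p q.1 <= M)%N.
  by move=> qs; rewrite /M (big_rem q) //= leq_maxl.
pose ind i x : R := (p x <= i)%:R.
pose k' x y := f M * k x y + \sum_(i < M) (f i - f i.+1) * (ind i x * ind i y * k x y).
have pk' : psd k'.
  move=> t; under eq_bigr do under eq_bigr do rewrite /k' mulrDr.
  under eq_bigr do rewrite big_split /=.
  rewrite big_split /= addr_ge0 //; first exact: psd_nneg_scale.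
  apply: (@psd_sum X _ (index_enum _) (fun (i : 'I_M) x y =>
    (f i - f i.+1) * (ind i x * ind i y * k x y))) => i; apply: psd_nneg_scale; first by rewrite subr_ge0.
  exact: psd_scale.
rewrite (_ : \sum_(q <- s) _ = \sum_(q <- s) \sum_(r <- s) q.2 * r.2 * k' q.1 r.1).
  exact: pk'.
rewrite big_seq [RHS]big_seq; apply: eq_bigr => q qs.
rewrite big_seq [RHS]big_seq; apply: eq_bigr => r rs; congr (_ * _).
rewrite /k' (telescope_above f (c := maxn (p q.1) (p r.1)) (M := M)); last first.
  by rewrite geq_max !pM.
rewrite mulrDl mulr_suml; congr (_ + _); apply: eq_bigr => i _.
rewrite geq_max /ind; case: (p q.1 <= i)%N; case: (p r.1 <= i)%N => /=;
  by rewrite ?mul1r ?mul0r ?mulr0.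
Qed.

Lemma psd_prod_max (X : eqType) (J : Type) (l : seq J) (f : J -> nat -> R) (p : J -> X -> nat)
    (k : X -> X -> R) :
  (forall j i, 0 <= f j i) -> (forall j i, f j i.+1 <= f j i) -> psd k ->
  psd (fun x y => \prod_(j <- l) f j (maxn (p j x) (p j y)) * k x y).
Proof.
move=> f0 fd pk; elim: l => [|j l IH].
  have -> // : (fun x y => \prod_(j <- [::]) f j (maxn (p j x) (p j y)) * k x y) = k.
  by apply/funext => x; apply/funext => y; rewrite big_nil mul1r.
have -> : (fun x y => \prod_(i <- j :: l) f i (maxn (p i x) (p i y)) * k x y) =
    (fun x y => f j (maxn (p j x) (p j y)) * (\prod_(j <- l) f j (maxn (p j x) (p j y)) * k x y)).
  by apply/funext => x; apply/funext => y; rewrite big_cons mulrA.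
exact: psd_max.
Qed.

Lemma psd_limit (X : eqType) (k : X -> X -> R) :
  (forall (s : seq X) (e : R), 0 < e -> exists2 k', psd k' &
     forall x y, x \in s -> y \in s -> `|k x y - k' x y| <= e) -> psd k.
Proof.
move=> H s; set A := \sum_(p <- s) _.
pose B := \sum_(p <- s) \sum_(q <- s) `|p.2 * q.2|.
have B0 : 0 <= B by apply: sumr_ge0 => p _; apply: sumr_ge0.
suff K (e : R) : 0 < e -> - (B * e) <= A.
  rewrite leNgt; apply/negP => A0.
  (* With this e one has Be <= -A/2, so A >= A/2, contrary to A < 0. The 1 guards against B = 0. *)
  have := K (- A / (B + 1) / 2); rewrite !divr_gt0 ?oppr_gt0 ?ltr_wpDl // => /(_ isT).
  have : B / (B + 1) <= 1 by rewrite ler_pdivrMr ?ltr_wpDl // mul1r lerDl.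
  rewrite (_ : B * (- A / (B + 1) / 2) = B / (B + 1) * (- A / 2)); last by field; lra.
  by set t := B / _; nra.
move=> e0; have [k' pk' Hk] := H [seq p.1 | p <- s] e e0.
have : `|A - \sum_(p <- s) \sum_(q <- s) p.2 * q.2 * k' p.1 q.1| <= B * e.
  rewrite -sumrB mulr_suml; apply: le_trans (ler_norm_sum _ _ _) _.
  rewrite big_seq [leRHS]big_seq; apply: ler_sum => p ps.
  rewrite -sumrB mulr_suml; apply: le_trans (ler_norm_sum _ _ _) _.
  rewrite big_seq [leRHS]big_seq; apply: ler_sum => q qs.
  rewrite -mulrBr normrM ler_wpM2l //; apply: Hk; exact: map_f.
rewrite ler_norml => /andP[+ _]; have := pk' s; lra.
Qed.

End PSD.

(** * Differences of multisequences and Bernstein expansions *)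

Section Bernstein.
Variables (R : realType) (d : nat).
Implicit Types (F : ('I_d -> nat) -> R) (al be m n : 'I_d -> nat).

Lemma shift_eC al j k : shift_e (shift_e al j) k = shift_e (shift_e al k) j.
Proof. by apply/funext => i; rewrite /shift_e addnAC. Qed.

Lemma nablaPowS F be j :
  nablaPow (shift_e be j) F = nabla j (nablaPow be F).
Proof.
apply: (mpowS (P := fun=> True)) => // k l G _; apply/funext => al.
by rewrite /nabla (shift_eC al k l); lra.
Qed.

Lemma nablaPow0 F : nablaPow (fun=> 0%N) F = F.
Proof. exact: mpow0. Qed.

(** Under the linear functional sending the monomial X^k to [F k], the iterated difference at [al]
    is the value at the product of the X_j^al_j (1 - X_j)^be_j. Polynomial identities thereby become
    identities between differences. *)
Lemma nablaPow_coef F M be al : (forall j, al j + be j < M)%N ->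
  nablaPow be F al = \sum_(k : {ffun 'I_d -> 'I_M})
    (\prod_j ('X^(al j) * (1 - 'X) ^+ (be j) : {poly R})`_(k j)) * F (fun j => k j).
Proof.
move: be al; apply: mindex_ind => [al alM|be j IH al alM].
  have aM j : (al j < M)%N by have := alM j; rewrite addn0.
  rewrite nablaPow0 (bigD1 [ffun j => Ordinal (aM j)]) //= big1 ?mul1r.
    rewrite big1 ?addr0 => [|k kk].
      by congr F; apply/funext => j; rewrite ffunE.
    have [j kj] : exists j, (k j : nat) != al j.
      apply: contrapT => H; case/eqP: kk; apply/ffunP => j; apply: val_inj.
      rewrite ffunE /=; apply/eqP; apply: contrapT => h; apply: H; exists j.
      exact/negP.
    rewrite (bigD1 j) //= expr0 mulr1 coefXn (negbTE kj) !mul0r.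
    by [].
  by move=> j _; rewrite expr0 mulr1 coefXn ffunE eqxx.
have b1 i : (al i + be i < M)%N.
  by apply: leq_ltn_trans (alM i); rewrite leq_add2l /shift_e leq_addr.
have b2 i : (shift_e al j i + be i < M)%N.
  by have := alM i; rewrite /shift_e; lia.
rewrite nablaPowS /nabla IH // IH // -sumrB; apply: eq_bigr => k _.
rewrite -mulrBl; congr (_ * _).
rewrite !(bigD1 (P := predT) j) //= /shift_e eqxx.
set P1 := \prod_(i | _) _; set P2 := \prod_(i | _) _; set P3 := \prod_(i | _) _.
have -> : P2 = P1 by apply: eq_bigr => i /negbTE ->; rewrite addn0.
have -> : P3 = P1 by apply: eq_bigr => i /negbTE ->; rewrite addn0.
have E : ('X^(al j) : {poly R}) * (1 - 'X) ^+ (be j).+1 =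
    ('X^(al j) : {poly R}) * (1 - 'X) ^+ be j - ('X^((al j).+1) : {poly R}) * (1 - 'X) ^+ be j.
  by rewrite !exprS; ring.
by rewrite !addn1 E coefB mulrBl.
Qed.

(** Expand X^m (X + (1 - X))^(n - m). *)
Lemma sum_bernstein (N n m : nat) : (m <= n)%N -> (n <= N)%N ->
  \sum_(b < N.+1) 'C(n - m, b)%:R *: ('X^(n - b) * (1 - 'X) ^+ b : {poly R}) = 'X^m.
Proof.
move=> mn nN; have nmN : (n - m < N.+1)%N by lia.
have := exprDn ('X : {poly R}) (1 - 'X) (n - m).
rewrite addrC subrK expr1n => /(congr1 (fun p => 'X^m * p)); rewrite mulr1 => E.
rewrite [RHS]E mulr_sumr (big_ord_widen N.+1 (fun b => 'X^m *
   ('X^(n - m - b) * (1 - 'X) ^+ b *+ 'C(n - m, b)))) //.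
rewrite [RHS]big_mkcond /=; apply: eq_bigr => b _; case: ifP => bn.
  rewrite mulrnAr scaler_nat mulrA -exprD; congr (_ * _ *+ _).
  by congr ('X^_); lia.
by rewrite bin_small ?scale0r //; lia.
Qed.

(** [be] ranges up to [N] whatever [n] is, so that expansions attached to vertices of different
    depths share one index set. Where n - be is truncated, the binomial coefficient vanishes. *)
Lemma bernstein F N n m : (forall j, m j <= n j)%N -> (forall j, n j <= N)%N ->
  F m = \sum_(be : {ffun 'I_d -> 'I_N.+1})
    (\prod_j 'C(n j - m j, be j)%:R) * nablaPow (fun j => be j : nat) F (fun j => n j - be j)%N.
Proof.
move=> mn nN.
have FE : F m = \sum_(k : {ffun 'I_d -> 'I_N.+1})
    (\prod_j ('X^(m j) : {poly R})`_(k j)) * F (fun j => k j).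
  rewrite -[F in LHS]nablaPow0 (@nablaPow_coef F N.+1) => [|j].
    by apply: eq_bigr => k _; congr (_ * _); apply: eq_bigr => j _; rewrite expr0 mulr1.
  by rewrite addn0 ltnS (leq_trans (mn j)).
rewrite FE.
transitivity (\sum_(k : {ffun 'I_d -> 'I_N.+1}) \sum_(be : {ffun 'I_d -> 'I_N.+1})
    (\prod_j ('C(n j - m j, be j)%:R *
       ('X^(n j - be j) * (1 - 'X) ^+ (be j) : {poly R})`_(k j))) * F (fun j => k j)).
  apply: eq_bigr => k _; rewrite -mulr_suml; congr (_ * _).
  rewrite -(bigA_distr_bigA (fun j (b : 'I_N.+1) => 'C(n j - m j, b)%:R *
    ('X^(n j - b) * (1 - 'X) ^+ b : {poly R})`_(k j))) /=; apply: eq_bigr => j _.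
  rewrite -(sum_bernstein (mn j) (nN j)) coef_sum; apply: eq_bigr => b _.
  by rewrite coefZ.
rewrite exchange_big /=; apply: eq_bigr => be _.
rewrite (@nablaPow_coef F N.+1) => [|j].
  by rewrite mulr_sumr; apply: eq_bigr => k _; rewrite big_split /= mulrA.
by have := ltn_ord (be j); have := nN j; lia.
Qed.

Lemma nablaPow_rsum (I : choiceType) (F : I -> ('I_d -> nat) -> R) (G : ('I_d -> nat) -> R) :
  (forall al, rsummable (fun x => F x al) /\ G al = rsum (fun x => F x al)) ->
  forall be al, rsummable (fun x => nablaPow be (F x) al) /\
    nablaPow be G al = rsum (fun x => nablaPow be (F x) al).
Proof.
move=> H; apply: mindex_ind => [al|be j IH al].
  rewrite nablaPow0 (_ : (fun x => nablaPow _ _ _) = (fun x => F x al)); first exact: H.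
  by apply/funext => x; rewrite nablaPow0.
have [s1 E1] := IH al; have [s2 E2] := IH (shift_e al j).
rewrite (_ : (fun x => nablaPow _ _ _) =
    (fun x => nablaPow be (F x) al - nablaPow be (F x) (shift_e al j))); last first.
  by apply/funext => x; rewrite nablaPowS.
by rewrite nablaPowS /nabla rsumB // E1 E2; split=> //; exact: rsummableB.
Qed.

Lemma nablaPow_scale (a : R) F be al :
  nablaPow be (fun m => a * F m) al = a * nablaPow be F al.
Proof.
move: be al; apply: mindex_ind => [al|be j IH al]; first by rewrite !nablaPow0.
by rewrite !nablaPowS /nabla !IH mulrBr.
Qed.

Lemma nablaPow_shift F j be al :
  nablaPow be (fun m => F (shift_e m j)) al = nablaPow be F (shift_e al j).
Proof.
move: be al; apply: mindex_ind => [al|be k IH al]; first by rewrite !nablaPow0.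
by rewrite !nablaPowS /nabla !IH shift_eC.
Qed.

End Bernstein.

(** * The dilation kernel *)

Section BinomialEstimates.
Variable R : realType.

Lemma bin_step (N b i : nat) : (i < N)%N ->
  (N - i)%:R * ('C(N - i.+1, b)%:R : R) = (N - i - b)%N%:R * 'C(N - i, b)%:R.
Proof.
move=> iN; rewrite -!natrM; congr (_%:R).
have -> : (N - i = (N - i.+1).+1)%N by lia.
by rewrite [LHS]mul_bin_down.
Qed.

(** The ratio 'C(N - i - 1, b) / 'C(N - i, b) = (N - i - b) / (N - i), formally at i = -1. The ratio
    decreases in i, so the node bounds it from above for all i >= 0, and unlike the ratio itself it
    is positive for every b <= N. *)
Definition node (N b : nat) : R := (N.+1 - b)%:R / N.+1%:R.

Lemma node_gt0 N b : (b <= N)%N -> 0 < node N b.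
Proof. by move=> bN; rewrite divr_gt0 // ltr0n; lia. Qed.

Lemma node_le1 N b : node N b <= 1.
Proof. by rewrite ler_pdivrMr ?ltr0n // mul1r ler_nat leq_subr. Qed.

Lemma bin_node_step (N b i : nat) : (i < N)%N -> (b <= N)%N ->
  0 <= node N b * ('C(N - i, b)%:R) - 'C(N - i.+1, b)%:R <=
  i.+1%:R / (N - i)%:R * 'C(N - i, b)%:R.
Proof.
move=> iN bN; set t := 'C(N - i, b)%:R; set t' := 'C(N - i.+1, b)%:R.
have n0 : 0 < (N - i)%:R :> R by rewrite ltr0n subn_gt0.
have N0 : 0 < N.+1%:R :> R by rewrite ltr0n.
have t0 : 0 <= t by rewrite ler0n.
have t'E : t' = (N - i - b)%N%:R / (N - i)%:R * t.
  apply: (mulfI (lt0r_neq0 n0)); rewrite bin_step // !mulrA; congr (_ * _).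
  by rewrite [X in _ = X / _]mulrC mulfK // lt0r_neq0.
have [bi|bi] := leqP b (N - i); last first.
  have -> : t = 0 by rewrite /t bin_small.
  have -> : t' = 0 by rewrite /t' bin_small //; lia.
  by rewrite !mulr0 subrr lexx.
rewrite t'E -mulrBl.
have -> : node N b - (N - i - b)%N%:R / (N - i)%:R =
    b%:R * i.+1%:R / ((N - i)%:R * N.+1%:R) :> R.
  rewrite /node !natrB //; try lia.
  rewrite -!natr1; field.
  by rewrite -natrB ?natr1 ?gt_eqF //; lia.
apply/andP; split; first by rewrite mulr_ge0 ?divr_ge0 ?mulr_ge0 ?ler0n // ltW.
apply: ler_wpM2r => //.
have -> : b%:R * i.+1%:R / ((N - i)%:R * N.+1%:R) =
    i.+1%:R / (N - i)%:R * (b%:R / N.+1%:R) :> R by rewrite invfM; ring.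
rewrite ler_piMr ?divr_ge0 ?ler0n //.
by rewrite ler_pdivrMr // mul1r ler_nat; lia.
Qed.

(** Each of the e - p factors costs a relative error of at most M/(N - M), which tends to 0 as N
    grows with M fixed. *)
Lemma bin_node_approx (N M b p e : nat) : (p <= e)%N -> (e <= M)%N -> (M < N)%N ->
  (b <= N)%N ->
  0 <= 'C(N - p, b)%:R * node N b ^+ (e - p) - 'C(N - e, b)%:R <=
  M%:R * (M%:R / (N - M)%:R) * 'C(N - p, b)%:R.
Proof.
move=> pe eM MN bN; pose t i : R := 'C(N - i, b)%:R.
have x0 := ltW (node_gt0 bN); have x1 := node_le1 N b.
have NM0 : 0 < (N - M)%:R :> R by rewrite ltr0n subn_gt0.
suff K n : (p + n <= M)%N ->
    0 <= t p * node N b ^+ n - t (p + n)%N <= n%:R * (M%:R / (N - M)%:R) * t p.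
  have := K (e - p)%N; rewrite subnKC // => /(_ eM) /andP[-> h] /=.
  apply: le_trans h _; rewrite !ler_wpM2r ?divr_ge0 ?ler0n // ler_nat; lia.
elim: n => [|n IH] pn; first by rewrite addn0 expr0 mulr1 subrr mulr0n !mul0r lexx.
have /IH/andP[h1 h2] : (p + n <= M)%N by lia.
have /andP[h3 h4] := @bin_node_step N b (p + n) ltac:(lia) bN.
rewrite -/(t (p + n)%N) -/(t (p + n).+1) in h3 h4; rewrite addnS.
have E : t p * node N b ^+ n.+1 - t (p + n).+1 =
    node N b * (t p * node N b ^+ n - t (p + n)%N) +
    (node N b * t (p + n)%N - t (p + n).+1) by rewrite exprS; ring.
have tt : t (p + n)%N <= t p by rewrite ler_nat leq_bin2l // ; lia.
have q0 : 0 <= M%:R / (N - M)%:R :> R by rewrite divr_ge0 ?ler0n.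
have h5 : (p + n).+1%:R / (N - (p + n))%:R * t (p + n)%N <= M%:R / (N - M)%:R * t p.
  apply: ler_pM; rewrite ?divr_ge0 ?ler0n //.
  apply: ler_pM; rewrite ?invr_ge0 ?ler0n ?ler_nat //; first by lia.
  by rewrite lef_pV2 ?posrE ?ltr0n ?ler_nat //; lia.
rewrite E; apply/andP; split; first by rewrite addr_ge0 // mulr_ge0.
have h6 : node N b * (t p * node N b ^+ n - t (p + n)%N) <= t p * node N b ^+ n - t (p + n)%N.
  by rewrite ler_piMl.
by rewrite -natr1; lra.
Qed.

Lemma prod_diff_le (J : Type) (l : seq J) (t t' T : J -> R) (eta : R) : 0 <= eta ->
  (forall j, 0 <= t j) -> (forall j, t' j <= T j) ->
  (forall j, 0 <= t' j - t j <= eta * T j) ->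
  0 <= \prod_(j <- l) t' j - \prod_(j <- l) t j <= (size l)%:R * eta * \prod_(j <- l) T j.
Proof.
move=> e0 t0 tT H.
have t't j : t j <= t' j by have /andP[h _] := H j; rewrite -subr_ge0.
have P0 (f : J -> R) : (forall j, 0 <= f j) -> forall r, 0 <= \prod_(j <- r) f j.
  by move=> f0 r; apply: prodr_ge0.
have t'0 j : 0 <= t' j := le_trans (t0 j) (t't j).
have T0 j : 0 <= T j := le_trans (t'0 j) (tT j).
elim: l => [|j l /andP[h1 h2]]; first by rewrite !big_nil subrr mulr0n !mul0r lexx.
rewrite !big_cons.
set a := \prod_(i <- l) t i in h1 h2 *; set a' := \prod_(i <- l) t' i in h1 h2 *.
set A := \prod_(i <- l) T i in h2 *.
have a0 : 0 <= a by exact: P0.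
have aA : a' <= A by apply: ler_prod => i; rewrite t'0 tT.
have /andP[k1 k2] := H j.
have -> : t' j * a' - t j * a = t' j * (a' - a) + (t' j - t j) * a by ring.
apply/andP; split; first by rewrite addr_ge0 // mulr_ge0.
have m1 : t' j * (a' - a) <= T j * ((size l)%:R * eta * A).
  by apply: ler_pM.
have m2 : (t' j - t j) * a <= eta * T j * A.
  by apply: ler_pM => //; lra.
by rewrite /= -natr1; lra.
Qed.

End BinomialEstimates.

(** * The dilation kernel and its positivity *)

Section Kernel.
Variables (R : realType) (d : nat) (U : 'I_d -> countType).
Variables (E : forall j, U j -> U j -> Prop) (root : forall j, U j).
Arguments E : clear implicits.
Hypothesis tr : forall j, rooted_directed_tree (E j) (root j).
Local Notation V := (prodV U).
Local Notation depth := (depthV E root).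
Local Notation desc := (descV E root).
Local Notation join := (joinV E root).
Local Notation compatible := (compatibleV E root).
Local Notation le_V := (le_V E root).
Implicit Types (u v w x y : V) (m : 'I_d -> nat).

Variable psi : V -> ('I_d -> nat) -> R.
Hypothesis psi_fiber : forall u k m,
  rsummable (fun x => if `[< desc k u x >] then psi x m else 0) /\
  psi u (fun j => k j + m j)%N = rsum (fun x => if `[< desc k u x >] then psi x m else 0).
Hypothesis psi_cm : forall u, completely_monotone (psi u).

(** Differences act on m alone, so additivity over descendants survives. By complete monotonicity,
    each difference of psi_u at k is thus a sum of non-negative masses at the k-th descendants. *)
Lemma nabla_fiber u k be :
  rsummable (fun x => if `[< desc k u x >] then nablaPow be (psi x) (fun=> 0%N) else 0) /\
  nablaPow be (psi u) k =
  rsum (fun x => if `[< desc k u x >] then nablaPow be (psi x) (fun=> 0%N) else 0).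
Proof.
have := @nablaPow_rsum R d V (fun x m => if `[< desc k u x >] then psi x m else 0)
  (fun m => psi u (fun j => k j + m j)%N) (fun m => psi_fiber u k m) be (fun=> 0%N).
have -> : nablaPow be (fun m => psi u (fun j => k j + m j)%N) (fun=> 0%N) =
    nablaPow be (psi u) k.
  suff H m : nablaPow be (fun m => psi u (fun j => k j + m j)%N) m =
      nablaPow be (psi u) (fun j => k j + m j)%N.
    by rewrite H; congr (nablaPow be (psi u) _); apply/funext => j; rewrite addn0.
  move: be m; apply: mindex_ind => [m|be j IH m]; first by rewrite !nablaPow0.
  rewrite !nablaPowS /nabla !IH; congr (_ - nablaPow be (psi u) _).
  by apply/funext => i; rewrite /shift_e addnA.
suff -> : (fun x => nablaPow be (fun m => if `[< desc k u x >] then psi x m else 0) (fun=> 0%N)) =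
  (fun x => if `[< desc k u x >] then nablaPow be (psi x) (fun=> 0%N) else 0) by move=> H; exact: H.
apply/funext => x; case: ifP => _ //.
have H m : nablaPow be (fun=> 0) m = 0 :> R.
  move: be m; apply: mindex_ind => [m|be j IH m]; first by rewrite nablaPow0.
  by rewrite nablaPowS /nabla !IH subrr.
exact: H.
Qed.

Section Level.
Variables (be ka : 'I_d -> nat).

Let eta x : R := if `[< depth x = ka >] then nablaPow be (psi x) (fun=> 0%N) else 0.

Let eta_ge0 x : 0 <= eta x.
Proof. by rewrite /eta; case: ifP => // _; exact: psi_cm. Qed.

Let below x v : R := if `[< le_V v x >] then 1 else 0.

Lemma level_sum u :
  rsummable (fun x => eta x * below x u) /\
  rsum (fun x => eta x * below x u) =
  if `[< forall j, (depth u j <= ka j)%N >] then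
    nablaPow be (psi u) (fun j => ka j - depth u j)%N else 0.
Proof.
case: asboolP => [uk|uk]; last first.
  have z x : eta x * below x u = 0.
    rewrite /eta /below; case: asboolP => [xk|]; last by rewrite mul0r.
    case: asboolP => [ux|]; last by rewrite mulr0.
    by case: uk => j; rewrite -xk; have [] := ux j.
  split; first by apply: (rsummable_supp (s := [::])).
  by rewrite (rsum_supp (s := [::])) ?big_nil.
have [s1 e1] := nabla_fiber u (fun j => ka j - depth u j)%N be.
have EE : (fun x => eta x * below x u) = (fun x => if `[< desc (fun j => ka j - depth u j)%N u x >]
    then nablaPow be (psi x) (fun=> 0%N) else 0).
  apply/funext => x; rewrite /eta /below.
  case: (asboolP (desc _ _ _)) => [/desc_le[ux dx]|H].
    have -> : depth x = ka by apply/funext => j; rewrite dx subnKC.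
    by rewrite asboolT // asboolT // mulr1.
  case: asboolP => [xk|]; last by rewrite mul0r.
  case: asboolP => [ux|]; last by rewrite mulr0.
  case: H; apply/desc_le; split=> // j; rewrite -xk; have [ujx _] := ux j.
  by rewrite subnKC.
by rewrite EE e1.
Qed.

(** Closed form of a Gram matrix: the inner product, with weights [eta] on the vertices of depth
    [ka], of the indicators of the descendants of v and of w. *)
Definition gram v w : R :=
  if `[< compatible v w >] && `[< forall j, (depth (join v w) j <= ka j)%N >] then
    nablaPow be (psi (join v w)) (fun j => ka j - depth (join v w) j)%N else 0.

Lemma gram_psd : psd gram.
Proof.
have below2 v w x : below x v * below x w =
    if `[< compatible v w >] then below x (join v w) else 0.
  rewrite /below; case: (asboolP (le_V v x)) => vx; last first.
    rewrite mul0r; case: asboolP => // c; case: asboolP => // jx; case: vx.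
    by have [] := (iffRL (join_ub E root v w x)) (conj c jx).
  case: (asboolP (le_V w x)) => wx; last first.
    rewrite mulr0; case: asboolP => // c; case: asboolP => // jx; case: wx.
    by have [] := (iffRL (join_ub E root v w x)) (conj c jx).
  have [c jx] := (iffLR (join_ub E root v w x)) (conj vx wx).
  by rewrite !asboolT // mulr1.
have sm v w : rsummable (fun x => eta x * (below x v * below x w)).
  have -> : (fun x => eta x * (below x v * below x w)) =
      if `[< compatible v w >] then (fun x => eta x * below x (join v w)) else fun=> 0.
    by case: ifP => c; apply/funext => x; rewrite below2 c ?mulr0.
  case: ifP => _; first by have [] := level_sum (join v w).
  by apply: (rsummable_supp (s := [::])).
have -> : gram = fun v w => rsum (fun x => eta x * (below x v * below x w)).
  apply/funext => v; apply/funext => w; rewrite /gram; case: ifPn => [/andP[c k]|].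
    have [_] := level_sum (join v w); rewrite k => <-.
    by congr rsum; apply/funext => x; rewrite below2 c.
  rewrite negb_and; case: (boolP `[< compatible v w >]) => /= c k.
    have [_] := level_sum (join v w); rewrite (negbTE k) => <-.
    by congr rsum; apply/funext => x; rewrite below2 c.
  rewrite (rsum_supp (s := [::])) ?big_nil // => x _.
  by rewrite below2 (negbTE c) mulr0.
exact: psd_rsum.
Qed.

End Level.
(* The point [(v, (a, r))] stands for the vector N^*a N^r (L(v) e_v) of the
   dilation space. *)
Definition point : eqType := (V * ({ffun 'I_d -> nat} * {ffun 'I_d -> nat}))%type.
Implicit Types p q : point.

Definition hgt p j := (depth p.1 j + p.2.2 j)%N.
Definition charge p : {ffun 'I_d -> int} := [ffun j => (hgt p j)%:Z - (p.2.1 j)%:Z].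

(** In the measure model, integration over theta forces equal frequencies ([charge]), and the ends
    below both vertices are those below the join u. What remains is the integral of t^(e - depth u)
    against nu_u, where 2e is the sum of [hgt] and of the adjoint exponent over both points; for
    equal charges e = hgt p + a_q. *)
Definition kernel p q : R := if (charge p == charge q) && `[< compatible p.1 q.1 >] then
  psi (join p.1 q.1) (fun j => hgt p j + q.2.1 j - depth (join p.1 q.1) j)%N else 0.

Lemma chargeP p q : charge p = charge q ->
  forall j, (hgt p j + q.2.1 j = hgt q j + p.2.1 j)%N.
Proof. by move=> + j => /(congr1 (fun f => (f : {ffun _ -> _}) j)); rewrite !ffunE; lia. Qed.

Lemma depth_join_le p q j : charge p = charge q ->
  (depth (join p.1 q.1) j <= hgt p j + q.2.1 j)%N.
Proof. by move=> /chargeP /(_ j) e; rewrite depth_join geq_max; move: e; rewrite /hgt; lia. Qed.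

Section Approximation.
Variable N : nat.
Implicit Type be : {ffun 'I_d -> 'I_N.+1}.

Let x be j : R := node R N (be j).
Let x_gt0 be j : 0 < x be j.
Proof. by apply: node_gt0; rewrite -ltnS. Qed.

(** Decreasing in the depth i because the node dominates every binomial ratio; this is what
    [psd_prod_max] requires at the depth of a join. *)
Let f be j i : R := 'C(N - i, be j)%:R / x be j ^+ i.

Let f_ge0 be j i : 0 <= f be j i.
Proof. by rewrite divr_ge0 ?ler0n // exprn_ge0 // ltW. Qed.

Let f_dec be j i : f be j i.+1 <= f be j i.
Proof.
rewrite /f ler_pdivrMr ?exprn_gt0 // exprS mulrA mulrAC mulfVK ?expf_neq0 ?gt_eqF //.
have bN : (be j <= N)%N by rewrite -ltnS.
have [iN|Ni] := ltnP i N.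
  by have /andP[h _] := @bin_node_step R N (be j) i iN bN; rewrite mulrC -subr_ge0.
have -> : (N - i = 0)%N by lia.
have -> : (N - i.+1 = 0)%N by lia.
rewrite /x; case: (nat_of_ord (be j)) => [|b]; last by rewrite bin0n mul0r.
by rewrite /node subn0 divff ?mulr1 // pnatr_eq0.
Qed.

(** For equal charges the exponents at p and q add up to 2e, so the two square roots combine to
    x^e. *)
Let h be p : R := \prod_j Num.sqrt (x be j) ^+ (p.2.1 j + hgt p j).

Let ker_be be p q : R := if charge p == charge q then
  h be p * h be q * (\prod_j f be j (maxn (depth p.1 j) (depth q.1 j)) *
    gram (fun j => be j : nat) (fun j => N - be j)%N p.1 q.1) else 0.

(* The Bernstein weight 'C(N - e, be) of [psi], where [e] is the exponent of t in
   the inner product, is not a positive kernel; it is replaced by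
   'C(N - depth, be) x^(e - depth), which is one. *)
Definition kernel_approx p q : R := \sum_be ker_be be p q.

Lemma kernel_approx_psd : psd kernel_approx.
Proof.
apply: psd_sum => be; apply: psd_class; apply: psd_scale.
by apply: psd_prod_max => //; apply: (psd_comp (fun p : point => p.1)); exact: gram_psd.
Qed.

Let D be u := nablaPow (fun j => be j : nat) (psi u) (fun j => N - depth u j - be j)%N.

Let ker_beE be p q : charge p = charge q -> compatible p.1 q.1 ->
  (forall j, depth (join p.1 q.1) j <= N)%N -> let u := join p.1 q.1 in
  ker_be be p q = \prod_j ('C(N - depth u j, be j)%:R *
    x be j ^+ (hgt p j + q.2.1 j - depth u j)) * D be u.
Proof.
move=> cpq comp leN u; rewrite /ker_be cpq eqxx.
have hh : h be p * h be q = \prod_j x be j ^+ (hgt p j + q.2.1 j).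
  rewrite /h -big_split; apply: eq_bigr => j _ /=; rewrite -exprD.
  have -> : (p.2.1 j + hgt p j + (q.2.1 j + hgt q j) = 2 * (hgt p j + q.2.1 j))%N.
    by have := chargeP cpq j; lia.
  by rewrite exprM sqr_sqrtr // ltW.
rewrite hh mulrA -big_split /=.
have -> : \prod_j (x be j ^+ (hgt p j + q.2.1 j) * f be j (maxn (depth p.1 j) (depth q.1 j))) =
    \prod_j ('C(N - depth u j, be j)%:R * x be j ^+ (hgt p j + q.2.1 j - depth u j)).
  apply: eq_bigr => j _; rewrite /f -depth_join -/u.
  rewrite -{1}(subnK (depth_join_le j cpq)) -/u exprD.
  by field; rewrite expf_neq0 // gt_eqF.
rewrite /gram (asboolT comp) /=; case: asboolP => H.
  congr (_ * nablaPow _ _ _); apply/funext => j; rewrite -/u; lia.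
(* A join deeper than the level N - be makes [gram] vanish, and the binomial on the other side
   vanishes too. *)
have [j Hj] : exists j, ~ (depth u j <= N - be j)%N.
  by apply: contrapT => H'; apply: H => j; apply: contrapT => H''; apply: H'; exists j.
rewrite mulr0 (bigD1 j) //= bin_small ?mul0r //.
move/negP: Hj; have := ltn_ord (be j); have := leN j; rewrite -/u; lia.
Qed.

Lemma kernel_approx_bound M p q : (M < N)%N -> (forall j, hgt p j + q.2.1 j <= M)%N ->
  `|kernel p q - kernel_approx p q| <=
  d%:R * (M%:R * (M%:R / (N - M)%:R)) * psi (join p.1 q.1) (fun=> 0%N).
Proof.
move=> MN eM; set u := join p.1 q.1.
have q0 : 0 <= M%:R * (M%:R / (N - M)%:R) :> R by rewrite !mulr_ge0 ?invr_ge0 ?ler0n.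
have psi00 : 0 <= psi u (fun=> 0%N).
  by have := psi_cm u (fun=> 0%N) (fun=> 0%N); rewrite nablaPow0.
have rhs0 : 0 <= d%:R * (M%:R * (M%:R / (N - M)%:R)) * psi u (fun=> 0%N).
  by rewrite !mulr_ge0 ?ler0n ?invr_ge0.
rewrite /kernel; case: ifPn => [/andP[/eqP cpq /asboolP comp]|]; last first.
  rewrite negb_and => H; rewrite sub0r normrN.
  rewrite /kernel_approx big1 ?normr0 // => be _; rewrite /ker_be.
  case: ifP => // /eqP cpq; move: H; rewrite cpq eqxx /= => ncomp.
  by rewrite /gram (negbTE ncomp) /= !mulr0.
pose e j := (hgt p j + q.2.1 j)%N.
have pe j : (depth u j <= e j)%N by exact: depth_join_le.
have eN j : (e j <= N)%N by exact: leq_trans (eM j) (ltnW MN).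
rewrite -/u (@bernstein _ _ (psi u) N (fun j => N - depth u j)%N); first last.
- by move=> j; rewrite leq_subr.
- by move=> j; apply: leq_sub2r; exact: eN.
(* Every term of the error is a small multiple of the corresponding non-negative term in the
   expansion of psi_u(0), so the total error is that multiple of psi_u(0). *)
have P0 := @bernstein _ _ (psi u) N (fun j => N - depth u j)%N (fun=> 0%N)
  (fun j => leq0n _) (fun j => leq_subr _ _).
have Dge0 be : 0 <= D be u by exact: psi_cm.
rewrite distrC /kernel_approx -sumrB P0 mulr_sumr.
apply: le_trans (ler_norm_sum _ _ _) _; apply: ler_sum => be _.
rewrite ker_beE //; last by move=> j; exact: leq_trans (pe j) (eN j).
rewrite -/u -[nablaPow _ _ _]/(D be u) -mulrBl [leRHS]mulrA normrM (ger0_norm (Dge0 be)).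
apply: ler_wpM2r => //.
have -> : \prod_j 'C(N - depth u j - 0, be j)%:R = \prod_j 'C(N - depth u j, be j)%:R :> R.
  by apply: eq_bigr => j _; rewrite subn0.
have -> : \prod_j ('C(N - depth u j - (hgt p j + q.2.1 j - depth u j), be j)%:R) =
    \prod_j 'C(N - e j, be j)%:R :> R.
  apply: eq_bigr => j _; congr ('C(_, _)%:R).
  by have := pe j; have := eN j; rewrite /e; lia.
have bN j : (be j <= N)%N by rewrite -ltnS.
have Ha j : 0 <= 'C(N - e j, be j)%:R :> R by rewrite ler0n.
have Hb j : 'C(N - depth u j, be j)%:R * x be j ^+ (e j - depth u j) <=
    'C(N - depth u j, be j)%:R :> R.
  by rewrite ler_piMr ?ler0n // exprn_ile1 ?node_le1 // ltW.
have Hc j := @bin_node_approx R _ _ _ _ _ (pe j) (eM j) MN (bN j).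
have := prod_diff_le (index_enum 'I_d) q0 Ha Hb Hc.
have -> : size (index_enum 'I_d) = d by rewrite -[RHS]card_ord cardT enumT.
by case/andP => h1 h2; rewrite ger0_norm.
Qed.

End Approximation.

Theorem kernel_psd : psd kernel.
Proof.
apply: psd_limit => s e e0.
pose M := (\sum_(p <- s) \sum_(q <- s) \sum_j (hgt p j + q.2.1 j))%N.
pose B : R := \sum_(p <- s) \sum_(q <- s) psi (join p.1 q.1) (fun=> 0%N).
have psi00 u : 0 <= psi u (fun=> 0%N).
  by have := psi_cm u (fun=> 0%N) (fun=> 0%N); rewrite nablaPow0.
pose A : R := d%:R * (M%:R * M%:R) * B.
have B0 : 0 <= B by apply: sumr_ge0 => p _; apply: sumr_ge0.
have A0 : 0 <= A by rewrite !mulr_ge0.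
(* With N = M + k the error bound is at most A/k, and this k makes it less than e. *)
pose k := (Num.truncn (A / e)).+1.
have Ak : A / e < k%:R by exact: truncnS_gt.
have k0 : 0 < k%:R :> R by rewrite ltr0n.
exists (kernel_approx (M + k)); first exact: kernel_approx_psd.
move=> p q ps qs.
have Mk : (M < M + k)%N by rewrite -addn1 leq_add2l.
have eM j : (hgt p j + q.2.1 j <= M)%N.
  rewrite /M (big_rem p) //= (big_rem q) //= (bigD1 j) //=; lia.
apply: le_trans (kernel_approx_bound Mk eM) _.
rewrite addKn.
have Bpq : psi (join p.1 q.1) (fun=> 0%N) <= B.
  rewrite /B (big_rem p) //= (big_rem q) //=.
  rewrite -addrA lerDl addr_ge0 //; first exact: sumr_ge0.
  by apply: sumr_ge0 => p' _; apply: sumr_ge0.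
apply: (@le_trans _ _ (A / k%:R)); last first.
  by rewrite ler_pdivrMr // mulrC -ler_pdivrMr // ltW.
rewrite /A (_ : d%:R * (M%:R * (M%:R / k%:R)) = d%:R * (M%:R * M%:R) / k%:R); last by field; rewrite gt_eqF.
rewrite mulrAC ler_wpM2r ?invr_ge0 ?ler0n //.
by rewrite ler_wpM2l // !mulr_ge0 ?ler0n.
Qed.

End Kernel.

(** * Dilation of a positive semidefinite kernel *)

Section PolyCombinations.
Variables (K : fieldType).
Implicit Types (p q : {poly K}).

(** The linear map sending the generator X^i to [F i]; multiplication of polynomials is not
    involved. *)
Definition comb (W : lmodType K) (F : nat -> W) p : W := \sum_(i < size p) p`_i *: F i.

Lemma comb_widen (W : lmodType K) (F : nat -> W) p m : (size p <= m)%N ->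
  comb F p = \sum_(i < m) p`_i *: F i.
Proof.
move=> pm; rewrite /comb (big_ord_widen m (fun i => p`_i *: F i)) // big_mkcond /=.
apply: eq_bigr => i _; case: ltnP => // ip.
by rewrite nth_default // scale0r.
Qed.

Lemma comb_lin (W : lmodType K) (F : nat -> W) : islin (comb F).
Proof.
move=> a p q; pose m := maxn (size (a *: p + q)) (maxn (size p) (size q)).
rewrite !(@comb_widen _ F _ m) ?leq_max ?leqnn ?orbT //.
rewrite scaler_sumr -big_split /=; apply: eq_bigr => i _.
by rewrite coefD coefZ scalerDl scalerA.
Qed.

Lemma combX (W : lmodType K) (F : nat -> W) n : comb F 'X^n = F n.
Proof.
rewrite /comb size_polyXn big_ord_recr /= big1 ?add0r => [|i _].
  by rewrite coefXn eqxx scale1r.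
by rewrite coefXn ltn_eqF // scale0r.
Qed.

Lemma poly_lin_eq (W : lmodType K) (S T : {poly K} -> W) : islin S -> islin T ->
  (forall n, S 'X^n = T 'X^n) -> forall p, S p = T p.
Proof.
move=> lS lT E p; rewrite -[p]coefK poly_def !islin_sum //.
by apply: eq_bigr => i _; rewrite (islinZ lS) (islinZ lT) E.
Qed.

End PolyCombinations.

Lemma iota_index_iota n : iota 0 n = index_iota 0 n.
Proof. by rewrite /index_iota subn0. Qed.

(** * Gram-Schmidt for a degenerate form *)

Section GramSchmidt.
Variables (R : realType) (H : lmodType R[i]) (B : hform H) (v : nat -> H).

(** As the inverse of 0 is 0, a null residual gives the zero vector: every [gse n] has norm 0 or 1
    and no generator need be discarded. *)
Definition normalize u : H := ((Num.sqrt (hq B u))^-1)%:C%C *: u.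

Definition residual (s : seq H) u := u - \sum_(e <- s) B u e *: e.

Fixpoint gs n : seq H :=
  if n is n'.+1 then rcons (gs n') (normalize (residual (gs n') (v n'))) else [::].

Definition gse n : H := normalize (residual (gs n) (v n)).

Lemma gsE n : gs n = [seq gse i | i <- iota 0 n].
Proof. by elim: n => // n IH; rewrite [LHS]/= -/(gse n) IH -addn1 iotaD map_cat cats1. Qed.

Lemma residualE n : residual (gs n) (v n) = v n - \sum_(i < n) B (v n) (gse i) *: gse i.
Proof. by rewrite /residual gsE big_map iota_index_iota big_mkord. Qed.

Lemma hq_normalize u : hq B (normalize u) = if hq B u == 0 then 0 else 1.
Proof.
rewrite /normalize hqZ sqmod_real exprVn sqr_sqrtr ?hq_ge0 //.
by case: eqP => [->|/eqP u0]; rewrite ?mulr0 // mulVf.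
Qed.

Lemma gse_hq n : hq B (gse n) = 0 \/ hq B (gse n) = 1.
Proof. by rewrite hq_normalize; case: eqP; [left|right]. Qed.

Lemma hf_gse_diag x i : B x (gse i) * B (gse i) (gse i) = B x (gse i).
Proof.
rewrite hqE; case: (gse_hq i) => E; last by rewrite E mulr1.
by rewrite hf_sym (hf_null _ E) conjc0 mul0r.
Qed.

Lemma gse_orth i j : i != j -> B (gse i) (gse j) = 0.
Proof.
suff K n : forall k, (k < n)%N -> B (gse n) (gse k) = 0.
  case: (ltngtP i j) => // ij _; last exact: K.
  by rewrite hf_sym K // conjc0.
have [m] := ubnP n; elim: m n => // m IH n nm k kn.
rewrite [gse n in LHS]/gse {1}/normalize hfZl.
suff -> : B (residual (gs n) (v n)) (gse k) = 0 by rewrite mulr0.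
rewrite residualE hfBl hf_suml [X in _ - X](bigD1 (Ordinal kn)) //= [X in _ - (_ + X)]big1 => [|l lk].
  by rewrite hfZl hf_gse_diag addr0 subrr.
rewrite hfZl; suff -> : B (gse l) (gse k) = 0 by rewrite mulr0.
have := ltn_ord l; move: lk; rewrite -val_eqE /= => lk ln.
case: (ltngtP (l : nat) k) lk => // h _; last by apply: IH => //; lia.
by rewrite hf_sym IH ?conjc0 //; lia.
Qed.

Lemma hf_v_gse n : B (v n) (gse n) = B (residual (gs n) (v n)) (gse n).
Proof.
rewrite residualE hfBl hf_suml big1 ?subr0 // => i _.
by rewrite hfZl gse_orth ?mulr0 // ltn_eqF.
Qed.

Lemma v_expansion n : hq B (v n - \sum_(i < n.+1) B (v n) (gse i) *: gse i) = 0.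
Proof.
rewrite big_ord_recr /= opprD addrA -residualE hf_v_gse.
set u := residual _ _; rewrite -[gse n]/(normalize u).
have [u0|u0] := eqVneq (hq B u) 0.
  by rewrite (hf_null _ u0) scale0r subr0.
rewrite /normalize hfZr conjc_real scalerA -mulrA [B u u * _]mulrC mulrA hqE.
rewrite -!rmorphM /= -invfM -expr2 sqr_sqrtr ?hq_ge0 // mulVf //.
by rewrite scale1r subrr hq0.
Qed.

Lemma v_above n i : (n < i)%N -> B (v n) (gse i) = 0.
Proof.
move=> ni; set w := \sum_(k < n.+1) B (v n) (gse k) *: gse k.
have -> : B (v n) (gse i) = B (v n - w) (gse i) + B w (gse i) by rewrite -hfDl subrK.
rewrite (hf_null _ (v_expansion n)) add0r hf_suml big1 // => k _.
by rewrite hfZl gse_orth ?mulr0 // ltn_eqF //; have := ltn_ord k; lia.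
Qed.

Lemma hq_sum_gse (s : seq nat) (c : nat -> R[i]) : uniq s ->
  hq B (\sum_(i <- s) c i *: gse i) <= \sum_(i <- s) sqmod (c i).
Proof.
elim: s => [|i s IH] /=; first by rewrite !big_nil hq0.
move=> /andP[si us]; rewrite !big_cons hqD hqZ.
have -> : B (c i *: gse i) (\sum_(k <- s) c k *: gse k) = 0.
  rewrite hf_sumr big_seq big1 // => k ks; rewrite hfZl hfZr gse_orth ?mulr0 //.
  by apply: contra si => /eqP ->.
rewrite mulr0 addr0; apply: lerD (IH us).
by case: (gse_hq i) => ->; rewrite ?mulr0 ?mulr1 ?sqmod_ge0.
Qed.

Lemma bessel_gse x (s : seq nat) : uniq s -> \sum_(i <- s) sqmod (B x (gse i)) <= hq B x.
Proof.
move=> us; set t := \sum_(i <- s) _; pose y := \sum_(i <- s) B x (gse i) *: gse i.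
have Exy : B x y = t%:C%C.
  rewrite hf_sumr rmorph_sum; apply: eq_bigr => i _.
  by rewrite hfZr mulrC mulc_conj.
have := hq_ge0 B (x - y); rewrite hqB Exy /=.
by have := hq_sum_gse (fun i => B x (gse i)) us; rewrite -/y -/t; lra.
Qed.

Lemma gs_coord_l2 x : l2 (fun i => B x (gse i)).
Proof.
apply/l2E/(rsummable_bounded (c := hq B x)) => [i|s us]; first exact: sqmod_ge0.
exact: bessel_gse.
Qed.

Definition coord x : L2 R nat := toL2 (gs_coord_l2 x).

Lemma coord_lin : islin coord.
Proof. by move=> a x y; apply: L2_inj => i; rewrite l2val_lin /= hf_lin. Qed.

Lemma coord_null x : hq B x = 0 -> coord x = 0.
Proof. by move=> x0; apply: L2_inj => i /=; rewrite (hf_null _ x0). Qed.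

Lemma coord_v n : coord (v n) = \sum_(i <- iota 0 n.+1) B (v n) (gse i) *: delta i.
Proof.
apply: L2_inj => i; rewrite l2val_sum_delta ?iota_uniq // mem_iota add0n leq0n andTb.
by case: ltnP => // ni; rewrite /= v_above.
Qed.

(** A generator has finitely many coordinates and equals its expansion up to a null vector, so both
    sides are the same finite sum. *)
Lemma coord_isometry_v n y : L2form (coord (v n)) (coord y) = B (v n) y.
Proof.
rewrite coord_v hf_suml.
have -> : B (v n) y = B (\sum_(i < n.+1) B (v n) (gse i) *: gse i) y.
  apply/eqP; rewrite -subr_eq0 -hfBl; apply/eqP; exact/hf_null/v_expansion.
rewrite hf_suml iota_index_iota big_mkord; apply: eq_bigr => i _.
by rewrite [LHS]hfZl [RHS]hfZl delta_ip -[l2val _ _]/(B y (gse i)) -hf_sym.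
Qed.

End GramSchmidt.

(** * The GNS construction *)

Section Dilation.
Variables (R : realType) (d : nat) (X : countType) (x0 : X) (k : X -> X -> R).
Variables (n n' : 'I_d -> X -> X).
Hypothesis k_sym : forall x y, k x y = k y x.
Hypothesis k_psd : psd k.
Hypothesis k_adj : forall j x y, k (n j x) y = k x (n' j y).
Hypothesis nn : forall j l x, n j (n l x) = n l (n j x).
Hypothesis nn' : forall j l x, n j (n' l x) = n' l (n j x).
Hypothesis k_bounded : forall x, exists C : R, forall w : seq 'I_d,
  k (word n w x) (word n w x) <= C.

Let g i : X := odflt x0 (unpickle i).
Let gK x : g (pickle x) = x. Proof. by rewrite /g pickleK. Qed.
Let kn i j : R[i]^o := ((k (g i) (g j))%:C)%C.

Let form (p q : {poly R[i]}) : R[i] :=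
  comb (fun i => ((comb (fun j => kn i j) q : R[i])^*)%C : R[i]^o) p.

Fact form_lin a p q r : form (a *: p + q) r = a * form p r + form q r.
Proof. exact: comb_lin. Qed.

Let formE (m : nat) (p q : {poly R[i]}) : (size p <= m)%N -> (size q <= m)%N ->
  form p q = \sum_(i < m) \sum_(j < m) p`_i * ((q`_j)^*)%C * kn i j.
Proof.
move=> pm qm; have S (a b : R[i]) (r : R) : a * (((b * (r%:C)%C)^*)%C) = a * (b^*)%C * (r%:C)%C.
  by rewrite conjcM conjc_real mulrA.
rewrite /form (comb_widen _ pm); apply: eq_bigr => i _.
rewrite (comb_widen _ qm) rmorph_sum scaler_sumr; apply: eq_bigr => j _.
exact: S.
Qed.

Fact form_sym p q : form q p = ((form p q)^*)%C.
Proof.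
pose m := maxn (size p) (size q).
have S (a b : R[i]) (r : R) : b * (a^*)%C * (r%:C)%C = ((a * (b^*)%C * (r%:C)%C)^*)%C.
  by rewrite !conjcM conjcK conjc_real [(a^*)%C * _]mulrC.
rewrite !(@formE m) ?leq_max ?leqnn ?orbT // rmorph_sum [LHS]exchange_big.
apply: eq_bigr => i _; rewrite rmorph_sum; apply: eq_bigr => j _.
by rewrite /kn k_sym; exact: S.
Qed.

Fact form_pos p : 0 <= complex.Re (form p p).
Proof.
rewrite (@formE (size p)) //.
have -> : complex.Re (\sum_(i < size p) \sum_(j < size p) p`_i * ((p`_j)^*)%C * kn i j) =
    \sum_(i < size p) \sum_(j < size p) complex.Re (p`_i) * complex.Re (p`_j) * k (g i) (g j) +
    \sum_(i < size p) \sum_(j < size p) complex.Im (p`_i) * complex.Im (p`_j) * k (g i) (g j).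
  have ReD (J : finType) (F : J -> R[i]) : complex.Re (\sum_i F i) = \sum_i complex.Re (F i).
    by apply: (big_morph (@complex.Re R)) => // [[? ?] [? ?]].
  rewrite ReD -big_split; apply: eq_bigr => i _ /=; rewrite ReD -big_split.
  apply: eq_bigr => j _ /=; rewrite /kn.
  by case: (p`_i) (p`_j) => [? ?] [? ?] /=; ring.
have P (c : nat -> R) : 0 <= \sum_(i < size p) \sum_(j < size p) c i * c j * k (g i) (g j).
  have := k_psd [seq (g i, c i) | i <- index_iota 0 (size p)].
  rewrite big_map big_mkord; congr (0 <= _); apply: eq_bigr => i _.
  by rewrite big_map big_mkord.
by rewrite addr_ge0 //; [exact: (P (fun i => complex.Re p`_i))|exact: (P (fun i => complex.Im p`_i))].
Qed.

Let B : hform {poly R[i]} := HForm form_lin form_sym form_pos.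

Let BX i j : B 'X^i 'X^j = kn i j.
Proof. by rewrite /B /= /form combX combX /kn conjc_real. Qed.

Let act (f : X -> X) (p : {poly R[i]}) : {poly R[i]} := comb (fun i => 'X^(pickle (f (g i)))) p.

Let act_lin f : islin (act f). Proof. exact: comb_lin. Qed.

Let actX f i : act f 'X^i = 'X^(pickle (f (g i))).
Proof. exact: combX. Qed.

Let act_comm f1 f2 : (forall x, f1 (f2 x) = f2 (f1 x)) ->
  forall p, act f1 (act f2 p) = act f2 (act f1 p).
Proof.
move=> f12; apply: poly_lin_eq => [a p q|a p q|i]; first by rewrite !act_lin.
  by rewrite !act_lin.
by rewrite !actX !gK f12.
Qed.

Let act_adj j p q : B (act (n j) p) q = B p (act (n' j) q).
Proof.
move: p; apply: (poly_lin_eq (W := R[i]^o)) => [a p r|a p r|i]; first by rewrite act_lin hf_lin.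
  by rewrite hf_lin.
apply: (can_inj (@conjcK R)); rewrite -!hf_sym; move: q.
apply: (poly_lin_eq (W := R[i]^o)) => [a p r|a p r|l]; first by rewrite hf_lin.
  by rewrite act_lin hf_lin.
by rewrite !actX !BX /kn !gK k_sym k_adj k_sym.
Qed.

Let A j := act (n j).
Let A' j := act (n' j).

Let AA j l p : A j (A l p) = A l (A j p). Proof. exact: act_comm. Qed.
Let AA' j l p : A j (A' l p) = A' l (A j p). Proof. exact: act_comm. Qed.

Let orbits p : bounded_orbit B A p.
Proof.
have wl w : islin (word A w) by apply: word_lin => j; exact: act_lin.
have Z a q : bounded_orbit B A q -> bounded_orbit B A (a *: q).
  move=> [C HC]; exists (sqmod a * C) => w; rewrite (islinZ (wl w)) hqZ.
  by rewrite ler_wpM2l ?sqmod_ge0.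
have D q r : bounded_orbit B A q -> bounded_orbit B A r -> bounded_orbit B A (q + r).
  move=> Hq Hr; rewrite -[r]opprK; apply: bounded_orbitB => //; first by move=> j; exact: act_lin.
  by rewrite -scaleN1r; exact: Z.
rewrite -[p]coefK poly_def; apply: big_ind => [|//|i _].
  by exists 0 => w; rewrite (islin0 (wl w)) hq0.
apply: Z; have [C HC] := k_bounded (g i); exists C => w.
(* [i] need not be the code of [g i], so the empty word is a separate case. *)
have -> : word A w 'X^i = 'X^(if w is [::] then i else pickle (word n w (g i))).
  elim: w => // j w IH; rewrite word_cons IH [A j _]actX; case: w {IH} => //= l w.
  by rewrite gK.
rewrite /hq BX /kn /=.
have := HC w; case: w => //= j w.
by rewrite gK.
Qed.

(** Orbits of generators are bounded by hypothesis, hence all orbits are; with normality this forces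
    contractivity, exactly as in the necessity part. *)
Let cA j p : hq B (A j p) <= hq B p.
Proof.
by apply: (hq_contractive (A := A) (A' := A')) => //; move=> ?; exact: act_lin.
Qed.

Let cA' j p : hq B (A' j p) <= hq B p.
Proof. by rewrite (hq_adj (A := A) act_adj AA'). Qed.

Let e := gse B (fun i => 'X^i).
Let U := coord B (fun i => 'X^i).
Let lU : islin U. Proof. exact: coord_lin. Qed.

Let U_form p q : L2form (U p) (U q) = B p q.
Proof.
move: p; apply: (poly_lin_eq (W := R[i]^o)) => [a p r|a p r|i].
- by rewrite lU hf_lin.
- by rewrite hf_lin.
- exact: (coord_isometry_v B (fun i => 'X^i)).
Qed.

(** [S] is prescribed on [delta i] by the image of the i-th orthonormalized vector; coordinates with
    null [e i] are sent to 0. Intertwining is checked on generators, which agree with their finite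
    expansions up to null vectors, and [T] preserves null vectors. *)
Let extend (T : {poly R[i]} -> {poly R[i]}) : islin T -> (forall p, hq B (T p) <= hq B p) ->
  exists S : L2 R nat -> L2 R nat, [/\ contraction S, forall i, S (delta i) = U (T (e i))
    & forall p, S (U p) = U (T p)].
Proof.
move=> lT cT.
have cf : contractive_family (fun i => U (T (e i))).
  move=> s c us.
  under eq_bigr do rewrite -(islinZ lU) -(islinZ lT).
  rewrite -(islin_sum lU) -(islin_sum lT).
  rewrite /hq U_form; apply: le_trans (cT _) _; exact: hq_sum_gse.
have [S [cS HS]] := extension_exists cf; have [lS bS] := cS.
exists S; split=> //; apply: poly_lin_eq => [a p q|a p q|i].
- by rewrite lU lS.
- by rewrite lT lU.
rewrite [U 'X^i]coord_v (islin_sum lS).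
under eq_bigr do rewrite (islinZ lS) HS -(islinZ lU) -(islinZ lT).
rewrite -(islin_sum lU) -(islin_sum lT).
rewrite iota_index_iota big_mkord.
set w := \sum_(l < _) _; apply/eqP; rewrite eq_sym -subr_eq0 -(islinB lU) -(islinB lT).
apply/eqP/coord_null/eqP; rewrite eq_le hq_ge0 andbT.
by apply: le_trans (cT _) _; rewrite v_expansion.
Qed.

Theorem dilation : exists (G : X -> L2 R nat) (N N' : 'I_d -> L2 R nat -> L2 R nat),
  [/\ forall x y, L2form (G x) (G y) = ((k x y)%:C)%C,
      forall j, contraction (N j) /\ contraction (N' j),
      forall j f h, L2form (N j f) h = L2form f (N' j h),
      (forall j l f, N j (N l f) = N l (N j f)) /\ (forall j f, N j (N' j f) = N' j (N j f))
    & forall j x, N j (G x) = G (n j x)].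
Proof.
have [N HN] := choice (fun j => extend (act_lin (n j)) (cA j)).
have [N' HN'] := choice (fun j => extend (act_lin (n' j)) (cA' j)).
exists (fun x => U 'X^(pickle x)), N, N'.
have N1 j : islin (N j) by have [[]] := HN j.
have N1' j : islin (N' j) by have [[]] := HN' j.
have N2 j f : hq L2form (N j f) <= hq L2form f by have [[_]] := HN j.
have N2' j f : hq L2form (N' j f) <= hq L2form f by have [[_]] := HN' j.
have N3 j i : N j (delta i) = U (A j (e i)) by have [] := HN j.
have N3' j i : N' j (delta i) = U (A' j (e i)) by have [] := HN' j.
have N4 j p : N j (U p) = U (A j p) by have [] := HN j.
have N4' j p : N' j (U p) = U (A' j p) by have [] := HN' j.
have lin2 (S T : L2 R nat -> L2 R nat) : islin S -> islin T -> islin (fun f => S (T f)).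
  by move=> lS lT a f h; rewrite lT lS.
split.
- by move=> x y; rewrite U_form BX /kn !gK.
- by move=> j; split; split.
- move=> j; apply: form_adj => // i l.
  have cE p r : l2val (U p) r = B p (e r) by [].
  by rewrite N3 N3' L2ip_delta delta_ip !cE -hf_sym; exact: act_adj.
- split=> [j l f|j f].
    apply: (L2_lin_eq (B := L2form) (c := 1) (T1 := fun f => N j (N l f))
      (T2 := fun f => N l (N j f))) => //; try exact: lin2; try exact: L2_definite.
    + by move=> h; rewrite mul1r; apply: le_trans (N2 _ _) (N2 _ _).
    + by move=> h; rewrite mul1r; apply: le_trans (N2 _ _) (N2 _ _).
    + by move=> i; rewrite !N3 !N4 AA.
  apply: (L2_lin_eq (B := L2form) (c := 1) (T1 := fun f => N j (N' j f))
      (T2 := fun f => N' j (N j f))) => //; try exact: lin2; try exact: L2_definite.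
  + by move=> h; rewrite mul1r; apply: le_trans (N2 _ _) (N2' _ _).
  + by move=> h; rewrite mul1r; apply: le_trans (N2' _ _) (N2 _ _).
  + by move=> i; rewrite N3 N3' N4 N4' AA'.
- by move=> j x; rewrite N4 [A j _]actX gK.
Qed.

End Dilation.

(** * Sufficiency and the main theorem *)

Lemma isometry_of_basis (R : realType) (V I : choiceType) (T : L2 R V -> L2 R I) :
  contraction T ->
  (forall v w, L2form (T (delta v)) (T (delta w)) = L2form (delta v) (delta w)) ->
  forall f, hq L2form (T f) = hq L2form f.
Proof.
move=> [lT bT] E f.
have bound (g h : L2 R V) : sqmod (L2form (T g) (T h) - L2form g h) <= 4 * hq L2form h * hq L2form g.
  apply: (le_trans (sqmodB_le _ _)).
  have h1 := cauchy_schwarz L2form (T g) (T h); have h2 := cauchy_schwarz L2form g h.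
  have h3 := ler_pM (hq_ge0 _ _) (hq_ge0 _ _) (bT g) (bT h).
  by lra.
have E1 v g : L2form (T g) (T (delta v)) = L2form g (delta v).
  apply/eqP; rewrite -subr_eq0; apply/eqP.
  apply: (L2_functional0 (phi := fun g => L2form (T g) (T (delta v)) - L2form g (delta v))
    (c := 4 * hq L2form (delta v))) => [a u w|u|w].
  - by rewrite lT !hf_lin; ring.
  - exact: bound.
  - by rewrite E subrr.
suff K g : L2form (T g) (T f) - L2form g f = 0 by rewrite /hq; move/eqP: (K f); rewrite subr_eq0 => /eqP ->.
apply: (L2_functional0 (phi := fun g => L2form (T g) (T f) - L2form g f)
    (c := 4 * hq L2form f)) => [a u w|u|w].
- by rewrite lT !hf_lin; ring.
- exact: bound.
- by rewrite hf_sym E1 -hf_sym subrr.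
Qed.

Lemma contractive_of_orthonormal (R : realType) (V I : choiceType) (G : V -> L2 R I) :
  (forall v w, L2form (G v) (G w) = if v == w then 1 else 0) -> contractive_family G.
Proof.
move=> oG s c; elim: s => [|v s IH] /=; first by rewrite !big_nil hq0.
move=> /andP[vs us]; rewrite !big_cons hqD hqZ.
rewrite [X in complex.Re X](_ : _ = 0).
  rewrite mulr0 addr0; apply: lerD (IH us).
  by rewrite /hq oG eqxx mulr1.
rewrite hf_sumr big_seq big1 // => w ws; rewrite hfZl hfZr oG.
by case: eqP => [vw|_]; rewrite ?mulr0 //; rewrite vw ws in vs.
Qed.

Lemma completely_monotone_scale (R : realType) (d : nat) (a : R) (F : ('I_d -> nat) -> R) :
  0 < a -> completely_monotone (fun m => a * F m) <-> completely_monotone F.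
Proof.
move=> a0; split=> H al be; have := H al be; rewrite nablaPow_scale ?pmulr_rge0 //.
Qed.

Section Main.
Variables (R : realType) (d : nat) (U : 'I_d -> countType).
Variables (E : forall j, U j -> U j -> Prop) (root : forall j, U j).
Variables (lam : 'I_d -> prodV U -> R).
Arguments E : clear implicits.
Hypothesis tr : forall j, rooted_directed_tree (E j) (root j).
Hypothesis lam_gt0 : forall j (w : prodV U), w j <> root j -> 0 < lam j w.
Local Notation V := (prodV U).
Local Notation S := (multishift E root lam).
Hypothesis bS : forall j, bounded_op (S j).
Hypothesis SS : forall j k, commute_op (S j) (S k).
Hypothesis cS : forall j f, l2 f -> nrm2 (S j f) <= nrm2 f.
Local Notation depth := (depthV E root).
Local Notation desc := (descV E root).
Local Notation join := (joinV E root).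
Local Notation compatible := (compatibleV E root).
Local Notation le_V := (le_V E root).
Implicit Types (v w : V) (m : 'I_d -> nat).

Section WithWeights.
Variable L : V -> R.
Hypothesis L_gt0 : forall w, 0 < L w.
Hypothesis LS : forall j w, w j <> root j -> L w = lam j w * L (pack E j w).
Local Notation psi := (level_mass E root L).

Lemma psi_unique_child j v : v j <> root j ->
  (forall z, E j (parent (E j) (v j)) z -> z = v j) ->
  forall m, psi (pack E j v) (shift_e m j) = psi v m.
Proof.
move=> vr uniq_child m; rewrite /level_mass; congr rsum; apply/funext => y.
congr (if _ then _ else _); apply: asbool_equiv_eq.
have D k : depth v k = (depth (pack E j v) k + (k == j))%N by rewrite (depth_pack tr vr).
split=> H k; have [dk ak] := H k; split; move: (D k) dk ak; rewrite /shift_e.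
- by move=> -> ->; lia.
- have [->|kj] := eqVneq k j; last by rewrite !addn0 pack_other // => _ _ ->.
  rewrite !addn1 pack_same => Dj dj.
  rewrite /anc iterS => ap; apply: uniq_child; rewrite -ap; apply: (parent_edge (tr j)) => zr.
  have := tdepth_anc (tr j) (m j) (y j).
  rewrite /anc zr (tdepth_root (tr j)) -/(depth y j) dj; lia.
- by move=> -> ->; lia.
- have [->|kj] := eqVneq k j; last by rewrite !addn0 pack_other // => _ _ ->.
  by rewrite !addn1 pack_same /anc iterS => _ _ ->.
Qed.

Lemma cm_from_branching :
  (forall v, (forall j, v j = root j \/ exists u : U j, Vprec (E j) u /\ E j u (v j)) ->
     completely_monotone (psi v)) ->
  forall v, completely_monotone (psi v).
Proof.
move=> H v; move: {2}(depth v) (erefl (depth v)) => m.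
have [n] := ubnP (\sum_j m j)%N; elim: n m v => // n IH m v mn vm.
have [Hv|] := pselect (forall j, v j = root j \/ exists u : U j, Vprec (E j) u /\ E j u (v j)).
  exact: H.
move/existsNP => [j /not_orP [vr nb]].
have D := depth_pack tr vr.
have cm : completely_monotone (psi (pack E j v)).
  apply: (IH (depth (pack E j v))) => //.
  have s1 : (\sum_(i < d) (i == j) = 1)%N.
    by rewrite (bigD1 j) //= eqxx big1 ?addn0 // => i /negbTE ->.
  have e1 : (\sum_i m i = \sum_i depth (pack E j v) i + 1)%N.
    by rewrite -vm D /shift_e big_split /= s1.
  by rewrite e1 addn1 ltnS in mn.
have uc z : E j (parent (E j) (v j)) z -> z = v j.
  move=> pz; apply: contrapT => zv; apply: nb; exists (parent (E j) (v j)).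
  by have pv := parent_edge (tr j) vr; split=> //; exists z, (v j).
move=> al be; rewrite (_ : psi v = fun m => psi (pack E j v) (shift_e m j)).
  by rewrite nablaPow_shift; exact: cm.
by apply/funext => k; rewrite psi_unique_child.
Qed.

Section Sufficiency.
Hypothesis psi_cm : forall v, completely_monotone (psi v).

(** Gram-Schmidt needs an enumeration of the symbols, so vertices are re-encoded as finite dependent
    functions, which form a [countType]. *)
Let X : countType :=
  ({dffun forall j, U j} * ({ffun 'I_d -> nat} * {ffun 'I_d -> nat}))%type.
Let toP (x : X) : point U := ((fun j => x.1 j : U j) : V, x.2).
Let ofV v (r : {ffun 'I_d -> nat}) : X := ([ffun j => v j], ([ffun=> 0%N], r)).
Let bump (f : {ffun 'I_d -> nat}) j := [ffun i => (f i + (i == j))%N].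
Let n j (x : X) : X := (x.1, (x.2.1, bump x.2.2 j)).
Let n' j (x : X) : X := (x.1, (bump x.2.1 j, x.2.2)).
Let k (x y : X) : R := kernel E root psi (toP x) (toP y).

Let bumpC f i j : bump (bump f i) j = bump (bump f j) i.
Proof. by apply/ffunP => l; rewrite !ffunE addnAC. Qed.

Let fibers := psi_add_fiber tr bS SS cS L_gt0 LS.

Let k_psd : psd k.
Proof. by apply: (psd_comp toP); apply: kernel_psd => //; exact: fibers. Qed.

Let k_sym (x y : X) : k x y = k y x.
Proof.
rewrite /k /kernel eq_sym; case: eqP => //= c.
rewrite (asbool_equiv_eq (compatibleC E root _ _)); case: asboolP => // comp.
rewrite (joinC comp); congr (psi _ _); apply/funext => j.
by rewrite (chargeP c).
Qed.

Let charge_eq (x y : X) : (charge E root (toP x) == charge E root (toP y)) =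
  [forall j, (depth (toP x).1 j + x.2.2 j + y.2.1 j == depth (toP y).1 j + y.2.2 j + x.2.1 j)%N].
Proof.
apply/eqP/forallP => [c j|c]; first by have := chargeP c j; rewrite /hgt => ->.
apply/ffunP => j; rewrite !ffunE /hgt; have /eqP := c j; rewrite /=.
by lia.
Qed.

Let k_adj j (x y : X) : k (n j x) y = k x (n' j y).
Proof.
rewrite /k /kernel !charge_eq.
have -> : [forall i, (depth (toP (n j x)).1 i + (n j x).2.2 i + y.2.1 i ==
      depth (toP y).1 i + y.2.2 i + (n j x).2.1 i)%N] =
    [forall i, (depth (toP x).1 i + x.2.2 i + (n' j y).2.1 i ==
      depth (toP (n' j y)).1 i + (n' j y).2.2 i + x.2.1 i)%N].
  by apply: eq_forallb => i; rewrite /= !ffunE addnA addnAC -!addnA [(x.2.2 i + _)%N]addnC !addnA;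
    congr (_ == _); rewrite addnAC; lia.
case: ifP => // _; congr (psi _ _); apply/funext => i.
by rewrite /hgt /= !ffunE; congr (_ - _)%N; lia.
Qed.

Let word_fst (w : seq 'I_d) (x : X) : (word n w x).1 = x.1.
Proof. by elim: w. Qed.

Let k_bounded (x : X) : exists C : R, forall w : seq 'I_d, k (word n w x) (word n w x) <= C.
Proof.
exists (L (join (toP x).1 (toP x).1) ^+ 2) => w; rewrite /k /kernel.
case: ifP => _; last by rewrite sqr_ge0.
rewrite /toP /= !word_fst.
exact: (psi_le tr bS SS cS L_gt0 LS).
Qed.

Let toPV v r : (toP (ofV v r)).1 = v.
Proof. by apply: functional_extensionality_dep => j; rewrite /= ffunE. Qed.

Let k_ofV v w r r' : k (ofV v r) (ofV w r') =
  if `[< (forall j, depth v j + r j = depth w j + r' j)%N /\ compatible v w >] then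
    psi (join v w) (fun j => depth v j + r j - depth (join v w) j)%N else 0.
Proof.
rewrite /k /kernel charge_eq !toPV.
have -> : (fun j => hgt E root (toP (ofV v r)) j + (toP (ofV w r')).2.1 j - depth (join v w) j)%N =
   (fun j => depth v j + r j - depth (join v w) j)%N.
  by apply/funext => j; rewrite /hgt toPV /= ffunE addn0.
congr (if _ then _ else _).
apply/andP/asboolP => [[/forallP H /asboolP c]|[H c]].
  by split=> // j; have /eqP := H j; rewrite /= !ffunE !addn0.
split; last by apply/asboolP.
by apply/forallP => j; rewrite /= !ffunE !addn0 H.
Qed.

Let zero : {ffun 'I_d -> nat} := [ffun=> 0%N].

Lemma sufficiency : joint_subnormal S.
Proof.
have nn j l x : n j (n l x) = n l (n j x) by rewrite /n /= bumpC.
have nn' j l x : n j (n' l x) = n' l (n j x) by [].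
have [G [N [N' [GG cN adj [NN NN'] NG]]]] :=
  dilation (ofV (root : V) zero) k_sym k_psd k_adj nn nn' k_bounded.
have [T [lT ET bT TT]] := lift_tuple bS SS cS.
pose g v : L2 R nat := ((L v)^-1)%:C%C *: G (ofV v zero).
have lN j : islin (N j) by have [[]] := cN j.
have lN' j : islin (N' j) by have [_ []] := cN j.
have bN j f : hq L2form (N j f) <= hq L2form f by have [[_]] := cN j.
have bN' j f : hq L2form (N' j f) <= hq L2form f by have [_ [_]] := cN j.
have gip v w (a b : R) r r' : L2form (a%:C%C *: G (ofV v r)) (b%:C%C *: G (ofV w r')) =
    (a * b * k (ofV v r) (ofV w r'))%:C%C.
  by rewrite hfZl hfZr GG conjc_real -!rmorphM /= mulrA.
have gg v w : L2form (g v) (g w) = if v == w then 1 else 0.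
  rewrite gip k_ofV; case: asboolP => [[dvw [vj wj]]|H].
    (* Zero exponents and equal charges mean equal depths, and compatible vertices of equal depth
       coincide. *)
    have vw : v = w.
      have dv j : depth v j = depth w j by have := dvw j; rewrite /zero !ffunE !addn0.
      have jw : join v w = w.
        by apply: functional_extensionality_dep => j; rewrite /joinV dv leqnn.
      rewrite jw in vj; apply: functional_extensionality_dep => j.
      by have [_] := vj j; rewrite -!/(depth _ j) dv subnn.
    rewrite vw eqxx (join_le (le_V_refl E root w)).
    rewrite (_ : (fun j => _) = (fun=> 0%N)); last first.
      by apply/funext => j; rewrite /zero ffunE addn0 subnn.
    rewrite psi0; congr Complex; field.
    by rewrite gt_eqF.
  case: eqP => [vw|_]; last by rewrite mulr0.
  case: H; rewrite vw; split=> //.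
  by rewrite /compatibleV (join_le (le_V_refl E root w)); split; exact: le_V_refl.
have [J [cJ EJ]] := extension_exists (contractive_of_orthonormal gg).
have [lJ bJ] := cJ.
have iJ : forall f, hq L2form (J f) = hq L2form f.
  by apply: isometry_of_basis => // v w; rewrite !EJ gg delta_orth.
pose one j : 'I_d -> nat := shift_e (fun=> 0%N) j.
have TE j v : T j (delta v) = mpow T (one j) (delta v).
  by rewrite (mpowS (P := fun=> True)) // mpow0.
have Tval j v w : l2val (T j (delta v)) w =
    if `[< desc (one j) v w >] then (L w / L v)%:C%C else 0.
  rewrite TE (mpow_lift _ _ ET) -opPowE.
  exact: (pow_basis tr bS SS cS L_gt0 LS).
have Tnrm j v : hq L2form (T j (delta v)) = (L v ^+ 2)^-1 * psi v (one j).
  rewrite TE L2_hq (mpow_lift _ _ ET) -opPowE.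
  exact: (nrm2_pow_basis tr bS SS cS L_gt0 LS).
(* With s = S_j e_v, an infinite combination in general, the square of the norm of N g_v - J s is
   expanded. It vanishes because the cross term B(J s, N g_v) equals the square norm of s and
   because both vectors have that square norm, namely psi_v(eps_j) / L(v)^2. *)
have NJ_basis j v : N j (g v) = J (T j (delta v)).
  set s := T j (delta v).
  have aE : N j (g v) = ((L v)^-1)%:C%C *: G (ofV v (bump zero j)).
    by rewrite (islinZ (lN j)) NG.
  have cross f : L2form (J f) (N j (g v)) = L2form f s.
    apply/eqP; rewrite -subr_eq0; apply/eqP.
    apply: (L2_functional0 (phi := fun f => L2form (J f) (N j (g v)) - L2form f s)
      (c := 4)) => [a u w|u|w].
    - by rewrite lJ !hf_lin; ring.
    - apply: (le_trans (sqmodB_le _ _)).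
      have h1 := cauchy_schwarz L2form (J u) (N j (g v)).
      have h2 := cauchy_schwarz L2form u s.
      have h3 := bN j (g v); have h4 := bT j (delta v).
      have g1 : hq L2form (g v) = 1 by rewrite /hq gg eqxx.
      rewrite g1 in h3; rewrite hq_delta -/s in h4; rewrite iJ in h1.
      have h5 := ler_wpM2l (hq_ge0 L2form u) h3; have h6 := ler_wpM2l (hq_ge0 L2form u) h4.
      by lra.
    - apply/eqP; rewrite subr_eq0; apply/eqP.
      rewrite EJ aE gip delta_ip Tval k_ofV.
      case: (asboolP (desc _ _ _)) => [/desc_le[vw dw]|H].
        have dvw i : (depth v i <= depth w i)%N by rewrite dw leq_addr.
        have c : compatible w v.
          by apply/compatibleC; rewrite /compatibleV (join_le vw); split=> //; exact: le_V_refl.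
        rewrite asboolT; last first.
          by split=> // i; rewrite dw /zero !ffunE /one /shift_e addn0.
        rewrite (joinC c) (join_le vw) (_ : (fun i => _) = (fun=> 0%N)); last first.
          by apply/funext => i; rewrite /zero ffunE addn0 subnn.
        rewrite psi0 conjc_real; congr Complex; field.
        by rewrite !gt_eqF.
      rewrite conjc0 asboolF ?mulr0 // => -[dw [wj vj]]; apply: H; apply/desc_le.
      have dwE i : depth w i = (depth v i + one j i)%N.
        by have := dw i; rewrite /zero !ffunE addn0.
      split=> //.
      have jw : join v w = w.
        by apply: functional_extensionality_dep => i; rewrite /joinV dwE leq_addr.
      have [vw _] := (iffLR (compatibleC E root w v)) (conj wj vj).
      by rewrite jw in vw.
  apply/eqP; rewrite -subr_eq0; apply/eqP/L2_definite.
  rewrite hqB iJ hf_sym cross -hf_sym.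
  have -> : hq L2form (N j (g v)) = hq L2form s.
    rewrite aE /hq gip k_ofV asboolT; last first.
      split=> //; rewrite /compatibleV (join_le (le_V_refl E root v)).
      by split; exact: le_V_refl.
    rewrite -/(hq _ s) Tnrm (join_le (le_V_refl E root v)) /=.
    rewrite (_ : (fun i => _) = one j).
      by rewrite -invfM -expr2.
    by apply/funext => i; rewrite addKn !ffunE.
  by rewrite -/(hq _ s); lra.
have NJ j f : N j (J f) = J (T j f).
  move: f; apply: (L2_lin_eq (B := L2form) (c := 1)
    (T1 := fun f => N j (J f)) (T2 := fun f => J (T j f))) => //.
  - exact: L2_definite.
  - by move=> a u w; rewrite lJ lN.
  - by move=> a u w; rewrite lT lJ.
  - by move=> u; rewrite mul1r; apply: le_trans (bN _ _) (bJ _).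
  - by move=> u; rewrite mul1r; apply: le_trans (bJ _) (bT _ _).
  - by move=> v; rewrite EJ NJ_basis.
have opE (V' I' : choiceType) (P : L2 R V' -> L2 R I') f (lf : l2 f) :
  unlift P f = l2val (P (toL2 lf)) by rewrite -unliftE.
exists nat, (unlift J), (fun j => unlift (N j)); split.
- split=> [f _|a f h lf lh|f lf]; first exact: unlift_l2.
    exact: unlift_lin.
  by rewrite (opE _ _ _ _ lf) -L2_hq iJ L2_hq.
- move=> j.
  have bd (P : L2 R nat -> L2 R nat) : islin P -> (forall f, hq L2form (P f) <= hq L2form f) ->
      bounded_op (unlift P).
    by move=> lP bP; apply: (unlift_bounded (c := 1)) => // f; rewrite mul1r.
  split; first exact: bd.
  exists (unlift (N' j)); split; first split; first exact: bd.
    move=> f h lf lh; rewrite (opE _ _ _ _ lf) (opE _ _ _ _ lh).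
    exact: (adj j (toL2 lf) (toL2 lh)).
  move=> f lf; rewrite !(opE _ _ _ _ lf) !unliftE.
  by rewrite NN'.
- by move=> j l f lf; rewrite !(opE _ _ _ _ lf) !unliftE NN.
- move=> j f lf; rewrite (opE _ _ _ _ lf) unliftE NJ -unliftE ET.
  by [].
Qed.

End Sufficiency.
End WithWeights.

Lemma chi_alpha_depth v : ChiAlpha E (depth v) [set (root : V)] v.
Proof.
rewrite /ChiAlpha.
(* Generalize to the coordinates already processed: w agrees with v on [l] and with the root
   elsewhere. *)
suff H (l : seq 'I_d) : uniq l -> forall w : V, (forall j, j \in l -> w j = v j) ->
    (forall j, j \notin l -> w j = root j) ->
    foldr (fun j B => iter (depth v j) (ChiV E j) B) [set (root : V)] l w.
  by apply: H => [|//|j]; [exact: enum_uniq | rewrite mem_enum].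
elim: l => [|j l IH] /= ul w wl wr.
  by apply: functional_extensionality_dep => j; exact: wr.
case/andP: ul => jl ul.
set A := foldr _ _ _.
have dw : depth w j = depth v j by rewrite /depthV wl // mem_head.
have {}IH (w' : V) : (forall k, k != j -> w' k = w k) -> w' j = root j -> A w'.
  move=> e ej; apply: IH => // k kl.
    rewrite e; first by apply: wl; rewrite inE kl orbT.
    by apply: contraNneq jl => <-.
  have [->//|kj] := eqVneq k j.
  by rewrite e // wr // inE negb_or kj.
suff G (m : nat) : forall w : V, (forall w' : V, (forall k, k != j -> w' k = w k) ->
    w' j = root j -> A w') -> depth w j = m -> iter m (ChiV E j) A w by exact: G.
clearbody A; clear -tr; elim: m => [|m IHm] w IH wm /=.
  by apply: IH => //; apply: (tdepth0 (tr j)).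
have wr : w j <> root j.
  by move=> wr; move: wm; rewrite /depthV wr (tdepth_root (tr j)).
exists (pack E j w); split.
- apply: IHm => [w' e ej|].
    by apply: IH => // k kj; rewrite e // pack_other.
  by apply: succn_inj; rewrite -wm (depth_pack tr wr) /shift_e eqxx addn1.
- by rewrite pack_same; exact: (parent_edge (tr j)).
- by move=> k kj; rewrite pack_other.
Qed.

Lemma branching_index_ge j (u : U j) : Vprec (E j) u ->
  ((tdepth (E j) (root j) u).+1%:R%:E <= branching_index R (E j) (root j))%E.
Proof.
move=> bu; rewrite /branching_index asboolT; last by exists u.
rewrite -natr1 addrC EFinD; apply: leeD2l; apply: ereal_sup_ubound.
exists (tdepth (E j) (root j) u) => //; exists u; split=> //.
exact: (tdepthP (tr j)).
Qed.

Lemma branching_index_ge0 j : (0 <= branching_index R (E j) (root j))%E.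
Proof.
have [[u bu]|H] := pselect (exists u : U j, Vprec (E j) u).
  by apply: le_trans (branching_index_ge bu); rewrite lee_fin.
by rewrite /branching_index asboolF.
Qed.

(** Take for alpha the depth of v: a non-root coordinate is the child of a branching vertex, and the
    summand 1 in the branching index accounts for that one step. *)
Lemma Wt_sub_W v :
  (forall j, v j = root j \/ exists u : U j, Vprec (E j) u /\ E j u (v j)) ->
  exists alpha : 'I_d -> nat,
    (forall j, ((alpha j)%:R%:E <= branching_index R (E j) (root j))%E)
    /\ ChiAlpha E alpha [set (root : V)] v.
Proof.
move=> H; exists (depth v); split; last exact: chi_alpha_depth.
move=> j; case: (H j) => [vr|[u [bu uv]]].
  by rewrite /depthV vr (tdepth_root (tr j)); exact: branching_index_ge0.
by rewrite /depthV (tdepth_child (tr j) uv); exact: branching_index_ge.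
Qed.

Lemma subnormal_of_cm :
  (forall v, (forall j, v j = root j \/ exists u : U j, Vprec (E j) u /\ E j u (v j)) ->
     completely_monotone (fun al => nrm2 (opPow S al (basis_vec R v)))) ->
  joint_subnormal S.
Proof.
have [L [L_gt0 LS]] := weight_exists tr lam_gt0 bS SS cS.
move=> H; apply: (sufficiency L_gt0 LS); apply: cm_from_branching => v Hv.
apply/(@completely_monotone_scale _ _ (L v ^+ 2)^-1); first by rewrite invr_gt0 exprn_gt0.
have := H v Hv; congr (completely_monotone _); apply/funext => m.
exact: (nrm2_pow_basis tr bS SS cS L_gt0 LS).
Qed.

End Main.

Theorem mainTheorem7 (R : realType) (d : nat) (U : 'I_d -> countType)
    (E : forall j : 'I_d, U j -> U j -> Prop) (root : forall j : 'I_d, U j)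
    (lam : 'I_d -> prodV U -> R) :
  (0 < d)%N ->
  (forall j, rooted_directed_tree (E j) (root j)) ->
  (forall j, leafless (E j)) ->
  (forall j (w : prodV U), w j <> root j -> 0 < lam j w) ->
  let S := multishift E root lam in
  (forall j, bounded_op (S j)) ->
  (forall j k, commute_op (S j) (S k)) ->
  (forall j f, l2 f -> nrm2 (S j f) <= nrm2 f) ->
  let W := [set v : prodV U | exists alpha : 'I_d -> nat,
              (forall j, ((alpha j)%:R%:E <= branching_index R (E j) (root j))%E)
              /\ ChiAlpha E alpha [set root] v] in
  let Wt := [set v : prodV U | forall j,
               v j = root j \/ exists u, Vprec (E j) u /\ E j u (v j)] in
  let phi := fun v alpha => nrm2 (opPow S alpha (basis_vec R v)) in
  [/\ (joint_subnormal S <-> forall v, W v -> completely_monotone (phi v)),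
      ((forall v, W v -> completely_monotone (phi v)) <->
       (forall v, Wt v -> completely_monotone (phi v)))
    & (joint_subnormal S <-> forall v, Wt v -> completely_monotone (phi v))].
Proof.
move=> _ tr _ lam_gt0 S bS SS cS W Wt phi.
have necessity : joint_subnormal S -> forall v, completely_monotone (phi v).
  by move=> sn v; apply: (subnormal_cm bS SS cS sn); exact: l2_basis.
have sufficient : (forall v, Wt v -> completely_monotone (phi v)) -> joint_subnormal S.
  exact: (subnormal_of_cm tr lam_gt0 bS SS cS).
(* (i) gives monotonicity at every vertex, in particular on [W]; this inclusion brings (ii) down to
   (iii), which gives back (i). *)
have WtW v : Wt v -> W v by exact: (Wt_sub_W R tr).
have WWt : (forall v, W v -> completely_monotone (phi v)) ->
    forall v, Wt v -> completely_monotone (phi v) by move=> H v /WtW; exact: H.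
split; split.
- by move=> /necessity H v _.
- by move/WWt/sufficient.
- exact: WWt.
- by move=> /sufficient/necessity H v _.
- by move=> /necessity H v _.
- exact: sufficient.
Qed.
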